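(* Let $K\subseteq(0,1)$ be compact and let $H:\mathbb{R}\to K$ be a function for which there exists a constant $C_H>0$ such that $$|H(x)-H(y)|\le\frac{C_H}{|\log|x-y||}\qquad\text{for all }x\neq y\text{ with }|x-y|<1.$$ Let $(\xi_{j,k})_{(j,k)\in\mathbb{N}\times\mathbb{Z}}$ be independent $\mathcal{N}(0,1)$ random variables and let $$f_H=\sum_{j\in\mathbb{N}}\sum_{k\in\mathbb{Z}}\xi_{j,k}2^{-H(k2^{-j})j}\psi(2^j\cdot-k),$$ where $\psi$ is a wavelet as described in the context. Let $I$ be any non-empty open interval of $\mathbb{R}$. Almost surely the following holds: (1) For almost every $t\in I$ (with respect to Lebesgue measure), $$\limsup_{s\to t}\frac{|f_H(s)-f_H(t)|}{\omega_o^{(H(t))}(|s-t|)}<+\infty,$$ and for every modulus of continuity $\omega$ with $\omega=o(\omega_o^{(H(t))})$, $\displaystyle\limsup_{s\to t}\frac{|f_H(s)-f_H(t)|}{\omega(|s-t|)}=+\infty$. (2) There exists $t\in I$ such that $$\limsup_{s\to t}\frac{|f_H(s)-f_H(t)|}{\omega_r^{(H(t))}(|s-t|)}<+\infty,$$ and for every modulus of continuity $\omega$ with $\omega=o(\omega_r^{(H(t))})$, $\displaystyle\limsup_{s\to t}\frac{|f_H(s)-f_H(t)|}{\omega(|s-t|)}=+\infty$. (3) There exists $t\in I$ such that $$\limsup_{s\to t}\frac{|f_H(s)-f_H(t)|}{\omega_s^{(H(t))}(|s-t|)}<+\infty,$$ and for every modulus of continuity $\omega$ with $\omega=o(\omega_s^{(H(t))})$,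 $\displaystyle\limsup_{s\to t}\frac{|f_H(s)-f_H(t)|}{\omega(|s-t|)}=+\infty$.
   Context: $\mathbb{N}=\{0,1,2,\dots\}$. Wavelets: $\psi,\widetilde\psi:\mathbb{R}\to\mathbb{R}$ generate a pair of biorthogonal wavelet bases of $L^2(\mathbb{R})$, i.e. $\{2^{j/2}\psi(2^j\cdot-k)\}_{j,k\in\mathbb{Z}}$ and $\{2^{j/2}\widetilde\psi(2^j\cdot-k)\}_{j,k\in\mathbb{Z}}$ are Riesz bases of $L^2(\mathbb{R})$ and $2^{j/2}2^{j'/2}\int_{\mathbb{R}}\psi(2^jx-k)\widetilde\psi(2^{j'}x-k')\,dx=\delta_{j,j'}\delta_{k,k'}$. The orthonormal case $\widetilde\psi=\psi$ (e.g. Lemarié–Meyer or Daubechies wavelets) is included. Either both $\psi,\widetilde\psi$ belong to the Schwartz class, or both are compactly supported; moreover $\psi$ is continuously differentiable and $\int\psi=\int\widetilde\psi=0$. Almost surely the series defining $f_H$ converges uniformly on every compact subset of $\mathbb{R}$ (sum over $k$ first, then over $j$), and $f_H$ denotes its sum. A modulus of continuity is an increasing function $\omega:[0,\infty)\to[0,\infty)$ (in particular $\omega(x)>0$ for $x>0$) with $\omega(0)=0$ for which there is $C>0$ such that $\omega(2x)\le C\omega(x)$ for all $x\ge0$. For $h\in(0,1)$ and $x$ near $0$: $\omega_r^{(h)}(x)=|x|^h\sqrt{\log|x|^{-1}}$, $\omega_o^{(h)}(x)=|x|^h\sqrt{\log\log|x|^{-1}}$, $\omega_s^{(h)}(x)=|x|^h$.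 The notation $\omega=o(\omega')$ means $\omega(x)/\omega'(x)\to0$ as $x\to0^+$. *)

(* Defs.v *)
From HB Require Import structures.
From mathcomp Require Import all_boot all_order all_algebra.
From mathcomp Require Import all_classical all_reals all_analysis.
Import Order.TTheory GRing.Theory Num.Theory.
Import numFieldNormedType.Exports.

Set Implicit Arguments.
Unset Strict Implicit.
Unset Printing Implicit Defensive.

Local Open Scope classical_set_scope.
Local Open Scope ring_scope.

Section Wavelets.
Context {R : realType}.
Local Notation mu := (@lebesgue_measure R).

(* Complete in L^2(R), with two-sided norm bounds on finite linear
   combinations; by density these bounds extend to square-summable
   coefficients. *)
Definition riesz_basis (I : eqType) (e : I -> R -> R) : Prop :=
  [/\ forall i, e i \in Lfun mu 2%:E,
      exists A B : R, [/\ 0 < A, 0 < B &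
        forall (s : seq I) (c : I -> R), uniq s ->
        ((A * \sum_(i <- s) c i ^+ 2)%:E
           <= 'N[mu]_2%:E[EFin \o (fun x => \sum_(i <- s) c i * e i x)%R] ^+ 2
           <= (B * \sum_(i <- s) c i ^+ 2)%:E)%E] &
      forall g : R -> R, g \in Lfun mu 2%:E -> forall eps : R, 0 < eps ->
        exists (s : seq I) (c : I -> R),
        ('N[mu]_2%:E[EFin \o (fun x => g x - \sum_(i <- s) c i * e i x)%R]
           < eps%:E)%E].

Definition dyadic_family (psi : R -> R) (p : int * int) (x : R) : R :=
  2 `^ (p.1%:~R / 2) * psi (2 ^ p.1 * x - p.2%:~R).

Definition biorthogonal (psi psit : R -> R) : Prop :=
  forall p q : int * int,
  (\int[mu]_x (dyadic_family psi p x * dyadic_family psit q x)%:E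
   = ((p == q)%:R : R)%:E)%E.

Definition schwartz (f : R -> R) : Prop :=
  (forall (n : nat) (x : R), derivable (derive1n n f) x 1) /\
  (forall m n : nat, exists C : R, forall x, `|x ^+ m * derive1n n f x| <= C).

Definition compactly_supported (f : R -> R) : Prop :=
  compact (closure [set x | f x != 0]).

Definition wavelet_pair (psi psit : R -> R) : Prop :=
  [/\ riesz_basis (dyadic_family psi) /\ riesz_basis (dyadic_family psit),
      biorthogonal psi psit,
      (schwartz psi /\ schwartz psit) \/
        (compactly_supported psi /\ compactly_supported psit),
      (forall x, derivable psi x 1) /\ continuous (derive1 psi) &
      (\int[mu]_x (psi x)%:E = 0)%E /\ (\int[mu]_x (psit x)%:E = 0)%E].

End Wavelets.

Section Series.
Context {R : realType}.

Definition sumZ (u : int -> R) : R :=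
  limn (series (fun n : nat => u n%:Z))
  + limn (series (fun n : nat => u (- n.+1%:Z))).

(* f_H for the coefficients xi, one realization of the random variables;
   lim is total, with a junk value where the series diverges. *)
Definition wavelet_series (psi H : R -> R) (xi : nat -> int -> R) (x : R) : R :=
  limn (series (fun j : nat => sumZ (fun k : int =>
    xi j k * 2 `^ (- (H (k%:~R * 2 ^- j) * j%:R)) * psi (2 ^+ j * x - k%:~R)))).

End Series.

Section Moduli.
Context {R : realType}.

(* Values at negative arguments are irrelevant. *)
Definition modulus_of_continuity (om : R -> R) : Prop :=
  [/\ om 0 = 0,
      forall x, 0 <= x -> 0 <= om x,
      forall x y, 0 <= x -> x < y -> om x < om y &
      exists C : R, 0 < C /\ forall x, 0 <= x -> om (2 * x) <= C * om x].

Definition omega_r (h x : R) : R := `|x| `^ h * Num.sqrt (ln `|x|^-1).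
Definition omega_o (h x : R) : R := `|x| `^ h * Num.sqrt (ln (ln `|x|^-1)).
Definition omega_s (h x : R) : R := `|x| `^ h.

Definition negligible_at0 (om om' : R -> R) : Prop :=
  om x / om' x @[x --> 0^'+] --> 0.

Definition limsup_increment (f om : R -> R) (t : R) : \bar R :=
  lime_sup (fun s => (`|f s - f t| / om `|s - t|)%:E) t.

Definition exact_modulus_at (f om : R -> R) (t : R) : Prop :=
  (limsup_increment f om t < +oo)%E /\
  forall om' : R -> R, modulus_of_continuity om' -> negligible_at0 om' om ->
    limsup_increment f om' t = +oo%E.

End Moduli.

(* Mutual independence of an arbitrary family of real random variables. *)
Definition independent_family d (T : measurableType d) (R : realType)
    (P : probability T R) (I : eqType) (X : I -> {RV P >-> R}) : Prop :=
  forall (s : seq I) (B : I -> set R), uniq s ->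
  (forall i, measurable (B i)) ->
  (P (\bigcap_(i in [set` s]) (X i @^-1` B i))
   = \prod_(i <- s) P (X i @^-1` B i))%E.

Definition log_holder (R : realType) (H : R -> R) : Prop :=
  exists C : R, 0 < C /\ forall x y : R, x != y -> `|x - y| < 1 ->
    `|H x - H y| <= C / `|ln `|x - y| |.

(* Main.v *)
(* The increments of [f] are governed by the coefficients [xi j k] for [k] close to
   [2 ^+ j * t].  If [`|xi j k| <= C * phi j * (1 + ln (1 + `|2 ^+ j * t - k|))] for
   all [j] and [k], summing the series shows that the increments at [t] are
   [O(|s - t|^(H t) * phi n)] when [|s - t|] is about [2 ^- n]; log-Hölder continuity
   allows one to replace [H (k 2^-j)] by [H t].  Conversely, integrating [f] against
   the dual wavelet recovers each coefficient, so a modulus [om = o(omega)] at [t]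
   forces [xi j k = o(phi j)] along [k] close to [2 ^+ j * t].  It remains to find
   points where the two bounds hold: with [phi j = sqrt (ln j)] at almost every [t]
   (Borel-Cantelli at a fixed [t], then Fubini), with [phi j = sqrt j] at the limit of
   nested dyadic intervals carrying large coefficients, and with [phi j = 1] at the end
   of a branch surviving in a binary tree of dyadic intervals, where vertices die with
   small probability and siblings have independent fates.  No point does better than the last
   case, since a union bound excludes infinite dyadic branches of small
   coefficients. *)
Require Import Defs.
From HB Require Import structures.
From mathcomp Require Import all_boot all_order all_algebra.
From mathcomp Require Import all_classical all_reals all_analysis.
From mathcomp Require Import measurable_realfun zify ring lra.
Import Order.TTheory GRing.Theory Num.Theory.
Import numFieldNormedType.Exports.

Set Implicit Arguments.
Unset Strict Implicit.
Unset Printing Implicit Defensive.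

Local Open Scope classical_set_scope.
Local Open Scope ring_scope.

(** * Summation over the integers *)

(** One null set must serve uncountably many points [t] and moduli [om']. Hence every almost sure
    statement concerns the coefficients alone, and [exact_modulus_of_coef] converts it by a
    deterministic argument in which the large coefficients at [t] are found before [om'] is chosen.
    A modulus is only known to be doubling, so increments bounded by it near [t] may grow
    polynomially at larger scales; the moments of [psit] absorb this. An upper bound at [t] must
    control all [k], not only the intervals containing [t]. An interval at a distance of [2 ^+ n]
    cells separates from [t] about [n] levels up, so a bound linear in the number of levels since
    the separation is logarithmic in the distance, and the decay of [psi] pays for it. For slow
    points this requires control of a branch together with its neighbours, hence triples of dyadic
    intervals. Triples of adjacent intervals overlap, and independence of siblings is regained by
    keeping only two of the eight descendants three levels below. *)

Section Summation.
Context {R : realType}.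
Implicit Types (y z M : R) (u v : int -> R).

(* [z / (1 + |z|)] is bounded by 1 and its unit increments dominate
   [(1 + |z|)^-2]: a telescoping majorant uniform in translations. *)
Lemma inv_sqr_telescope z : ((1 + `|z|) ^+ 2)^-1 <=
  2 * ((z + 1) / (1 + `|z + 1|) - z / (1 + `|z|)).
Proof.
have [z0|z0] := leP 0 z.
  rewrite !ger0_norm; [|lra|lra].
  have -> : 2 * ((z + 1) / (1 + (z + 1)) - z / (1 + z)) =
    2 * ((1 + z) / (2 + z)) * ((1 + z) ^+ 2)^-1.
    by field; apply/andP; split; apply: lt0r_neq0; lra.
  rewrite ler_peMl ?invr_ge0 ?sqr_ge0// mulrA ler_pdivlMr; lra.
rewrite (ltr0_norm z0).
have [z1|z1] := leP 0 (z + 1).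
  rewrite ger0_norm//.
  have -> : 2 * ((z + 1) / (1 + (z + 1)) - z / (1 - z)) =
    2 * (1 + z) / (2 + z) + 2 * (- z) / (1 - z).
    by field; apply/andP; split; apply: lt0r_neq0; lra.
  rewrite (@le_trans _ _ 1)//.
    rewrite invf_le1; last by apply: exprn_gt0; lra.
    by apply: exprn_ege1; lra.
  have h1 : (1 + z) <= 2 * (1 + z) / (2 + z) by rewrite ler_pdivlMr; nra.
  have h2 : - z <= 2 * (- z) / (1 - z) by rewrite ler_pdivlMr; nra.
  lra.
rewrite (ltr0_norm z1).
have -> : 2 * ((z + 1) / (1 - (z + 1)) - z / (1 - z)) =
    2 * ((1 - z) / (- z)) * ((1 - z) ^+ 2)^-1.
    by field; apply/and3P; split; rewrite neq_lt; apply/orP;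
      first [left; lra | right; lra].
rewrite ler_peMl ?invr_ge0 ?sqr_ge0// mulrA ler_pdivlMr; lra.
Qed.

(** The telescoped majorant is twice a difference of two values in [[-1, 1]], whatever [y] and
    [n]. *)
Lemma sum_inv_sqr_le y n : \sum_(0 <= i < n) ((1 + `|y - i%:R|) ^+ 2)^-1 <= 4.
Proof.
have b z : -1 <= z / (1 + `|z|) <= 1.
  have := normr_ge0 z => z0; have := ler_norm z; have := ler_norm (- z).
  rewrite normrN => h1 h2.
  by apply/andP; split; rewrite ?ler_pdivlMr ?ler_pdivrMr; lra.
apply: (@le_trans _ _ (\sum_(0 <= i < n)
    2 * ((i.+1%:R - y) / (1 + `|i.+1%:R - y|) - (i%:R - y) / (1 + `|i%:R - y|)))).
  apply: ler_sum => i _; rewrite distrC (le_trans (inv_sqr_telescope _))//.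
  by rewrite -[i.+1%:R]natr1 (_ : i%:R - y + 1 = i%:R + 1 - y)//; ring.
rewrite -big_distrr/= telescope_sumr//.
have /andP[_ h1] := b (n%:R - y); have /andP[h2 _] := b (0%:R - y); lra.
Qed.

Lemma intNSr (n : nat) : (- n.+1%:Z)%:~R = - n.+1%:R :> R.
Proof. by rewrite mulrNz. Qed.

Lemma sum_inv_sqrN_le y n :
  \sum_(0 <= i < n) ((1 + `|y - (- i.+1%:Z)%:~R|) ^+ 2)^-1 <= 4.
Proof.
rewrite (le_trans _ (sum_inv_sqr_le (- y - 1) n))//.
apply: ler_sum => i _; rewrite intNSr.
by rewrite (_ : - y - 1 - i%:R = - (y - - i.+1%:R)) ?normrN// -[i.+1%:R]natr1; ring.
Qed.

Lemma series_dominated (a b : R^nat) (B : R) : (forall n, `|a n| <= b n) ->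
  (forall n, \sum_(0 <= i < n) b i <= B) ->
  cvgn (series a) /\ `|limn (series a)| <= B.
Proof.
move=> ab bB.
have cb : cvgn [normed series a].
  apply: nondecreasing_is_cvgn.
    by apply: nondecreasing_series => n _ _; exact: normr_ge0.
  exists B => _ [n _ <-]; rewrite (le_trans _ (bB n))//.
  by apply: ler_sum => i _; exact: ab.
have ca : cvgn (series a) by exact: normed_cvg.
split => //.
rewrite (le_trans (lim_series_norm cb))//.
apply: limr_le => //; near=> n; rewrite (le_trans _ (bB n))//.
by apply: ler_sum => i _; exact: ab.
Unshelve. all: by end_near. Qed.

Definition sumZ_cvg u :=
  cvgn (series (fun n : nat => u n%:Z)) /\
  cvgn (series (fun n : nat => u (- n.+1%:Z))).

(** The sum over [- n <= k < n]: both halves are cut at one index, so that a single limit can be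
    taken under an integral. *)
Definition sumZ_partial u (n : nat) : R :=
  series (fun n : nat => u n%:Z) n + series (fun n : nat => u (- n.+1%:Z)) n.

Lemma sumZ_partial_cvg u : sumZ_cvg u -> sumZ_partial u @ \oo --> sumZ u.
Proof. by move=> [c1 c2]; apply: cvgD. Qed.

Lemma sumZB u v : sumZ_cvg u -> sumZ_cvg v ->
  sumZ u - sumZ v = sumZ (fun k => u k - v k).
Proof.
move=> [u1 u2] [v1 v2]; rewrite /sumZ.
have E (a b : R^nat) : cvgn (series a) -> cvgn (series b) ->
    limn (series a) - limn (series b) = limn (series (fun n => a n - b n)).
  move=> ca cb; apply/esym/cvg_lim => //.
  rewrite (_ : series (fun n => a n - b n) = series a \- series b).
    exact: cvgB.
  by apply/funext => n; rewrite /series/= sumrB.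
by rewrite -(E _ _ u1 v1) -(E _ _ u2 v2); ring.
Qed.

Lemma sumZ_partial_le u y M : 0 <= M ->
  (forall k, `|u k| <= M * ((1 + `|y - k%:~R|) ^+ 2)^-1) ->
  forall n, `|sumZ_partial u n| <= 8 * M.
Proof.
move=> M0 uM n.
rewrite /sumZ_partial (le_trans (ler_normD _ _))//.
have h (v : R^nat) (b : R^nat) : (forall n, `|v n| <= M * b n) ->
    \sum_(0 <= i < n) b i <= 4 -> `|series v n| <= 4 * M.
  move=> vb b4; rewrite (le_trans (ler_norm_sum _ _ _))//.
  rewrite (@le_trans _ _ (\sum_(0 <= i < n) M * b i)) ?ler_sum//.
  by rewrite -big_distrr/= mulrC ler_wpM2r.
have h1 := h _ _ (fun n => uM n%:Z) (sum_inv_sqr_le y n).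
have h2 := h _ _ (fun n => uM (- n.+1%:Z)) (sum_inv_sqrN_le y n).
by rewrite (le_trans (lerD h1 h2))//; lra.
Qed.

Lemma sumZ_dominated u y M : 0 <= M ->
  (forall k, `|u k| <= M * ((1 + `|y - k%:~R|) ^+ 2)^-1) ->
  sumZ_cvg u /\ `|sumZ u| <= 8 * M.
Proof.
move=> M0 uM.
have h (v : R^nat) (b : R^nat) : (forall n, `|v n| <= M * b n) ->
    (forall n, \sum_(0 <= i < n) b i <= 4) ->
    cvgn (series v) /\ `|limn (series v)| <= M * 4.
  move=> vb b4; apply: (@series_dominated _ (fun n => M * b n)) => // n.
  by rewrite -big_distrr/= ler_wpM2l.
have [c1 l1] := h _ _ (fun n => uM n%:Z) (sum_inv_sqr_le y).
have [c2 l2] := h _ _ (fun n => uM (- n.+1%:Z)) (sum_inv_sqrN_le y).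
split; first by split.
by rewrite /sumZ (le_trans (ler_normD _ _))//; lra.
Qed.

Lemma sum_geometric_le (r : R) n : 0 <= r -> r < 1 ->
  \sum_(0 <= i < n) r ^+ i <= (1 - r)^-1.
Proof.
move=> r0 r1.
have := @geometric_seriesE R 1 r (negbT (lt_eqF r1)).
move/(congr1 (fun f => f n)) => /=; rewrite mul1r => h.
have -> : \sum_(0 <= i < n) r ^+ i = (1 - r ^+ n) / (1 - r).
  by rewrite -h /series/=; apply: eq_bigr => i _; rewrite mul1r.
rewrite -[leRHS]mul1r ler_wpM2r ?invr_ge0 ?subr_ge0 ?(ltW r1)//.
by have := exprn_ge0 n r0; lra.
Qed.

Lemma bernoulli_ineq (x : R) n : 0 <= x -> 1 + n%:R * x <= (1 + x) ^+ n.
Proof.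
move=> x0; elim: n => [|n IH]; first by rewrite mul0r addr0 expr0.
rewrite exprS (@le_trans _ _ ((1 + x) * (1 + n%:R * x)))//.
  by rewrite -[n.+1%:R]natr1; have := ler0n R n; nra.
by rewrite ler_wpM2l// addr_ge0.
Qed.

(** Of the four factors [s ^+ i] of [r ^+ i], three absorb the cubic factor and the last one leaves
    a geometric series. *)
Lemma poly_geometric_le (r : R) : 0 < r -> r < 1 ->
  exists B : R, 0 < B /\
    forall n : nat, \sum_(0 <= i < n) (2 + i%:R) ^+ 3 * r ^+ i <= B.
Proof.
move=> r0 r1; pose s := r `^ 4^-1.
have s0 : 0 < s by exact: powR_gt0.
have s4 : s ^+ 4 = r.
  by rewrite -powR_mulrn ?powR_ge0// -powRrM mulVf ?powRr1// ltW.
have s1 : s < 1.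
  rewrite ltNge; apply/negP => s1; have := exprn_ege1 4 s1; rewrite s4; lra.
pose d := s^-1 - 1.
have d0 : 0 < d by rewrite subr_gt0 invf_gt1.
(* With this choice [D * (1 + i%:R * d)] exceeds [2 + i%:R] by nonnegative terms, and Bernoulli's
   inequality applies to [s^-1 = 1 + d]. *)
pose D := 2 + d^-1.
have D0 : 0 < D by rewrite addr_gt0// invr_gt0.
have hD (i : nat) : (2 + i%:R) * s ^+ i <= D.
  rewrite -[s]invrK exprVn ler_pdivrMr ?exprn_gt0 ?invr_gt0//.
  have -> : s^-1 = 1 + d by rewrite /d; ring.
  rewrite (@le_trans _ _ (D * (1 + i%:R * d)))//; last first.
    by rewrite ler_wpM2l ?(ltW D0)// bernoulli_ineq// ltW.
  have -> : D * (1 + i%:R * d) = 2 + i%:R + (d^-1 + 2 * i%:R * d).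
    by rewrite /D; field; rewrite gt_eqF.
  by rewrite lerDl addr_ge0// ?invr_ge0 ?mulr_ge0// ltW.
exists (D ^+ 3 * (1 - s)^-1); split.
  by rewrite mulr_gt0 ?exprn_gt0// invr_gt0 subr_gt0.
move=> n; apply: (@le_trans _ _ (\sum_(0 <= i < n) D ^+ 3 * s ^+ i)).
  apply: ler_sum => i _.
  have -> : (2 + i%:R) ^+ 3 * r ^+ i = ((2 + i%:R) * s ^+ i) ^+ 3 * s ^+ i.
    by rewrite -s4 (exprAC s 4 i); ring.
  rewrite ler_wpM2r ?exprn_ge0 ?(ltW s0)// lerXn2r// nnegrE.
    by rewrite mulr_ge0 ?exprn_ge0 ?(ltW s0)// addr_ge0.
  exact: ltW.
rewrite -big_distrr/= ler_wpM2l ?exprn_ge0 ?(ltW D0)//.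
exact: sum_geometric_le (ltW s0) s1.
Qed.

End Summation.

(** * Decay of the wavelet *)

Section Decay.
Context {R : realType}.
Implicit Types (f : R -> R) (x y : R).

Definition rapidly_decreasing f :=
  forall N : nat, exists D : R, 0 < D /\
    forall x, `|f x| <= D * ((1 + `|x|) ^+ N)^-1.

Lemma moments_rapidly_decreasing f :
  (forall m : nat, exists C : R, forall x, `|x ^+ m * f x| <= C) ->
  rapidly_decreasing f.
Proof.
move=> fC N; have [C0 h0] := fC 0%N; have [CN hN] := fC N.
have p0 : 0 <= C0 by exact: le_trans (normr_ge0 _) (h0 0).
have pN : 0 <= CN by exact: le_trans (normr_ge0 _) (hN 0).
have p2 : 0 < 2 ^+ N :> R by exact: exprn_gt0.
exists (2 ^+ N * (C0 + CN + 1)); split; first by rewrite mulr_gt0//; lra.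
move=> x; have x1 : 0 < 1 + `|x| by rewrite ltr_pwDl.
rewrite ler_pdivlMr ?exprn_gt0//.
have [x1'|x1'] := leP `|x| 1.
  have := h0 x; rewrite expr0 mul1r => h.
  rewrite mulrC ler_pM ?exprn_ge0 ?(ltW x1)//; last lra.
  by apply: lerXn2r; rewrite ?nnegrE ?(ltW x1)//; lra.
apply: (@le_trans _ _ (`|f x| * (2 ^+ N * `|x| ^+ N))).
  rewrite ler_wpM2l// -exprMn lerXn2r// ?nnegrE ?(ltW x1) ?mulr_ge0//; lra.
rewrite mulrCA ler_wpM2l ?(ltW p2)// mulrC -normrX -normrM.
by rewrite (le_trans (hN x))//; lra.
Qed.

Lemma bounded_support_rapidly_decreasing f (B : R) : continuous f ->
  (forall x, B < `|x| -> f x = 0) -> rapidly_decreasing f.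
Proof.
move=> cf fB N.
have [M [Mr hM]] : bounded_set (f @` `[- `|B|, `|B|]).
  apply: compact_bounded; apply: continuous_compact; last exact: segment_compact.
  exact: continuous_subspaceT.
pose M' := `|M| + 1.
have M'0 : 0 < M' by rewrite ltr_wpDl.
have b1 : 0 < 1 + `|B| by rewrite ltr_pwDl.
exists (M' * (1 + `|B|) ^+ N); split; first by rewrite mulr_gt0 ?exprn_gt0.
move=> x; have x1 : 0 < 1 + `|x| by rewrite ltr_pwDl.
rewrite ler_pdivlMr ?exprn_gt0//.
have [xB|xB] := leP `|x| `|B|.
  apply: ler_pM; rewrite ?exprn_ge0 ?(ltW x1)//.
    apply: (hM M'); first by rewrite /M' (le_lt_trans (ler_norm M))// ltrDl.
    by exists x => //=; rewrite in_itv/= -ler_norml.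
  by rewrite lerXn2r ?nnegrE ?(ltW x1) ?(ltW b1)// lerD2l.
rewrite fB ?(le_lt_trans (ler_norm B))// normr0 mul0r.
by rewrite mulr_ge0 ?exprn_ge0 ?(ltW M'0) ?(ltW b1).
Qed.

Lemma compactly_supported_bound f : compactly_supported f ->
  exists B : R, forall x, B < `|x| -> f x = 0.
Proof.
move=> /compact_bounded [B [_ hB]].
exists (`|B| + 1) => x Bx; apply: contrapT => /eqP fx.
have Bl : B < `|B| + 1 by rewrite (le_lt_trans (ler_norm B))// ltrDl.
have cx : closure [set x | f x != 0] x by exact: subset_closure.
by have := hB _ Bl x cx; rewrite /= leNgt Bx.
Qed.

(** The Schwartz and the compactly supported cases meet here; in the second one [psi] vanishes near
    every point beyond [B], hence so does its derivative. *)
Lemma wavelet_decay (psi psit : R -> R) : wavelet_pair psi psit ->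
  rapidly_decreasing psi /\ rapidly_decreasing (derive1 psi).
Proof.
move=> [_ _ + [dpsi cpsi] _].
case=> [[[_ h] _]|[/compactly_supported_bound[B hB] _]].
  by split; apply: moments_rapidly_decreasing => m; [have := h m 0%N|have := h m 1%N].
split; apply: (@bounded_support_rapidly_decreasing _ B) => //.
  by move=> x; apply: differentiable_continuous; apply/derivable1_diffP.
move=> x Bx; rewrite derive1E.
have -> : 'D_1 psi x = 'D_1 (cst 0) x; last by rewrite derive_cst.
apply: near_eq_derive => //.
have : nbhs x [set y | B < `|y|].
  apply: open_nbhs_nbhs; split => //.
  exact: (open_comp (fun x _ => @norm_continuous _ _ x) (@open_gt _ B)).
by apply: filterS => y /= By; rewrite hB.
Qed.

(** The mean value point lies within distance 1 of [y], so moving the decay from it to [y] costs at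
    most [2 ^+ N]. *)
Lemma increment_decay f (N : nat) : (forall x, derivable f x 1) ->
  rapidly_decreasing (derive1 f) ->
  exists D : R, 0 < D /\ forall x y, `|x - y| <= 1 ->
    `|f x - f y| <= D * `|x - y| * ((1 + `|y|) ^+ N)^-1.
Proof.
move=> df /(_ N)[D [D0 hD]].
exists (D * 2 ^+ N); split; first by rewrite mulr_gt0 ?exprn_gt0.
have key x y c : `|x - y| <= 1 -> Num.min x y <= c <= Num.max x y ->
    f x - f y = derive1 f c * (x - y) ->
    `|f x - f y| <= D * 2 ^+ N * `|x - y| * ((1 + `|y|) ^+ N)^-1.
  move=> xy1 cxy ->; rewrite normrM [leRHS]mulrAC ler_wpM2r//.
  rewrite (le_trans (hD c))// -mulrA ler_wpM2l ?(ltW D0)//.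
  have y1 : 0 < 1 + `|y| by rewrite ltr_pwDl.
  have c1 : 0 < 1 + `|c| by rewrite ltr_pwDl.
  rewrite ler_pdivlMr ?exprn_gt0// mulrC ler_pdivrMr ?exprn_gt0// -exprMn.
  rewrite lerXn2r// ?nnegrE ?mulr_ge0 ?(ltW y1) ?(ltW c1)//.
  have yc : `|y - c| <= 1.
    apply: le_trans xy1; rewrite distrC.
    case: (leP x y) cxy => xy /andP[h1 h2].
      by rewrite ler0_norm ?subr_le0// ler0_norm ?subr_le0//; lra.
    by rewrite ger0_norm ?subr_ge0// gtr0_norm ?subr_gt0//; lra.
  have := ler_normD (y - c) c; rewrite subrK => h; have := normr_ge0 c; lra.
have cf : continuous f.
  by move=> z; apply: differentiable_continuous; apply/derivable1_diffP.
have main x y : y <= x -> exists2 c, y <= c <= x &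
    f x - f y = derive1 f c * (x - y).
  have hd z : z \in `]y, x[%R -> is_derive z 1 f (derive1 f z).
    by move=> _; split; [exact: df|rewrite derive1E].
  move=> yx; have [c] := MVT_segment yx hd (continuous_subspaceT cf).
  by rewrite in_itv/= => hc e; exists c.
move=> x y xy1; have [xy|xy] := leP y x.
  have [c hc e] := main x y xy.
  by apply: (key _ _ c) => //; rewrite min_r// max_l.
have [c hc e] := main y x (ltW xy).
apply: (key _ _ c) => //; first by rewrite min_l ?max_r// ltW.
by rewrite -opprB e -mulrN opprB.
Qed.

End Decay.

(** * Coefficients near a point *)

Section LogHolder.
Context {R : realType}.

Lemma powR2N_nat (n : nat) : 2 `^ (- n%:R) = 2 ^- n :> R.
Proof. by rewrite powR_invn. Qed.

Lemma ln2_gt0 : 0 < ln 2 :> R. Proof. by rewrite ln_gt0// ltr1n. Qed.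

Lemma ln2_le1 : ln 2 <= 1 :> R.
Proof.
have h : -1 < 1 :> R by lra.
by have := le_ln1Dx h; rewrite -[1 + 1]/(2%:R).
Qed.

(* Two points at distance less than [2^(-n/2)] have Hölder exponents that
   differ by [O(1/n)]; the quadratic factor takes care of distant points. *)
Lemma log_holder_powR (H : R -> R) (a : R) : 0 <= a ->
  (forall x, a <= H x <= 1) -> log_holder H ->
  exists C : R, 0 < C /\ forall (n i : nat) (y t : R),
    2 `^ (- (H y * (n + i)%:R)) <=
      C * 2 `^ (- (H t * n%:R)) * (2 `^ (- a)) ^+ i *
      (1 + 2 ^+ n * `|y - t|) ^+ 2.
Proof.
move=> a0 Ha [CH [CH0 hH]].
have l2 := ln2_gt0.
pose K := 2 * CH / ln 2.
have K0 : 0 < K by rewrite divr_gt0// mulr_gt0.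
exists (2 `^ K); split; first exact: powR_gt0.
move=> n i y t.
have w1 : 1 <= (1 + 2 ^+ n * `|y - t|) ^+ 2.
  by rewrite exprn_ege1// lerDl mulr_ge0// exprn_ge0.
suff step : 2 `^ (- (H y * n%:R)) <=
    2 `^ K * 2 `^ (- (H t * n%:R)) * (1 + 2 ^+ n * `|y - t|) ^+ 2.
  have -> : - (H y * (n + i)%:R) = - (H y * n%:R) + - (H y * i%:R).
    by rewrite natrD; ring.
  rewrite powRD ?pnatr_eq0 ?implybT// [leRHS]mulrAC ler_pM ?powR_ge0//.
  rewrite -powR_mulrn ?powR_ge0// -powRrM ler_powR ?ler1n//.
  by have /andP[h _] := Ha y; have := ler0n R i; nra.
have [<-|/eqP yt] := pselect (y = t).
  rewrite subrr normr0 mulr0 addr0 expr1n mulr1 ler_peMl ?powR_ge0//.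
  by rewrite -[leLHS](powRr0 2) ler_powR ?ler1n// ltW.
have n0 := ler0n R n.
have [near|far] := ltP (`|y - t| ^+ 2) (2 ^- n).
  rewrite (@le_trans _ _ (2 `^ K * 2 `^ (- (H t * n%:R))))//; last first.
    by rewrite ler_peMr// mulr_ge0 ?powR_ge0.
  rewrite -powRD ?pnatr_eq0 ?implybT// ler_powR ?ler1n//.
  have d0 : 0 < `|y - t| by rewrite normr_gt0 subr_eq0.
  have d1 : `|y - t| < 1.
    rewrite -(@ltr_pXn2r _ 2)// ?nnegrE// expr1n (lt_le_trans near)//.
    by rewrite invf_le1 ?exprn_gt0// exprn_ege1// ler1n.
  have lneg : ln `|y - t| < 0 by rewrite ln_lt0// d0.
  have lL : n%:R * ln 2 / 2 <= `|ln `|y - t| |.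
    have : ln (`|y - t| ^+ 2) <= ln (2 ^- n).
      by rewrite ler_ln ?posrE ?exprn_gt0 ?invr_gt0 ?exprn_gt0// ltW.
    rewrite lnV ?posrE ?exprn_gt0// !lnXn// -[ln 2 *+ n]mulr_natl mulr2n.
    by rewrite (ltr0_norm lneg); lra.
  have L0 : 0 < `|ln `|y - t| | by rewrite normr_gt0 lt_eqF.
  have := hH y t yt d1; rewrite ler_pdivlMr// => h.
  have h' : `|H y - H t| * n%:R <= K.
    rewrite ler_pdivlMr//; have := normr_ge0 (H y - H t); nra.
  have := ler_norm (- (H y - H t)); rewrite normrN; nra.
(* Far points: the squared weight is at least [2 ^+ n], which compensates the power of 2 with
   exponent [- (H t * n%:R)] because [H t <= 1]. *)
rewrite (@le_trans _ _ 1)//.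
  rewrite -[leRHS](powRr0 2) ler_powR ?ler1n//.
  by have /andP[h _] := Ha y; nra.
have far' : 2 ^+ n <= (1 + 2 ^+ n * `|y - t|) ^+ 2.
  rewrite (@le_trans _ _ ((2 ^+ n * `|y - t|) ^+ 2))//.
    rewrite exprMn -ler_pdivrMl ?exprn_gt0// (le_trans _ far)//.
    by rewrite expr2 invfM mulrAC -mulrA mulfV ?mulr1// gt_eqF ?exprn_gt0.
  rewrite lerXn2r ?nnegrE ?addr_ge0 ?mulr_ge0 ?exprn_ge0// lerDr//.
rewrite (@le_trans _ _ (1 * 2 `^ (- n%:R) * 2 ^+ n))//.
  by rewrite mul1r powR2N_nat mulVf// gt_eqF ?exprn_gt0.
rewrite ler_pM ?mulr_ge0 ?powR_ge0 ?exprn_ge0// ler_pM ?powR_ge0//.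
  by rewrite -[leLHS](powRr0 2) ler_powR ?ler1n// ltW.
by rewrite ler_powR ?ler1n// lerN2 ler_piMl//; have /andP[] := Ha t.
Qed.

End LogHolder.

Section Levels.
Context {R : realType}.
Variables (psi H : R -> R) (x : nat -> int -> R) (phi : nat -> R) (t : R).
Variables (a b C1 : R).

(** The last clause compares finer levels with level [n] at the cost of a factor linear in [i],
    which [rho ^+ i] absorbs. *)
Definition slow_growth (phi : nat -> R) := [/\ forall n, 0 < phi n,
  {homo phi : m n / (m <= n)%N >-> m <= n} &
  forall n i, phi (n + i)%N <= phi n * (1 + i%:R)].

Definition coef (j : nat) (k : int) : R :=
  x j k * 2 `^ (- (H (k%:~R * 2 ^- j) * j%:R)).

Definition level (j : nat) (s : R) : R :=
  sumZ (fun k => coef j k * psi (2 ^+ j * s - k%:~R)).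

(** The logarithm makes a distance of [2 ^+ n] cells count linearly in [n], which is the form of the
    bounds along a surviving branch. *)
Definition coef_growth (t : R) (C1 : R) := forall j k,
  `|x j k| <= C1 * phi j * (1 + ln (1 + `|2 ^+ j * t - k%:~R|)).

Hypotheses (phi_slow : slow_growth phi) (a0 : 0 < a) (b1 : b < 1).
Hypotheses (Hab : forall x, a <= H x <= b) (Hlog : log_holder H).
Hypotheses (C10 : 0 <= C1) (xC1 : coef_growth t C1).

Local Notation rho := (2 `^ (- a)).

Lemma rho_gt0 : 0 < rho. Proof. exact: powR_gt0. Qed.

Lemma powR2N_lt1 (c : R) : 0 < c -> 2 `^ (- c) < 1.
Proof.
move=> c0; rewrite powRN invf_lt1 ?powR_gt0//.
rewrite -[ltLHS](powRr0 2) lt_neqAle ler_powR ?ler1n ?(ltW c0)// andbT.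
by rewrite powRr0 eq_sym powR_eq1 (gt_eqF c0) ltNge ler0n/= orbF pnatr_eq1.
Qed.

Lemma rho_lt1 : rho < 1. Proof. exact: powR2N_lt1. Qed.

Lemma exponent_bounds z : a <= H z <= 1.
Proof. by have /andP[-> /le_trans->] := Hab z; rewrite ?ltW. Qed.

Lemma one_add_ln_le (w : R) : 1 <= w -> 1 + ln w <= w.
Proof.
move=> w1; have h : -1 < w - 1 by lra.
by have := le_ln1Dx h; rewrite [1 + (_ - _)]addrC subrK => ?; lra.
Qed.

(** The weight is recentered from [t] to [s], where [psi] decays; the shift is at most [2 ^+ i]
    cells. One power of the weight comes from the logarithm and two from [log_holder_powR]; of the
    two factors [2 + i%:R], one comes from [phi] and one from the logarithm of the shift. *)
Lemma coef_near_le : exists C : R, 0 < C /\ forall (n i : nat) (s : R) (k : int),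
  `|s - t| <= 2 ^- n ->
  `|coef (n + i) k| <= C * phi n * (2 + i%:R) ^+ 2 * rho ^+ i *
    2 `^ (- (H t * n%:R)) * (1 + `|2 ^+ (n + i) * s - k%:~R|) ^+ 3.
Proof.
have [C [C0 hC]] := log_holder_powR (ltW a0) exponent_bounds Hlog.
exists (4 * C * (C1 + 1)); split; first by rewrite !mulr_gt0// ltr_wpDl.
move=> n i s k st; set w := 1 + _.
have [phi0 _ phiD] := phi_slow.
have w1 : 1 <= w by rewrite lerDl.
have p2 m : 0 < 2 ^+ m :> R by exact: exprn_gt0.
have st' : 2 ^+ n * `|s - t| <= 1 by rewrite -ler_pdivlMl// mulr1.
have wt : 1 + `|2 ^+ (n + i) * t - k%:~R| <= 2 ^+ i.+1 * w.
  have -> : 2 ^+ (n + i) * t - k%:~R = (2 ^+ (n + i) * s - k%:~R)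
      - 2 ^+ i * (2 ^+ n * (s - t)) by rewrite exprD; ring.
  have h := ler_normB (2 ^+ (n + i) * s - k%:~R) (2 ^+ i * (2 ^+ n * (s - t))).
  have h' : `|2 ^+ i * (2 ^+ n * (s - t))| <= 2 ^+ i.
    by rewrite normrM (gtr0_norm (p2 i)) ler_piMr ?(ltW (p2 i))//
      normrM (gtr0_norm (p2 n)).
  have i1 : 1 <= 2 ^+ i :> R by rewrite exprn_ege1// ler1n.
  by rewrite exprS; rewrite /w in w1 *; nra.
have xk : `|x (n + i)%N k| <= C1 * (phi n * (2 + i%:R)) * ((2 + i%:R) * w).
  rewrite (le_trans (xC1 _ _))// ler_pM ?mulr_ge0 ?(ltW (phi0 _))//.
  - by rewrite addr_ge0// ln_ge0// lerDl.
  - rewrite ler_wpM2l// (le_trans (phiD _ _))// ler_wpM2l ?(ltW (phi0 _))//.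
    by rewrite lerD2r ler1n.
  - have : ln (1 + `|2 ^+ (n + i) * t - k%:~R|) <= ln (2 ^+ i.+1 * w).
      by rewrite ler_ln ?posrE ?mulr_gt0 ?ltr_pwDl// (lt_le_trans ltr01).
    rewrite lnM ?posrE ?(lt_le_trans ltr01 w1)// lnXn//.
    have l2 := @ln2_le1 R.
    have hw := one_add_ln_le w1.
    have : ln 2 *+ i.+1 <= 1 + i%:R :> R.
      rewrite -[leLHS]mulr_natl -[i.+1%:R]natr1; have := ler0n R i; nra.
    have := ler0n R i; move=> *. nra.
have Hk : 2 `^ (- (H (k%:~R * 2 ^- (n + i)) * (n + i)%:R)) <=
    C * 2 `^ (- (H t * n%:R)) * rho ^+ i * (4 * w ^+ 2).
  rewrite (le_trans (hC n i _ t))// ler_wpM2l//.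
    by rewrite !mulr_ge0 ?exprn_ge0 ?powR_ge0// ltW.
  have -> : 4 * w ^+ 2 = (2 * w) ^+ 2 by ring.
  have w0 : 0 <= w by exact: le_trans ler01 w1.
  apply: lerXn2r; rewrite ?nnegrE ?addr_ge0 ?mulr_ge0 ?exprn_ge0//.
  have -> : k%:~R * 2 ^- (n + i) - t =
      (s - t) - 2 ^- (n + i) * (2 ^+ (n + i) * s - k%:~R).
    by rewrite mulrBr mulrA mulVf ?gt_eqF//; ring.
  have h := ler_normB (s - t) (2 ^- (n + i) * (2 ^+ (n + i) * s - k%:~R)).
  have h2 : 2 ^+ n * `|2 ^- (n + i) * (2 ^+ (n + i) * s - k%:~R)| <= w - 1.
    rewrite normrM gtr0_norm ?invr_gt0// exprD invfM !mulrA mulfV ?gt_eqF// mul1r.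
    rewrite /w [1 + _]addrC addrK -exprD ler_piMl// invf_le1//.
    by rewrite exprn_ege1// ler1n.
  have h3 := ler_wpM2l (ltW (p2 n)) h; rewrite [leRHS]mulrDr in h3; lra.
rewrite /coef normrM (@ger0_norm _ (powR _ _)) ?powR_ge0//.
rewrite (le_trans (ler_pM _ _ xk Hk)) ?powR_ge0//.
rewrite [leLHS](_ : _ = 4 * C * C1 * (phi n * (2 + i%:R) ^+ 2 * rho ^+ i *
   2 `^ (- (H t * n%:R)) * w ^+ 3)); last by ring.
rewrite [leRHS](_ : _ = 4 * C * (C1 + 1) * (phi n * (2 + i%:R) ^+ 2 * rho ^+ i *
   2 `^ (- (H t * n%:R)) * w ^+ 3)); last by ring.
rewrite ler_wpM2r//.
  rewrite !mulr_ge0 ?exprn_ge0 ?powR_ge0 ?addr_ge0 ?(ltW (phi0 _))//.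
by rewrite ler_wpM2l ?mulr_ge0 ?(ltW C0)// lerDl.
Qed.

(** For [s] far from [t] the exponent [H t] is given up and only [a <= H] is kept: this suffices for
    the convergence of the series at every [s] and for its linear growth. *)
Lemma coef_global_le : exists C : R, 0 < C /\ forall (j : nat) (s : R) (k : int),
  `|coef j k| <= C * (1 + `|s - t|) * (2 + j%:R) ^+ 2 * rho ^+ j *
    (1 + `|2 ^+ j * s - k%:~R|).
Proof.
have [phi0 _ phiD] := phi_slow.
exists (C1 * phi 0%N + 1); split; first by rewrite ltr_wpDl ?mulr_ge0 ?(ltW (phi0 _)).
move=> j s k; set w := 1 + `|2 ^+ j * s - _|; set d := `|s - t|.
have w1 : 1 <= w by rewrite lerDl.
have d0 : 0 <= d by exact: normr_ge0.
have p2 m : 0 < 2 ^+ m :> R by exact: exprn_gt0.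
have wt : 1 + `|2 ^+ j * t - k%:~R| <= 2 ^+ j * ((1 + d) * w).
  have -> : 2 ^+ j * t - k%:~R = (2 ^+ j * s - k%:~R) - 2 ^+ j * (s - t) by ring.
  have h := ler_normB (2 ^+ j * s - k%:~R) (2 ^+ j * (s - t)).
  have h' : `|2 ^+ j * (s - t)| = 2 ^+ j * d by rewrite normrM (gtr0_norm (p2 j)).
  have i1 : 1 <= 2 ^+ j :> R by rewrite exprn_ege1// ler1n.
  have : 0 <= d * 2 ^+ j by rewrite mulr_ge0// ltW.
  by rewrite /w in w1 *; rewrite h' in h; nra.
have xk : `|x j k| <= (C1 * phi 0%N) * (2 + j%:R) * ((1 + d) * (2 + j%:R) * w).
  rewrite (le_trans (xC1 _ _))// ler_pM ?mulr_ge0 ?(ltW (phi0 _))//.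
  - by rewrite addr_ge0// ln_ge0// lerDl.
  - rewrite -mulrA ler_wpM2l// (le_trans (phiD 0%N _))//.
    by rewrite ler_wpM2l ?(ltW (phi0 _))// lerD2r ler1n.
  - have : ln (1 + `|2 ^+ j * t - k%:~R|) <= ln (2 ^+ j * ((1 + d) * w)).
      rewrite ler_ln ?posrE ?ltr_pwDl// !mulr_gt0// ?(lt_le_trans ltr01 w1)//.
      by rewrite ltr_pwDl.
    rewrite !lnM ?posrE ?mulr_gt0 ?(lt_le_trans ltr01 w1) ?ltr_pwDl// lnXn//.
    have l2 := @ln2_le1 R.
    have hw := one_add_ln_le w1.
    have hd : ln (1 + d) <= d by rewrite le_ln1Dx// (lt_le_trans _ d0)// ltrN10.
    have : ln 2 *+ j <= j%:R :> R.
      by rewrite -[leLHS]mulr_natl ler_piMr.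
    have j0 := ler0n R j.
    move=> e1 e2; rewrite (@le_trans _ _ (d + j%:R + w))//; first lra.
    have : 0 <= j%:R * d * w by rewrite !mulr_ge0// (le_trans ler01).
    have : 0 <= d * (w - 1) by rewrite mulr_ge0//; lra.
    have : 0 <= j%:R * (w - 1) by rewrite mulr_ge0//; lra.
    nra.
have Hk : 2 `^ (- (H (k%:~R * 2 ^- j) * j%:R)) <= rho ^+ j.
  rewrite -powR_mulrn ?powR_ge0// -powRrM ler_powR ?ler1n//.
  by have /andP[h _] := Hab (k%:~R * 2 ^- j); have := ler0n R j; nra.
rewrite /coef normrM (@ger0_norm _ (powR _ _)) ?powR_ge0//.
rewrite (le_trans (ler_pM _ _ xk Hk)) ?powR_ge0//.
rewrite [leLHS](_ : _ = (C1 * phi 0%N) * ((1 + d) * (2 + j%:R) ^+ 2 * rho ^+ j * w));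
  last by ring.
rewrite -!(mulrA (C1 * phi 0%N + 1)) ler_wpM2r ?lerDl//.
by rewrite !mulr_ge0 ?exprn_ge0 ?powR_ge0 ?addr_ge0// (le_trans ler01).
Qed.

End Levels.

(** * Increments of the series *)

Section Increments.
Context {R : realType}.
Variables (psi H : R -> R) (x : nat -> int -> R) (phi : nat -> R) (t : R).
Variables (a b C1 : R).
Hypotheses (phi_slow : slow_growth phi) (a0 : 0 < a) (b1 : b < 1).
Hypotheses (Hab : forall x, a <= H x <= b) (Hlog : log_holder H).
Hypotheses (C10 : 0 <= C1) (xC1 : coef_growth x phi t C1).
Hypotheses (psi_decay : rapidly_decreasing psi)
  (dpsi_decay : rapidly_decreasing (derive1 psi))
  (psi_derivable : forall x, derivable psi x 1).

Local Notation rho := (2 `^ (- a)).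
Local Notation term j s k := (coef H x j k * psi (2 ^+ j * s - k%:~R)).

Lemma ler_pM_inv (u v w : R) (A B : R) (m n : nat) : 1 <= w -> 0 <= A ->
  0 <= B -> `|u| <= A * w ^+ m -> `|v| <= B * (w ^+ (n + m))^-1 ->
  `|u * v| <= A * B * (w ^+ n)^-1.
Proof.
move=> w1 A0 B0 hu hv; have w0 : 0 < w by exact: lt_le_trans w1.
rewrite normrM (le_trans (ler_pM _ _ hu hv))//.
rewrite exprD invfM [leLHS](_ : _ =
  A * B * (w ^+ n)^-1 * (w ^+ m / w ^+ m)); last by ring.
by rewrite mulfV ?mulr1// gt_eqF ?exprn_gt0.
Qed.

Lemma level_summable : exists C : R, 0 < C /\ forall (j : nat) (s : R),
  let M := C * (1 + `|s - t|) * ((2 + j%:R) ^+ 2 * rho ^+ j) in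
  [/\ sumZ_cvg (fun k => term j s k), `|level psi H x j s| <= M &
      forall n, `|sumZ_partial (fun k => term j s k) n| <= M].
Proof.
have [C [C0 hC]] := coef_global_le phi_slow Hab C10 xC1.
have [D [D0 hD]] := psi_decay 3%N.
exists (8 * (C * D)); split; first by rewrite !mulr_gt0.
move=> j s M; pose A := C * (1 + `|s - t|) * (2 + j%:R) ^+ 2 * rho ^+ j * D.
have A0 : 0 <= C * (1 + `|s - t|) * (2 + j%:R) ^+ 2 * rho ^+ j.
  by rewrite !mulr_ge0 ?exprn_ge0 ?addr_ge0// ltW.
have hA k : `|term j s k| <= A * ((1 + `|2 ^+ j * s - k%:~R|) ^+ 2)^-1.
  apply: (@ler_pM_inv _ _ _ _ _ 1 2) => //; first by rewrite lerDl.
    exact: ltW.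
have Age0 : 0 <= A by rewrite mulr_ge0// ltW.
have -> : M = 8 * A by rewrite /M /A; ring.
have [h1 h2] := sumZ_dominated Age0 hA.
by split => //; exact: sumZ_partial_le Age0 hA.
Qed.

Lemma level_near_le : exists C : R, 0 < C /\ forall (n i : nat) (s : R),
  `|s - t| <= 2 ^- n ->
  `|level psi H x (n + i) s| <=
    C * phi n * 2 `^ (- (H t * n%:R)) * ((2 + i%:R) ^+ 2 * rho ^+ i).
Proof.
have [C [C0 hC]] := coef_near_le phi_slow a0 b1 Hab Hlog C10 xC1.
(* Three powers cancel the growth of the coefficients and two make the sum over [k] converge. *)
have [D [D0 hD]] := psi_decay 5%N.
have [phi0 _ _] := phi_slow.
exists (8 * (C * D)); split; first by rewrite !mulr_gt0.
move=> n i s st.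
pose B := C * phi n * (2 + i%:R) ^+ 2 * rho ^+ i * 2 `^ (- (H t * n%:R)).
have B0 : 0 <= B.
  by rewrite !mulr_ge0 ?exprn_ge0 ?powR_ge0 ?addr_ge0 ?(ltW C0) ?(ltW (phi0 _)).
have hA k : `|term (n + i) s k| <=
    B * D * ((1 + `|2 ^+ (n + i) * s - k%:~R|) ^+ 2)^-1.
  apply: (@ler_pM_inv _ _ _ _ _ 3 2) => //; first by rewrite lerDl.
    exact: ltW.
  exact: hC.
have Age0 : 0 <= B * D by rewrite mulr_ge0// ltW.
have [_ h2] := sumZ_dominated Age0 hA.
by rewrite (le_trans h2)// /B le_eqVlt; apply/orP; left; apply/eqP; ring.
Qed.

Lemma level_increment_le : exists C : R, 0 < C /\ forall (j : nat) (s : R),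
  `|s - t| <= 2 ^- j ->
  `|level psi H x j s - level psi H x j t| <=
    C * phi j * 2 `^ (- (H t * j%:R)) * (2 ^+ j * `|s - t|).
Proof.
have [C [C0 hC]] := coef_near_le phi_slow a0 b1 Hab Hlog C10 xC1.
have [D [D0 hD]] := increment_decay 5 psi_derivable dpsi_decay.
have [E [E0 hE]] := level_summable.
have [phi0 _ _] := phi_slow.
exists (32 * (C * D)); split; first by rewrite !mulr_gt0.
move=> j s st; have p2 : 0 < 2 ^+ j :> R by exact: exprn_gt0.
rewrite /level sumZB; [|by have [] := hE j s|by have [] := hE j t].
(* The 4 is [(2 + i%:R) ^+ 2] at [i = 0]: the coefficients are bounded at level [j] itself, around
   [t]. *)
pose B := C * phi j * 4 * 2 `^ (- (H t * j%:R)).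
pose B' := D * (2 ^+ j * `|s - t|).
have B0 : 0 <= B by rewrite !mulr_ge0 ?powR_ge0 ?(ltW C0) ?(ltW (phi0 _)).
have B'0 : 0 <= B' by rewrite !mulr_ge0 ?(ltW D0) ?(ltW p2).
have hA k : `|term j s k - term j t k| <=
    B * B' * ((1 + `|2 ^+ j * t - k%:~R|) ^+ 2)^-1.
  rewrite -mulrBr.
  apply: (@ler_pM_inv _ _ _ _ _ 3 2) => //; first by rewrite lerDl.
    have := hC j 0%N t k; rewrite subrr normr0 addn0 => h.
    rewrite (le_trans (h _)) ?invr_ge0 ?(ltW p2)//.
    by rewrite /B le_eqVlt; apply/orP; left; apply/eqP; rewrite /=; ring.
  have e : (2 ^+ j * s - k%:~R) - (2 ^+ j * t - k%:~R) = 2 ^+ j * (s - t) by ring.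
  have := hD (2 ^+ j * s - k%:~R) (2 ^+ j * t - k%:~R).
  rewrite e normrM (gtr0_norm p2); apply.
  by rewrite -ler_pdivlMl// mulr1.
have Age0 : 0 <= B * B' by rewrite mulr_ge0// ltW.
have [_ h2] := sumZ_dominated Age0 hA.
by rewrite (le_trans h2)// /B /B' le_eqVlt; apply/orP; left; apply/eqP; ring.
Qed.

Lemma sqr_geometric_le (r : R) : 0 < r -> r < 1 -> exists B : R, 0 < B /\
  forall n : nat, \sum_(0 <= i < n) (2 + i%:R) ^+ 2 * r ^+ i <= B.
Proof.
move=> r0 r1; have [B [B0 hB]] := poly_geometric_le r0 r1.
exists B; split => // n; apply: le_trans (hB n).
apply: ler_sum => i _; rewrite ler_wpM2r ?exprn_ge0 ?(ltW r0)//.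
by rewrite ler_weXn2l//; have := ler0n R i; lra.
Qed.

Lemma wavelet_partial_sums_le : exists C : R, 0 < C /\ forall s : R,
  [/\ cvgn (series (fun j => level psi H x j s)),
      forall J, `|series (fun j => level psi H x j s) J| <= C * (1 + `|s - t|) &
      `|wavelet_series psi H x s| <= C * (1 + `|s - t|)].
Proof.
have [C [C0 hC]] := level_summable.
have [B [B0 hB]] := sqr_geometric_le (rho_gt0 a) (rho_lt1 a0).
exists (C * B); split; first exact: mulr_gt0.
move=> s; pose e j := C * (1 + `|s - t|) * ((2 + j%:R) ^+ 2 * rho ^+ j).
have d0 : 0 <= C * (1 + `|s - t|) by rewrite mulr_ge0 ?addr_ge0// ltW.
have he J : \sum_(0 <= j < J) e j <= C * B * (1 + `|s - t|).
  by rewrite -big_distrr/= [leRHS]mulrAC ler_wpM2l.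
have hl j : `|level psi H x j s| <= e j by have [] := hC j s.
have [c1 c2] := series_dominated hl he.
split => // J; rewrite (le_trans (ler_norm_sum _ _ _))// (le_trans _ (he J))//.
exact: ler_sum.
Qed.

(** Levels below [n] are smooth at the scale of [s - t]; their increments sum geometrically towards
    level [n] since [H t <= b < 1]. Levels from [n] on are bounded at [s] and at [t] separately and
    sum geometrically since [0 < a <= H]. *)
Lemma wavelet_increment_le : exists C : R, 0 < C /\ forall (n : nat) (s : R),
  `|s - t| <= 2 ^- n ->
  `|wavelet_series psi H x s - wavelet_series psi H x t| <=
    C * phi n * 2 `^ (- (H t * n%:R)).
Proof.
have [phi0 phim _] := phi_slow.
have [E [E0 hE]] := wavelet_partial_sums_le.
have [C [C0 hC]] := level_near_le.
have [C' [C'0 hC']] := level_increment_le.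
have [B [B0 hB]] := sqr_geometric_le (rho_gt0 a) (rho_lt1 a0).
pose sigma : R := 2 `^ (- (1 - b)).
have s0 : 0 < sigma by exact: powR_gt0.
have s1 : sigma < 1 by apply: powR2N_lt1; rewrite subr_gt0.
have B'0 : 0 < (1 - sigma)^-1 by rewrite invr_gt0 subr_gt0.
exists (C' * (1 - sigma)^-1 + 2 * C * B).
split; first by rewrite addr_gt0 ?mulr_gt0.
move=> n s st.
pose dl j := level psi H x j s - level psi H x j t.
have p2 m : 0 < 2 ^+ m :> R by exact: exprn_gt0.
set P := 2 `^ (- (H t * n%:R)).
have P0 : 0 <= P by exact: powR_ge0.
have low : \sum_(0 <= j < n) `|dl j| <= C' * (1 - sigma)^-1 * phi n * P.
  apply: (@le_trans _ _ (\sum_(0 <= j < n) C' * phi n * P * sigma ^+ (n - j))).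
    apply: ler_sum_nat => j /andP[_ jn].
    have hn : 2 ^- n <= 2 ^- j :> R.
      by rewrite lef_pV2 ?posrE// ler_weXn2l// ?ler1n// ltnW.
    rewrite (le_trans (hC' j s (le_trans st hn)))//.
    rewrite -!mulrA ler_wpM2l ?(ltW C'0)//.
    rewrite ler_pM ?mulr_ge0 ?powR_ge0 ?(ltW (phi0 _)) ?(ltW (p2 _))//.
      exact: phim (ltnW jn).
    apply: (@le_trans _ _ (2 `^ (- (H t * j%:R)) * (2 ^+ j * 2 ^- n))).
      by rewrite ler_wpM2l ?powR_ge0// ler_wpM2l// ltW.
    rewrite -[2 ^- n]powR_invn// -[2 ^+ j]powR_mulrn//.
    rewrite -[sigma ^+ _]powR_mulrn ?powR_ge0// /P /sigma -powRrM.
    rewrite -!powRD ?pnatr_eq0 ?implybT// ler_powR ?ler1n//.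
    rewrite natrB ?(ltnW jn)//.
    have hj : j%:R <= n%:R :> R by rewrite ler_nat ltnW.
    by have /andP[_ h] := Hab t; nra.
  rewrite -big_distrr/= -!mulrA ler_wpM2l ?(ltW C'0)//.
  rewrite [leRHS](_ : _ = phi n * (P * (1 - sigma)^-1)); last by ring.
  rewrite ler_wpM2l ?(ltW (phi0 _))// ler_wpM2l//.
  rewrite big_nat_rev/= add0n (le_trans _ (sum_geometric_le n (ltW s0) s1))//.
  rewrite ler_sum_nat// => i /andP[_ iN].
  rewrite subnA// ?(ltnW)// subnn add0n exprS ler_piMl ?exprn_ge0 ?(ltW s0)//.
  exact: ltW.
have high J : \sum_(n <= j < n + J) `|dl j| <= 2 * C * B * phi n * P.
  rewrite -{1}[n]add0n big_addn addKn.
  apply: (@le_trans _ _ (\sum_(0 <= i < J)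
      2 * C * phi n * P * ((2 + i%:R) ^+ 2 * rho ^+ i))).
    apply: ler_sum => i _; rewrite [(i + n)%N]addnC (le_trans (ler_normB _ _))//.
    have h1 := hC n i s st.
    have h2 := hC n i t; rewrite subrr normr0 invr_ge0 (ltW (p2 _)) in h2.
    have {}h2 := h2 isT; rewrite -/P in h1 h2; lra.
  rewrite -big_distrr/= [leRHS](_ : _ = 2 * C * phi n * P * B); last by ring.
  by rewrite ler_wpM2l// !mulr_ge0 ?(ltW C0) ?(ltW (phi0 _)).
have [cs _ _] := hE s; have [ct _ _] := hE t.
rewrite /wavelet_series -/(level psi H x _ s).
have -> : limn (series (fun j => level psi H x j s)) -
    limn (series (fun j => level psi H x j t)) = limn (series dl).
  apply/esym/cvg_lim => //; rewrite (_ : series dl =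
    series (fun j => level psi H x j s) \- series (fun j => level psi H x j t)).
    exact: cvgB.
  by apply/funext => J; rewrite /series/= sumrB.
have [|_] := @series_dominated _ dl (fun j => `|dl j|)
    ((C' / (1 - sigma) + 2 * C * B) * phi n * P) (fun j => lexx _).
  (* Summing up to [n + J] instead of [J] only adds nonnegative terms and makes the cut at [n]
     available. *)
  move=> J; apply: (@le_trans _ _ (\sum_(0 <= j < n + J) `|dl j|)).
    rewrite [leRHS](@big_cat_nat _ _ _ J)//= ?leq_addl// lerDl.
    exact: sumr_ge0.
  by rewrite (@big_cat_nat _ _ _ n)//= ?leq_addr// -mulrA mulrDl !mulrA lerD.
by [].
Qed.

End Increments.

(** * The dual wavelet *)

Section AffineChange.
Context {R : realType}.
Local Notation mu := (@lebesgue_measure R).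
Variables (c m : R).
Hypothesis c0 : 0 < c.

Let aff : measurableTypeR R -> measurableTypeR R := fun x => c * x - m.

Let measurable_aff : measurable_fun setT aff.
Proof.
apply: continuous_measurable_fun => x.
by apply: cvgB; [exact: mulrl_continuous|exact: cvg_cst].
Qed.

(** The image of Lebesgue measure under the affine map, rescaled by [c]; agreement on half-open
    intervals identifies it with Lebesgue measure. *)
Let nu : {measure set (measurableTypeR R) -> \bar R} :=
  mscale (PosNum c0)%:num%:nng
   (measure_function_pushforward__canonical__measure_function_Measure
     mu measurable_aff).

Let nuE A : measurable A -> mu A = nu A.
Proof.
apply: lebesgue_measure_unique => X [[a b] _ <-] /=.
rewrite /nu /= /mscale /= /pushforward.
have -> : aff @^-1` `]a, b]%classic = `](a + m) / c, (b + m) / c]%classic.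
  apply/seteqP; split => y; rewrite /= !in_itv/= /aff;
    rewrite ltr_pdivrMr// ler_pdivlMr// ![_ * c]mulrC => /andP[? ?];
    by apply/andP; split; lra.
rewrite !lebesgue_measure_itv/= !lte_fin ltr_pM2r ?invr_gt0// ltrD2r.
case: ifPn => _; last by rewrite mule0.
by rewrite -!EFinD -EFinM; congr EFin; field; rewrite gt_eqF.
Qed.

Local Open Scope ereal_scope.

Lemma ge0_integral_affine (g : R -> \bar R) : measurable_fun setT g ->
  (forall x, 0 <= g x) ->
  \int[mu]_x g (c * x - m)%R = (c^-1)%:E * \int[mu]_x g x.
Proof.
move=> mg g0.
have -> : \int[mu]_x g x = \int[nu]_x g x.
  by apply: eq_measure_integral => A mA _; exact: nuE.
rewrite ge0_integral_mscale// ge0_integral_pushforward//= muleA -EFinM.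
by rewrite mulVf ?gt_eqF// mul1e.
Qed.

Lemma integral_affine (g : R -> \bar R) : measurable_fun setT g ->
  mu.-integrable setT g ->
  \int[mu]_x g (c * x - m)%R = (c^-1)%:E * \int[mu]_x g x.
Proof.
move=> mg ig; rewrite integralE [in RHS]integralE.
rewrite muleBr ?integrable_add_def//.
rewrite -!ge0_integral_affine//.
- by congr (_ - _); apply: eq_integral => x _; rewrite ?funeposE ?funenegE.
- by exact: measurable_funeneg.
- by exact: measurable_funepos.
Qed.

Lemma integrable_affine (g : R -> \bar R) : 
  mu.-integrable setT g -> mu.-integrable setT (fun x => g (c * x - m)%R).
Proof.
move=> /integrableP[mg ig]; apply/integrableP; split.
  exact: (measurableT_comp mg measurable_aff).
rewrite (ge0_integral_affine (g := fun x => `|g x|))//; last exact: measurableT_comp.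
by rewrite lte_mul_pinfty ?lee_fin ?invr_ge0 ?(ltW c0).
Qed.

End AffineChange.

(** * Moments of the dual wavelet *)

Section Pairing.
Context {R : realType}.
Local Notation mu := (@lebesgue_measure R).

Lemma integrable_inv_oneDsqr :
  mu.-integrable setT (fun x : R => ((1 + x ^+ 2)^-1)%:E).
Proof.
have cf : continuous (fun x : R => (1 + x ^+ 2)^-1) by exact: continuous_oneDsqrV.
have f0 (x : R) : 0 <= (1 + x ^+ 2)^-1 by rewrite invr_ge0 addr_ge0 ?sqr_ge0.
apply/integrableP; split.
  by apply/measurable_EFinP; exact: continuous_measurable_fun.
under eq_integral do rewrite gee0_abs ?lee_fin ?f0//.
rewrite (ge0_symfun_integralT f0 cf); last by move=> x /=; rewrite sqrrN.
rewrite (_ : [set x | 0 <= x] = `[0, +oo[%classic); last first.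
  by apply/seteqP; split => y /=; rewrite in_itv/= andbT.
by have := @integral0y_oneDsqr R; rewrite /oneDsqr => ->; rewrite ltry.
Qed.

(** Decay in the mean rather than pointwise: a compactly supported [psit] is only known to be square
    integrable and may be unbounded. *)
Definition integrable_moments (g : R -> R) := measurable_fun setT g /\
  forall q : nat, mu.-integrable setT (fun x => ((1 + `|x|) ^+ q * g x)%:E).

Lemma measurable_weight (q : nat) :
  measurable_fun setT (fun x : R => (1 + `|x|) ^+ q).
Proof.
by apply: measurable_funX; apply: measurable_funD.
Qed.

Lemma rapidly_decreasing_integrable_moments (g : R -> R) :
  measurable_fun setT g -> rapidly_decreasing g -> integrable_moments g.
Proof.
move=> mg dg; split => // q.
have [D [D0 hD]] := dg (q + 2)%N.
apply: le_integrable (integrableZl measurableT D integrable_inv_oneDsqr) => //.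
  by apply/measurable_EFinP; apply: measurable_funM => //; exact: measurable_weight.
move=> x _; rewrite -EFinM/= lee_fin.
have w0 : 0 < 1 + `|x| by rewrite ltr_pwDl.
have i0 : 0 <= D * (1 + x ^+ 2)^-1.
  by rewrite mulr_ge0 ?(ltW D0)// invr_ge0 addr_ge0 ?sqr_ge0.
rewrite (ger0_norm i0) normrM ger0_norm ?exprn_ge0 ?(ltW w0)//.
rewrite (le_trans (ler_wpM2l _ (hD x))) ?exprn_ge0 ?(ltW w0)//.
rewrite exprD invfM mulrCA (mulrA (_ ^+ q)) mulfV ?mul1r ?gt_eqF ?exprn_gt0//.
rewrite ler_wpM2l ?(ltW D0)// lef_pV2 ?posrE ?exprn_gt0 ?ltr_pwDl ?sqr_ge0//.
by rewrite -[x ^+ 2]real_normK ?num_real//; have := normr_ge0 x; nra.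
Qed.

(** Measurability and square integrability of [psit] are read off the Riesz basis at index [(0, 0)].
    On a compact support, the absolute value of [psit] is at most [1 + psit ^+ 2]. *)
Lemma wavelet_dual_moments (psi psit : R -> R) : wavelet_pair psi psit ->
  integrable_moments psit.
Proof.
move=> [[_ [/(_ (0, 0))+ _ _]] _ + _ _].
move=> L2; have Dy : dyadic_family psit (0, 0) = psit.
  apply/funext => x; rewrite /dyadic_family/= mul0r powRr0 mul1r expr0z mul1r.
  by rewrite subr0.
rewrite {}Dy in L2.
have mpsit : measurable_fun setT psit.
  by move: (L2); rewrite inE => /andP[+ _]; rewrite inE.
case=> [[_ [dpsit h]]|[_ /compactly_supported_bound[B hB]]].
  apply: rapidly_decreasing_integrable_moments => //.
  by apply: moments_rapidly_decreasing => m; exact: (h m 0%N).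
split => // q.
have i2 := Lfun2_integrable_sqr L2.
pose B' := `|B|.
have i1 : mu.-integrable setT (EFin \o (\1_(`[- B', B']) : R -> R)).
  by apply: integrable_indic_itv.
have i3 := integrableZl measurableT ((1 + B') ^+ q) (integrableD measurableT i1 i2).
apply: le_integrable i3 => //.
  by apply/measurable_EFinP; apply: measurable_funM => //; exact: measurable_weight.
move=> x _; rewrite /= lee_fin.
have B'0 : 0 <= B' by exact: normr_ge0.
have i0 : 0 <= (1 + B') ^+ q * (\1_`[- B', B'] x + psit x ^+ 2).
  apply: mulr_ge0; first by rewrite exprn_ge0// addr_ge0.
  by rewrite addr_ge0 ?sqr_ge0// indicE.
rewrite (ger0_norm i0) normrM ger0_norm ?exprn_ge0//.
have [xB|xB] := leP `|x| B'; last first.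
  move: i0; rewrite hB ?(le_lt_trans (ler_norm B))//.
  by rewrite normr0 mulr0.
rewrite ler_pM ?exprn_ge0//; first by rewrite lerXn2r ?nnegrE ?addr_ge0// lerD2l.
rewrite indicE mem_set/=; last by rewrite in_itv/= -ler_norml.
by rewrite -[psit x ^+ 2]real_normK ?num_real//; have := normr_ge0 (psit x); nra.
Qed.

End Pairing.

(** * Calculus of integrals against a fixed function *)

Section DualPairing.
Context {R : realType}.
Local Notation mu := (@lebesgue_measure R).
Implicit Types (theta h g : R -> R) (v w c : R).

(** Measurability and integrability travel with the value, so that sums, multiples and limits need
    no side conditions. *)
Definition pairing theta h v := [/\ measurable_fun setT h,
  mu.-integrable setT (fun x => (h x * theta x)%:E) &
  (\int[mu]_x (h x * theta x)%:E = v%:E)%E].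

Lemma pairingD theta g h v w : pairing theta g v -> pairing theta h w ->
  pairing theta (fun x => g x + h x) (v + w).
Proof.
move=> [mg ig vg] [mh ih vh].
have E x : ((g x + h x) * theta x)%:E = ((g x * theta x)%:E + (h x * theta x)%:E)%E.
  by rewrite mulrDl EFinD.
split; first exact: measurable_funD.
  under eq_fun do rewrite E.
  exact: integrableD.
by under eq_integral do rewrite E; rewrite integralD// vg vh.
Qed.

Lemma pairingZ theta h v c : pairing theta h v ->
  pairing theta (fun x => c * h x) (c * v).
Proof.
move=> [mh ih vh].
have E x : (c * h x * theta x)%:E = (c%:E * (h x * theta x)%:E)%E.
  by rewrite -mulrA EFinM.
split; first exact: measurable_funM.
  under eq_fun do rewrite E.
  exact: integrableZl.
by under eq_integral do rewrite E; rewrite integralZl// vh.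
Qed.

Lemma pairing_sum theta (h : nat -> R -> R) (v : R^nat) n :
  (forall i, pairing theta (h i) (v i)) ->
  pairing theta (fun x => \sum_(0 <= i < n) h i x) (\sum_(0 <= i < n) v i).
Proof.
move=> hv; elim: n => [|n IH].
  have E x : ((\sum_(0 <= i < 0) h i x) * theta x)%:E = 0%E.
    by rewrite big_geq// mul0r.
  split; last by under eq_integral do rewrite E; rewrite integral0 big_geq.
    by under eq_fun do rewrite big_geq//; exact: measurable_cst.
  by under eq_fun do rewrite E; exact: integrable0.
under eq_fun do rewrite big_nat_recr//=.
by rewrite big_nat_recr//=; exact: pairingD.
Qed.

(** Dominated convergence. Values that are eventually constant are enough, since biorthogonality
    leaves a single nonzero term in the partial sums. *)
Lemma pairing_limit theta (h_ : nat -> R -> R) h (v_ : R^nat) v C :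
  measurable_fun setT theta ->
  mu.-integrable setT (fun x => ((1 + `|x|) * theta x)%:E) ->
  (forall n x, `|h_ n x| <= C * (1 + `|x|)) ->
  (forall x, h_ ^~ x @ \oo --> h x) ->
  (forall n, pairing theta (h_ n) (v_ n)) ->
  (\forall n \near \oo, v_ n = v) -> pairing theta h v.
Proof.
move=> mtheta itheta hC hh hv vv.
have mh n : measurable_fun setT (h_ n) by have [] := hv n.
have mh' : measurable_fun setT h by exact: measurable_fun_cvg mh (fun x _ => hh x).
have mprod g : measurable_fun setT g ->
    measurable_fun setT (fun x => (g x * theta x)%:E).
  by move=> mg; apply/measurable_EFinP; exact: measurable_funM.
have [|||||i1 _ i3] := @dominated_convergence _ _ R mu setT measurableT
  (fun n x => (h_ n x * theta x)%:E) (fun x => (h x * theta x)%:E)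
  (fun x => (C%:E * `|((1 + `|x|) * theta x)%:E|)%E).
- by move=> n; exact: mprod.
- exact: mprod.
- by apply: aeW => x _; apply: cvg_EFin; [exact: nearW|apply: cvgMl; exact: hh].
- by apply: integrableZl => //; exact: integrable_abse.
- apply: aeW => x n _; rewrite -EFinM lee_fin !normrM.
  rewrite mulrA ler_wpM2r// [`|1 + _|]ger0_norm ?addr_ge0//.
split => //.
apply: (cvg_unique _ i3) => //.
apply: cvg_near_cst; apply: filterS vv => n e.
by rewrite /= -e; have [_ _ <-] := hv n.
Qed.

End DualPairing.

Section SingleTerm.
Context {R : realType}.

Lemma sum_single (u : R^nat) (m n : nat) : (m < n)%N ->
  (forall i, i != m -> u i = 0) -> \sum_(0 <= i < n) u i = u m.
Proof.
move=> mn u0; rewrite big_mkord (bigD1 (Ordinal mn))//= big1 ?addr0// => i im.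
by apply: u0; apply: contra im => /eqP im; apply/eqP/val_inj.
Qed.

Lemma sumZ_partial_single (u : int -> R) (k : int) (n : nat) : (`|k| < n)%N ->
  (forall i, i != k -> u i = 0) -> sumZ_partial u n = u k.
Proof.
rewrite /sumZ_partial; case: k => [m|m] /= mn u0.
  rewrite /series /= (sum_single mn) => [|i im]; last by rewrite u0.
  by rewrite big1 ?addr0// => i _; rewrite u0.
rewrite /series /= big1 => [|i _]; last by rewrite u0.
rewrite add0r (@sum_single _ m)//; first exact: ltnW.
by move=> i im; rewrite u0// -NegzE; apply: contra im => /eqP[->].
Qed.

End SingleTerm.

(** * Recovering coefficients by duality *)

Section DualCoefficient.
Context {R : realType}.
Local Notation mu := (@lebesgue_measure R).
Variables (psi psit : R -> R).
Hypothesis hpsi : wavelet_pair psi psit.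

(** Not normalized in [L^2]: the factor [2 ^- j] appears in the pairings instead. *)
Definition dual (j : nat) (k : int) (x : R) := psit (2 ^+ j * x - k%:~R).

Lemma measurable_dual j k : measurable_fun setT (dual j k).
Proof.
have [mpsit _] := wavelet_dual_moments hpsi.
apply: (measurableT_comp mpsit); apply: continuous_measurable_fun => x.
by apply: cvgB; [exact: mulrl_continuous|exact: cvg_cst].
Qed.

Lemma integrable_dual_weight j k (q : nat) :
  mu.-integrable setT
    (fun x => ((1 + `|2 ^+ j * x - k%:~R|) ^+ q * dual j k x)%:E).
Proof.
have [_ /(_ q) h] := wavelet_dual_moments hpsi.
by have := integrable_affine k%:~R (exprn_gt0 j (ltr0n R 2)) h.
Qed.

Lemma integrable_dual_linear j k :
  mu.-integrable setT (fun x => ((1 + `|x|) * dual j k x)%:E).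
Proof.
apply: le_integrable (integrableZl measurableT (1 + `|k%:~R|)
  (integrable_dual_weight j k 1)) => //.
  apply/measurable_EFinP; apply: measurable_funM; last exact: measurable_dual.
  exact: (@measurable_weight R 1).
move=> x _; rewrite -EFinM/= lee_fin expr1 mulrA !normrM.
rewrite ler_wpM2r// [ `|1 + `|x| |]ger0_norm ?addr_ge0//.
rewrite [ `|1 + `|k%:~R| |]ger0_norm ?addr_ge0// [ `|1 + _|]ger0_norm ?addr_ge0//.
have p1 : 1 <= 2 ^+ j :> R by rewrite exprn_ege1// ler1n.
have : `|x| <= 2 ^+ j * `|x| by rewrite ler_peMl.
have := ler_normD (2 ^+ j * x - k%:~R) k%:~R.
rewrite subrK normrM [ `|2 ^+ j|]ger0_norm ?exprn_ge0//.
have := normr_ge0 (2 ^+ j * x - k%:~R); have := normr_ge0 (k%:~R : R).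
move=> *; nra.
Qed.

Lemma continuous_wavelet : continuous psi.
Proof.
have [_ _ _ [dpsi _] _] := hpsi.
by move=> x; apply: differentiable_continuous; apply/derivable1_diffP.
Qed.

Lemma measurable_dilate (f : R -> R) (j : nat) (k : int) : continuous f ->
  measurable_fun setT (fun x : R => f (2 ^+ j * x - k%:~R)).
Proof.
move=> cf; apply: continuous_measurable_fun => x.
apply: (@continuous_comp R R R (fun x : R => 2 ^+ j * x - k%:~R) f); last exact: cf.
by apply: cvgB; [exact: mulrl_continuous|exact: cvg_cst].
Qed.

Lemma pairing_dilate (j j' : nat) (k k' : int) :
  pairing (dual j' k') (fun x => psi (2 ^+ j * x - k%:~R))
    (2 ^- j' * ((j == j') && (k == k'))%:R).
Proof.
have [psid _] := wavelet_decay hpsi.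
have [_ biorth _ _ _] := hpsi.
have [D [D0 hD]] := psid 0%N.
have ipd : mu.-integrable setT
    (fun x => (psi (2 ^+ j * x - k%:~R) * dual j' k' x)%:E).
  apply: le_integrable (integrableZl measurableT D
      (integrable_dual_linear j' k')) => //.
    apply/measurable_EFinP; apply: measurable_funM; last exact: measurable_dual.
    exact: (measurable_dilate _ _ continuous_wavelet).
  move=> x _; rewrite -EFinM/= lee_fin mulrA !normrM ler_wpM2r//.
  rewrite (le_trans (hD _))// expr0 invr1 mulr1 (gtr0_norm D0) ler_peMr ?(ltW D0)//.
  by rewrite ger0_norm ?addr_ge0// lerDl.
split => //; first exact: (measurable_dilate _ _ continuous_wavelet).
have := biorth (j%:Z, k) (j'%:Z, k'); rewrite /dyadic_family/=.
set c := 2 `^ _; set c' := 2 `^ _.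
have E x : (c * psi (2 ^ (j%:Z) * x - k%:~R) *
    (c' * psit (2 ^ (j'%:Z) * x - k'%:~R)))%:E =
    ((c * c')%:E * (psi (2 ^+ j * x - k%:~R) * dual j' k' x)%:E)%E.
  by rewrite -EFinM /dual -!exprnP; congr EFin; ring.
under eq_integral do rewrite E.
rewrite integralZl//.
have := integrable_fin_num measurableT ipd.
case: (\int[mu]_x _)%E => // v _ [] h; congr EFin.
have cc0 : c * c' != 0 by rewrite mulf_neq0// gt_eqF// powR_gt0.
apply: (mulfI cc0); rewrite h xpair_eqE eqz_nat.
have [jj'|_] /= := eqVneq j j'; last by rewrite !mulr0.
rewrite mulrA -[LHS]mul1r; congr (_ * _).
rewrite /c /c' jj' -powRD ?pnatr_eq0 ?implybT//.
have -> : j'%:~R / 2 + j'%:~R / 2 = j'%:R :> R by rewrite -[j'%:R]/(j'%:~R); field.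
by rewrite powR_mulrn// mulfV// gt_eqF// exprn_gt0.
Qed.

(** As [psit] has zero mean, [f] may be replaced by [f - f t]. The polynomial weight is then moved
    from [t] to [k 2^-j], at most one cell away and hence at cost [2 ^+ q], and the affine change of
    variables leaves a fixed moment of [psit]. *)
Lemma dual_coefficient_le (q : nat) : exists m : R, 0 < m /\
  forall (f : R -> R) (j : nat) (k : int) (t v M : R),
  `|2 ^+ j * t - k%:~R| <= 1 -> 0 <= M ->
  (forall s, `|f s - f t| <= M * (1 + 2 ^+ j * `|s - t|) ^+ q) ->
  pairing (dual j k) f v -> `|v| <= M * m * 2 ^- j.
Proof.
have [mpsit ipsit] := wavelet_dual_moments hpsi.
have [_ _ _ _ [_ psit0]] := hpsi.
have := integrable_fin_num measurableT (integrable_abse (ipsit q)).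
case E : (\int[mu]_x _)%E => [m| |] // _.
have m0 : 0 <= m by rewrite -lee_fin -E; apply: integral_ge0 => x _; exact: abse_ge0.
exists (2 ^+ q * (m + 1)); split; first by rewrite mulr_gt0 ?exprn_gt0// ltr_wpDl.
move=> f j k t v M kt M0 fM hv.
have p2 : 0 < 2 ^+ j :> R by exact: exprn_gt0.
have h0 : pairing (dual j k) (fun=> f t) 0.
  rewrite -[0](mulr0 (f t)); rewrite (_ : (fun=> f t) = fun=> f t * 1); last first.
    by apply/funext => ?; rewrite mulr1.
  apply: pairingZ.
  have i0 : mu.-integrable setT (fun x => (psit x)%:E).
    by have := ipsit 0%N; apply: eq_integrable => // x _; rewrite expr0 mul1r.
  have E1 x : (1 * dual j k x)%:E = (psit (2 ^+ j * x - k%:~R))%:E.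
    by rewrite mul1r.
  split; first exact: measurable_cst.
    under eq_fun do rewrite E1.
    exact: (integrable_affine _ p2 i0).
  under eq_integral do rewrite E1.
  rewrite (integral_affine k%:~R p2 _ i0) ?psit0 ?mule0//.
  exact/measurable_EFinP.
have [_ idf vd] := pairingD hv (pairingZ (-1) h0).
rewrite mulr0 addr0 in vd.
have iw := integrable_dual_weight j k q.
rewrite -lee_fin -abse_EFin -vd.
apply: le_trans (le_abse_integral _ measurableT _) _ => //.
  by exact: measurable_int idf.
apply: (@le_trans _ _ (\int[mu]_x ((M * 2 ^+ q)%:E *
   `|((1 + `|2 ^+ j * x - k%:~R|) ^+ q * dual j k x)%:E|))%E).
  apply: ge0_le_integral => //.
  - by apply: measurableT_comp => //; exact: measurable_int idf.
  - apply: measurable_funeM; apply: measurableT_comp => //.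
    by exact: measurable_int iw.
  move=> x _; rewrite -EFinM lee_fin !normrM mulrA ler_wpM2r// mulN1r.
  rewrite (le_trans (fM x))// -mulrA ler_wpM2l//.
  rewrite (ger0_norm (exprn_ge0 _ _)) ?addr_ge0// -exprMn lerXn2r ?nnegrE
    ?mulr_ge0 ?addr_ge0 ?mulr_ge0 ?(ltW p2)//.
  have := ler_normB (2 ^+ j * x - k%:~R) (2 ^+ j * t - k%:~R).
  rewrite [X in `|X|](_ : _ = 2 ^+ j * (x - t)); last by ring.
  rewrite normrM (gtr0_norm p2).
  have := normr_ge0 (2 ^+ j * x - k%:~R); lra.
rewrite ge0_integralZl//; last 2 first.
- by apply: measurableT_comp => //; exact: measurable_int iw.
- by rewrite lee_fin mulr_ge0// exprn_ge0.
have := @ge0_integral_affine R _ k%:~R p2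
  (fun y => `|((1 + `|y|) ^+ q * psit y)%:E|%E).
rewrite /dual => ->//; last first.
  by apply: measurableT_comp => //; exact: measurable_int (ipsit q).
rewrite E -!EFinM lee_fin.
rewrite [leLHS](_ : _ = M * (2 ^+ q * m) * 2 ^- j); last by ring.
rewrite ler_wpM2r ?invr_ge0 ?(ltW p2)// ler_wpM2l// ler_wpM2l ?exprn_ge0//.
by rewrite lerDl.
Qed.

End DualCoefficient.

(** * Moduli of continuity *)

Section Limsup.
Context {R : realType}.
Implicit Types (f om : R -> R) (t : R).

Lemma limsup_increment_lty f om t (C delta : R) : 0 < delta ->
  (forall s, s != t -> `|s - t| < delta ->
    `|f s - f t| <= C * om `|s - t| /\ 0 < om `|s - t|) ->
  (limsup_increment f om t < +oo)%E.
Proof.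
move=> d0 h; rewrite /limsup_increment lime_supE.
apply: le_lt_trans (ltry C).
apply: le_trans (ereal_inf_lbound _) _ => /=.
  by exists delta => //; rewrite in_itv/= andbT.
apply: ge_ereal_sup => _ [s [/= ts st] <-].
have /h[] : s != t by exact/eqP.
  by rewrite distrC.
by move=> h1 h2; rewrite lee_fin ler_pdivrMr.
Qed.

Lemma limsup_increment_bound f om t : (forall x, 0 < x -> 0 < om x) ->
  0 <= om 0 -> limsup_increment f om t != +oo%E ->
  exists M delta : R, [/\ 0 <= M, 0 < delta & forall s, `|s - t| < delta ->
    `|f s - f t| <= M * om `|s - t|].
Proof.
move=> om0 om00; rewrite -ltey /limsup_increment lime_supE.
move=> /ereal_inf_lt[_ [e /= + <-]]; rewrite in_itv/= andbT => e0 he.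
have [M hM] : exists M : R, (ereal_sup [set (`|f s - f t| / om `|s - t|)%:E |
    s in ball t e `\ t] <= M%:E)%E.
  move: he; case: (ereal_sup _) => [r _|//|_]; first by exists r.
  by exists 0; rewrite leNye.
exists `|M|, e; split => // s se.
have [->|st] := eqVneq s t; first by rewrite !subrr normr0 mulr_ge0.
have o0 : 0 < om `|s - t| by rewrite om0// normr_gt0 subr_eq0.
rewrite -ler_pdivrMr// (le_trans _ (ler_norm M))// -lee_fin.
apply: le_trans hM; apply: ereal_sup_ubound; exists s => //.
split; last exact/eqP.
by rewrite /ball/= distrC.
Qed.

End Limsup.

Section Moduli.
Context {R : realType}.
Implicit Types (f om : R -> R) (t : R).

Lemma dyadic_bracket (r : R) : 1 <= r ->
  exists n : nat, 2 ^+ n <= r < 2 ^+ n.+1.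
Proof.
move=> r1; have r0 : 0 <= r by exact: le_trans r1.
have /andP[m1 m2] := truncn_itv r0.
set m := Num.truncn r in m1 m2.
have m0 : (0 < m)%N by rewrite truncn_ge_nat.
have /andP[h1 h2] := trunc_log_bounds (isT : (1 < 2)%N) m0.
exists (trunc_log 2 m); rewrite -!natrX; apply/andP; split.
  by rewrite (le_trans _ m1)// ler_nat.
by rewrite (lt_le_trans m2)// ler_nat.
Qed.

Lemma modulus_gt0 om : modulus_of_continuity om -> forall x, 0 < x -> 0 < om x.
Proof. by move=> [om0 _ omi _] x x0; rewrite -om0 omi. Qed.

(** The doubling constant is rounded up to [2 ^+ q], so that [n] doublings cost the [q]-th power of
    [2 ^+ n]. *)
Lemma modulus_polynomial om : modulus_of_continuity om ->
  exists q : nat, forall l x : R, 0 <= l -> 0 <= x ->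
    om (l * x) <= (2 * (1 + l)) ^+ q * om x.
Proof.
move=> hom; have [om0 omge omi [C [C0 hC]]] := hom.
have [q hq] : exists q : nat, C <= 2 ^+ q.
  have h1 : 1 <= 1 + C by rewrite lerDl ltW.
  have [n /andP[_ h]] := dyadic_bracket h1.
  by exists n.+1; rewrite (le_trans _ (ltW h))// lerDr.
have omn n x : 0 <= x -> om (2 ^+ n * x) <= (2 ^+ n) ^+ q * om x.
  move=> x0; elim: n => [|n IH]; first by rewrite expr0 expr1n !mul1r.
  rewrite !exprS -mulrA (le_trans (hC _ _)) ?mulr_ge0 ?exprn_ge0//.
  rewrite exprMn -mulrA; apply: ler_pM => //; first exact: ltW.
  by rewrite omge// mulr_ge0// exprn_ge0.
exists q => l x l0 x0.
have l1 : 1 <= 1 + l by rewrite lerDl.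
have [n /andP[h1 h2]] := dyadic_bracket l1.
have omle y z : 0 <= y -> y <= z -> om y <= om z.
  by move=> y0; rewrite le_eqVlt => /orP[/eqP->//|yz]; rewrite ltW// omi.
apply: (@le_trans _ _ (om (2 ^+ n.+1 * x))).
  apply: omle; first exact: mulr_ge0.
  by rewrite ler_wpM2r//; lra.
rewrite (le_trans (omn _ _ x0))// ler_wpM2r ?omge//.
by rewrite lerXn2r ?nnegrE ?exprn_ge0 ?mulr_ge0 ?addr_ge0// exprS ler_wpM2l.
Qed.

(* A local bound by [om] extends to all [s]: polynomial growth of the increments
   is compensated by [om (2 ^- j)], which decays at most exponentially in [j]. *)
Lemma modulus_global_bound f om t (K M delta : R) : modulus_of_continuity om ->
  0 <= K -> (forall s, `|f s - f t| <= K * (1 + `|s - t|)) ->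
  0 <= M -> 0 < delta ->
  (forall s, `|s - t| < delta -> `|f s - f t| <= M * om `|s - t|) ->
  exists (M' : R) (q : nat), 0 <= M' /\ forall (j : nat) (s : R),
    `|f s - f t| <= M' * om (2 ^- j) * (1 + 2 ^+ j * `|s - t|) ^+ q.
Proof.
move=> hom K0 hK M0 d0 hM.
have [q hq] := modulus_polynomial hom.
have om1 : 0 < om 1 by exact: modulus_gt0.
(* When [s] is at distance at least [delta] from [t], the weight [w] dominates the distance and
   [2 ^+ j], up to multiples of [d]. *)
pose d := 1 + delta^-1.
have d1 : 1 <= d by rewrite lerDl invr_ge0 ltW.
have dge0 : 0 <= d by exact: le_trans d1.
exists (M * 2 ^+ q + K * d * (4 * d) ^+ q / om 1), q.+1; split.
  by rewrite addr_ge0 ?mulr_ge0 ?invr_ge0 ?exprn_ge0 ?(ltW om1)// mulr_ge0.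
move=> j s; have p2 : 1 <= 2 ^+ j :> R by rewrite exprn_ege1// ler1n.
have p0 : 0 < 2 ^+ j :> R by rewrite exprn_gt0.
have omj : 0 < om (2 ^- j) by rewrite modulus_gt0// invr_gt0.
set w := 1 + 2 ^+ j * `|s - t|.
have w1 : 1 <= w by rewrite lerDl mulr_ge0// ltW.
have w0 : 0 <= w by exact: le_trans w1.
have T1 : 0 <= M * 2 ^+ q * om (2 ^- j) * w ^+ q.+1.
  by rewrite !mulr_ge0 ?exprn_ge0 ?(ltW omj).
have T2 : 0 <= K * d * (4 * d) ^+ q / om 1 * om (2 ^- j) * w ^+ q.+1.
  rewrite !mulr_ge0 ?exprn_ge0 ?invr_ge0 ?(ltW omj) ?(ltW om1)//.
  exact: mulr_ge0.
rewrite [leRHS](_ : _ = M * 2 ^+ q * om (2 ^- j) * w ^+ q.+1 +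
  K * d * (4 * d) ^+ q / om 1 * om (2 ^- j) * w ^+ q.+1); last by ring.
have [near|far] := ltP `|s - t| delta.
  rewrite (@le_trans _ _ (M * 2 ^+ q * om (2 ^- j) * w ^+ q.+1)) ?lerDl//.
  rewrite (le_trans (hM _ near))// -!mulrA ler_wpM2l//.
  have -> : `|s - t| = (2 ^+ j * `|s - t|) * 2 ^- j.
    by rewrite mulrAC mulfV ?mul1r// gt_eqF.
  rewrite (le_trans (hq _ _ _ _)) ?invr_ge0 ?mulr_ge0 ?(ltW p0)//.
  rewrite -/w exprMn -mulrA ler_wpM2l ?exprn_ge0// mulrC ler_wpM2l ?(ltW omj)//.
  by rewrite exprS ler_peMl ?exprn_ge0.
rewrite (@le_trans _ _ (K * d * (4 * d) ^+ q / om 1 * om (2 ^- j) * w ^+ q.+1))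
  ?lerDr//.
rewrite (le_trans (hK s))//.
have sd : 1 <= delta^-1 * `|s - t| by rewrite -ler_pdivrMl ?invr_gt0// invrK mulr1.
have s1 : 1 + `|s - t| <= d * w.
  have : `|s - t| <= 2 ^+ j * `|s - t| by rewrite ler_peMl.
  have : delta^-1 * `|s - t| <= delta^-1 * (2 ^+ j * `|s - t|).
    by rewrite ler_wpM2l ?invr_ge0 ?(ltW d0)// ler_peMl.
  have : 0 <= delta^-1 by rewrite invr_ge0 ltW.
  rewrite /d /w; nra.
have j1 : 1 + 2 ^+ j <= 2 * (d * w).
  have : 2 ^+ j <= 2 ^+ j * (delta^-1 * `|s - t|) by rewrite ler_peMr// ltW.
  have : 0 <= delta^-1 by rewrite invr_ge0 ltW.
  have : 0 <= 2 ^+ j * `|s - t| by rewrite mulr_ge0// ltW.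
  by rewrite /d /w; nra.
(* Going from scale [2 ^- j] to scale 1 costs the [q]-th power of [2 * (1 + 2 ^+ j)], which [w] now
   pays. *)
have key : 1 <= (4 * d) ^+ q / om 1 * om (2 ^- j) * w ^+ q.
  have := hq (2 ^+ j) (2 ^- j) (ltW p0); rewrite invr_ge0 => /(_ (ltW p0)).
  rewrite mulfV ?gt_eqF// => h.
  rewrite [leRHS](_ : _ = (4 * d * w) ^+ q * om (2 ^- j) / om 1); last first.
    by rewrite (exprMn _ (4 * d)); ring.
  rewrite ler_pdivlMr// mul1r (le_trans h)// ler_wpM2r ?(ltW omj)//.
  have e1 : 2 * (1 + 2 ^+ j) <= 4 * d * w by lra.
  have e0 : 0 <= 2 * (1 + 2 ^+ j) :> R by rewrite mulr_ge0// addr_ge0// ltW.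
  by apply: lerXn2r; rewrite ?nnegrE// (le_trans e0).
rewrite [leRHS](_ : _ = K * (d * w) *
    ((4 * d) ^+ q / om 1 * om (2 ^- j) * w ^+ q)); last by rewrite exprS; ring.
rewrite (@le_trans _ _ (K * (d * w)))//; first by rewrite ler_wpM2l.
by rewrite ler_peMr// !mulr_ge0.
Qed.

End Moduli.

(** * From coefficients to exact moduli *)

Section ExactModulus.
Context {R : realType}.
Local Notation mu := (@lebesgue_measure R).
Variables (psi psit H : R -> R) (x : nat -> int -> R) (phi : nat -> R) (t : R).
Variables (a b C1 : R).
Hypotheses (hpsi : wavelet_pair psi psit).
Hypotheses (phi_slow : slow_growth phi) (a0 : 0 < a) (b1 : b < 1).
Hypotheses (Hab : forall x, a <= H x <= b) (Hlog : log_holder H).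
Hypotheses (C10 : 0 <= C1) (xC1 : coef_growth x phi t C1).

Let f := wavelet_series psi H x.
Local Notation term j s k := (coef H x j k * psi (2 ^+ j * s - k%:~R)).

Lemma linear_growth_shift (s : R) : 1 + `|s - t| <= (1 + `|t|) * (1 + `|s|).
Proof.
have := ler_normB s t; have := mulr_ge0 (normr_ge0 t) (normr_ge0 s); lra.
Qed.

Lemma pairing_level (j j' : nat) (k' : int) :
  pairing (dual psit j' k') (level psi H x j)
    (coef H x j k' * (2 ^- j' * (j == j')%:R)).
Proof.
have [psid _] := wavelet_decay hpsi.
have [E [E0 hE]] := level_summable phi_slow Hab C10 xC1 psid.
pose v k := coef H x j k * (2 ^- j' * ((j == j') && (k == k'))%:R).
pose C := E * (1 + `|t|) * ((2 + j%:R) ^+ 2 * (2 `^ (- a)) ^+ j).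
apply: (@pairing_limit _ _ (fun n s => sumZ_partial (fun k => term j s k) n) _
   (fun n => sumZ_partial v n) _ C).
- exact: measurable_dual hpsi _ _.
- exact: integrable_dual_linear hpsi _ _.
- move=> n s; have [_ _ /(_ n) h] := hE j s; rewrite (le_trans h)//.
  rewrite /C [leRHS]mulrAC ler_wpM2r//.
  by rewrite -mulrA ler_wpM2l ?(ltW E0)// linear_growth_shift.
- by move=> s; have [h _ _] := hE j s; exact: sumZ_partial_cvg.
- move=> n; apply: pairingD; apply: (pairing_sum (v := fun n => v _)) => i;
    by apply: pairingZ; exact: pairing_dilate.
- near=> n; rewrite (@sumZ_partial_single _ _ k').
  + by rewrite /v eqxx andbT.
  + by near: n; exact: nbhs_infty_gt.
  + by move=> k kk'; rewrite /v (negbTE kk') andbF !mulr0.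
Unshelve. all: by end_near. Qed.

(** The second of two limits, over [j] after the one over [k] within a level, in the order of
    summation of the series; both are dominated by a multiple of [1 + |s|]. *)
Lemma pairing_wavelet_series (j' : nat) (k' : int) :
  pairing (dual psit j' k') f (coef H x j' k' * 2 ^- j').
Proof.
have [psid _] := wavelet_decay hpsi.
have [E [E0 hE]] := wavelet_partial_sums_le phi_slow a0 Hab C10 xC1 psid.
pose v j := coef H x j k' * (2 ^- j' * (j == j')%:R).
apply: (@pairing_limit _ _ (fun n s => series (fun j => level psi H x j s) n) _
   (series v) _ (E * (1 + `|t|))).
- exact: measurable_dual hpsi _ _.
- exact: integrable_dual_linear hpsi _ _.
- move=> n s; have [_ /(_ n) h _] := hE s; rewrite (le_trans h)//.
  by rewrite -mulrA ler_wpM2l ?(ltW E0)// linear_growth_shift.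
- by move=> s; have [h _ _] := hE s.
- by move=> n; apply: pairing_sum => j; exact: pairing_level.
- near=> n; rewrite /series/= (@sum_single _ _ j').
  + by rewrite /v eqxx mulr1.
  + by near: n; exact: nbhs_infty_gt.
  + by move=> j jj'; rewrite /v (negbTE jj') !mulr0.
Unshelve. all: by end_near. Qed.

Lemma increment_growth : exists K : R, 0 <= K /\
  forall s, `|f s - f t| <= K * (1 + `|s - t|).
Proof.
have [psid _] := wavelet_decay hpsi.
have [E [E0 hE]] := wavelet_partial_sums_le phi_slow a0 Hab C10 xC1 psid.
exists (2 * E); split; first by rewrite mulr_ge0// ltW.
move=> s; have [_ _ h1] := hE s; have [_ _ h2] := hE t.
rewrite (le_trans (ler_normB _ _))//.
rewrite subrr normr0 addr0 in h2.
have : 0 <= E * `|s - t| by rewrite mulr_ge0// ltW.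
rewrite /f; lra.
Qed.

(** [log_holder_powR] with the roles of [t] and the dyadic point exchanged; they are at most one
    cell apart, so the squared weight is at most 4. *)
Lemma coef_lower_at : exists C : R, 0 < C /\ forall (j : nat) (k : int),
  `|2 ^+ j * t - k%:~R| <= 1 ->
  `|x j k| * 2 `^ (- (H t * j%:R)) <= C * `|coef H x j k|.
Proof.
have H1 z : a <= H z <= 1.
  by have /andP[-> /le_trans->//] := Hab z; exact: ltW.
have [C [C0 hC]] := log_holder_powR (ltW a0) H1 Hlog.
exists (4 * C); split; first exact: mulr_gt0.
move=> j k hk; have := hC j 0%N t (k%:~R * 2 ^- j); rewrite addn0 expr0 mulr1 => h.
rewrite /coef normrM (@ger0_norm _ (powR _ _)) ?powR_ge0// mulrCA ler_wpM2l//.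
rewrite (le_trans h)// -mulrA -mulrA mulrCA ler_wpM2l ?(ltW C0)// mulrC.
rewrite ler_wpM2r ?powR_ge0//.
have p2 : 0 < 2 ^+ j :> R by rewrite exprn_gt0.
have -> : t - k%:~R * 2 ^- j = (2 ^+ j * t - k%:~R) * 2 ^- j.
  by rewrite mulrBl mulrAC mulfV ?mul1r// gt_eqF.
rewrite normrM (@gtr0_norm _ (2 ^- j)) ?invr_gt0// mulrCA mulfV ?gt_eqF// mulr1.
rewrite (_ : 4 = 2 ^+ 2) ?lerXn2r ?nnegrE ?addr_ge0//; last by ring.
by rewrite -[2]/(1 + 1) lerD2l.
Qed.

(** The lower bound on [om] is asked on whole dyadic shells, for the finiteness of the upper limit;
    the upper bound only at [2 ^- n], where another modulus is compared with [om]. *)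
Definition gauge (om : R -> R) (h : R) := exists (C : R) (n0 : nat), 0 < C /\
  forall n, (n0 <= n)%N ->
    (forall d, 2 ^- n.+1 < d -> d <= 2 ^- n ->
      phi n * 2 `^ (- (h * n%:R)) <= C * om d) /\
    om (2 ^- n) <= C * (phi n * 2 `^ (- (h * n%:R))).

(** A finite upper limit for [om'] would bound the coefficients at [t] by a multiple of
    [om' (2 ^- j)], too small at a large coefficient of high level. *)
Lemma exact_modulus_of_coef (om : R -> R) : gauge om (H t) ->
  (exists c : R, 0 < c /\ forall J : nat, exists (j : nat) (k : int),
    [/\ (J <= j)%N, `|2 ^+ j * t - k%:~R| <= 1 & c * phi j <= `|x j k|]) ->
  exact_modulus_at f om t.
Proof.
move=> [C [n0 [C0 hC]]] [c [c0 hx]].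
have [phi0 _ _] := phi_slow.
have [psid dpsid] := wavelet_decay hpsi.
have [_ _ _ [dpsi _] _] := hpsi.
have P0 n : 0 < phi n * 2 `^ (- (H t * n%:R)) by rewrite mulr_gt0 ?powR_gt0.
split.
  have [D [D0 hD]] :=
    wavelet_increment_le phi_slow a0 b1 Hab Hlog C10 xC1 psid dpsid dpsi.
  apply: (@limsup_increment_lty _ _ _ _ (D * C) (2 ^- n0.+1)).
    by rewrite invr_gt0 exprn_gt0.
  move=> s st sn; set d := `|s - t| in sn *.
  have d0 : 0 < d by rewrite normr_gt0 subr_eq0.
  have [n /andP[h1 h2]] : exists n, 2 ^+ n <= d^-1 < 2 ^+ n.+1.
    apply: dyadic_bracket; rewrite invf_ge1// (le_trans (ltW sn))//.
    by rewrite invf_le1 ?exprn_gt0// exprn_ege1// ler1n.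
  have nn0 : (n0 <= n)%N.
    have : 2 ^+ n0.+1 < 2 ^+ n.+1 :> R.
      by apply: lt_trans h2; rewrite -[ltLHS]invrK ltf_pV2 ?posrE ?invr_gt0.
    by rewrite ltr_eXn2l ?ltr1n// ltnS => /ltnW.
  have dn : d <= 2 ^- n by rewrite -[d]invrK lef_pV2 ?posrE ?invr_gt0 ?exprn_gt0.
  have dn1 : 2 ^- n.+1 < d by rewrite -[d]invrK ltf_pV2 ?posrE ?invr_gt0 ?exprn_gt0.
  have [/(_ d dn1 dn) hd _] := hC n nn0.
  split; last by rewrite -(pmulr_rgt0 _ C0) (lt_le_trans (P0 n)).
  rewrite (le_trans (hD n s dn))// -!mulrA ler_wpM2l// ltW//.
move=> om' hom' negl; apply/eqP/negPn/negP => fin.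
have om'0 := modulus_gt0 hom'.
have [om'00 _ _ _] := hom'.
have om'0ge : 0 <= om' 0 by rewrite om'00.
have [M [delta [M0 delta0 hM]]] := limsup_increment_bound om'0 om'0ge fin.
have [K [K0 hK]] := increment_growth.
have [M' [q [M'0 hM']]] := modulus_global_bound hom' K0 hK M0 delta0 hM.
have [m [m0 hm]] := dual_coefficient_le hpsi q.
have [B [B0 hB]] := coef_lower_at.
pose A := B * (M' * m) + 1.
have A0 : 0 < A by rewrite ltr_wpDl// mulr_ge0 ?(ltW B0)// mulr_ge0// ltW.
have key (j : nat) (k : int) : `|2 ^+ j * t - k%:~R| <= 1 ->
    `|x j k| * 2 `^ (- (H t * j%:R)) <= A * om' (2 ^- j).
  move=> hk; have p2 : 0 < 2 ^+ j :> R by rewrite exprn_gt0.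
  have oj : 0 < om' (2 ^- j) by rewrite om'0// invr_gt0.
  rewrite (le_trans (hB j k hk))// /A mulrDl mul1r -[leLHS]addr0.
  rewrite lerD ?(ltW oj)// -mulrA ler_wpM2l ?(ltW B0)//.
  have := hm f j k t _ (M' * om' (2 ^- j)) hk _ (hM' j) (pairing_wavelet_series j k).
  rewrite normrM (@gtr0_norm _ (2 ^- j)) ?invr_gt0// ler_pM2r ?invr_gt0//.
  by rewrite mulrAC; apply; rewrite mulr_ge0// ltW.
(* Chosen so that [A * eps * C] is half of [c]: the bound on a large coefficient falls to half of
   its known size. *)
pose eps := c / (C * A) / 2.
have eps0 : 0 < eps by rewrite !divr_gt0// mulr_gt0.
have /cvgrPdist_lt/(_ _ eps0) := negl.
case=> r /= r0 hr.
have [J hJ] : exists J : nat, 2 ^- J < r.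
  have [n /andP[_ h]] : exists n, 2 ^+ n <= 1 + r^-1 < 2 ^+ n.+1.
    by apply: dyadic_bracket; rewrite lerDl invr_ge0 ltW.
  exists n.+1; rewrite -[r]invrK ltf_pV2 ?posrE ?exprn_gt0 ?invr_gt0//.
  by apply: lt_trans h; rewrite ltrDr.
have [j [k [Jj hk cj]]] := hx (maxn J n0).
have p2 : 0 < 2 ^- j :> R by rewrite invr_gt0 exprn_gt0.
have Jj' : 2 ^- j <= 2 ^- J :> R.
  rewrite lef_pV2 ?posrE ?exprn_gt0// ler_eXn2l ?ltr1n//.
  by rewrite (leq_trans _ Jj)// leq_maxl.
have [hC1 hC2] := hC j (leq_trans (leq_maxr _ _) Jj).
have omj : 0 < om (2 ^- j).
  rewrite -(pmulr_rgt0 _ C0) (lt_le_trans (P0 j))// hC1//.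
  by rewrite ltf_pV2 ?posrE ?exprn_gt0// ltr_eXn2l ?ltr1n.
have dj : `|0 - 2 ^- j| < r by rewrite sub0r normrN gtr0_norm// (le_lt_trans Jj').
have := hr (2 ^- j) dj p2; rewrite /= sub0r normrN normrM normfV.
rewrite (gtr0_norm omj) gtr0_norm ?om'0//.
rewrite ltr_pdivrMr// => hlt.
have h1 := key j k hk.
have h2 : c * (phi j * 2 `^ (- (H t * j%:R))) <= A * om' (2 ^- j).
  by apply: le_trans h1; rewrite mulrA ler_wpM2r ?powR_ge0.
have h3 : c * (phi j * 2 `^ (- (H t * j%:R))) < A * (eps * om (2 ^- j)).
  by rewrite (le_lt_trans h2)// ltr_pM2l.
have h4 : A * (eps * om (2 ^- j)) <= c * (phi j * 2 `^ (- (H t * j%:R))) / 2.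
  rewrite (@le_trans _ _ (A * (eps * (C * (phi j * 2 `^ (- (H t * j%:R)))))))//.
    by rewrite ler_wpM2l ?(ltW A0)// ler_wpM2l// ltW.
  rewrite le_eqVlt; apply/orP; left; apply/eqP; rewrite /eps.
  by field; rewrite !gt_eqF.
have := mulr_gt0 c0 (P0 j); lra.
Qed.

End ExactModulus.

(** * The slow, rapid and ordinary gauges *)

Section Gauges.
Context {R : realType}.
Implicit Types (h d : R).

Lemma ln2_ge_half : 2^-1 <= ln 2 :> R.
Proof.
have h : -1 < - 2^-1 :> R by lra.
have := le_ln1Dx h; rewrite (_ : 1 + - 2^-1 = 2^-1 :> R); last by field.
by rewrite lnV ?posrE//; lra.
Qed.

Lemma mulr2_sqrt (x : R) : 2 * Num.sqrt x = Num.sqrt (4 * x).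
Proof.
rewrite sqrtrM// (_ : 4 = 2 ^+ 2) ?sqrtr_sqr ?ger0_norm//; ring.
Qed.

Lemma powR_dyadic h d (n : nat) : 0 <= h -> h <= 1 -> 2 ^- n.+1 < d ->
  2 `^ (- (h * n%:R)) <= 2 * d `^ h.
Proof.
move=> h0 h1 dn; have d0 : 0 < d by apply: lt_trans dn; rewrite invr_gt0 exprn_gt0.
apply: (@le_trans _ _ (2 * (2 ^- n.+1) `^ h)).
  have -> : 2 * (2 ^- n.+1) `^ h = 2 `^ (1 + - n.+1%:R * h).
    by rewrite powRD ?pnatr_eq0 ?implybT// powRr1// -powR_invn// -powRrM.
  rewrite ler_powR ?ler1n// -[n.+1%:R]natr1; have := ler0n R n; nra.
rewrite ler_wpM2l// ge0_ler_powR ?nnegrE ?(ltW d0) ?(ltW dn)//.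
Qed.

Lemma powR_dyadicE h (n : nat) : (2 ^- n) `^ h = 2 `^ (- (h * n%:R)).
Proof. by rewrite -powR_invn// -powRrM mulNr mulrC. Qed.

Lemma ln_dyadic_ge d (n : nat) : 0 < d -> d <= 2 ^- n -> n%:R * ln 2 <= ln d^-1.
Proof.
move=> d0 dn; rewrite mulr_natl -lnXn// ler_ln ?posrE ?invr_gt0 ?exprn_gt0//.
by rewrite -[leLHS]invrK lef_pV2 ?posrE ?invr_gt0 ?exprn_gt0.
Qed.

Definition slow_gauge (n : nat) : R := 1.
(** The shift, like the one by two under the logarithm of [ordinary_gauge], keeps the gauge positive
    at level 0. *)
Definition rapid_gauge (n : nat) : R := Num.sqrt n.+1%:R.
Definition ordinary_gauge (n : nat) : R := Num.sqrt (ln n.+2%:R).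

Lemma slow_gauge_growth : slow_growth slow_gauge.
Proof. by split => // n i; rewrite /slow_gauge mul1r lerDl. Qed.

Lemma rapid_gauge_growth : slow_growth rapid_gauge.
Proof.
split => [n|m n mn|n i]; rewrite /rapid_gauge ?sqrtr_gt0//.
  by rewrite ler_wsqrtr// ler_nat.
rewrite -[X in _ <= _ * X]ger0_norm ?addr_ge0// -sqrtr_sqr -sqrtrM//.
rewrite ler_wsqrtr// -addn1 natrD -[n.+1%:R]natr1 natrD.
have := ler0n R n; have := ler0n R i; nra.
Qed.

Lemma ordinary_gauge_growth : slow_growth ordinary_gauge.
Proof.
split => [n|m n mn|n i]; rewrite /ordinary_gauge.
- by rewrite sqrtr_gt0 ln_gt0// ltr1n.
- by rewrite ler_wsqrtr// ler_ln ?posrE// ler_nat.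
have l2 : 2^-1 <= ln n.+2%:R :> R.
  by rewrite (le_trans ln2_ge_half)// ler_ln ?posrE// ler_nat.
rewrite -[X in _ <= _ * X]ger0_norm ?addr_ge0// -sqrtr_sqr -sqrtrM//; last first.
  by rewrite (le_trans _ l2).
rewrite ler_wsqrtr//.
have i0 := ler0n R i; have n0 := ler0n R n.
have p1 : 0 < 1 + i%:R :> R by rewrite ltr_pwDl.
have e : ln (n + i).+2%:R <= ln n.+2%:R + i%:R :> R.
  apply: (@le_trans _ _ (ln (n.+2%:R * (1 + i%:R)))).
    rewrite ler_ln ?posrE ?mulr_gt0//.
    by rewrite -addn2 -[n.+2]addn2 !natrD; nra.
  by rewrite lnM ?posrE// lerD2l le_ln1Dx// (lt_le_trans _ i0)// ltrN10.
by rewrite (le_trans e)//; nra.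
Qed.

Lemma slow_gauge_compat h : 0 < h -> h < 1 -> gauge slow_gauge (omega_s h) h.
Proof.
move=> h0 h1; exists 2, 0%N; split => // n _; rewrite /slow_gauge /omega_s; split.
  move=> d dn dn'; have d0 : 0 < d by apply: lt_trans dn; rewrite invr_gt0 exprn_gt0.
  by rewrite mul1r gtr0_norm// powR_dyadic// ltW.
rewrite ger0_norm ?invr_ge0 ?exprn_ge0// powR_dyadicE mul1r.
by rewrite ler_peMl ?powR_ge0// ler1n.
Qed.

Lemma rapid_gauge_compat h : 0 < h -> h < 1 -> gauge rapid_gauge (omega_r h) h.
Proof.
(* As [ln d^-1] is at least [n / 2] on the shell, [n + 1 <= 4 * ln d^-1] as soon as [1 <= n]. The 4
   is a factor 2 from the power times a factor 2 from the root. *)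
move=> h0 h1; exists 4, 1%N; split => // n n1; rewrite /rapid_gauge /omega_r.
have n1' : 1 <= n%:R :> R by rewrite ler1n.
have l2 := ln2_ge_half.
have p0 : 0 < 2 ^- n :> R by rewrite invr_gt0 exprn_gt0.
split.
  move=> d dn dn'; have d0 : 0 < d by apply: lt_trans dn; rewrite invr_gt0 exprn_gt0.
  rewrite gtr0_norm// mulrC [leRHS](_ : _ =
    (2 * d `^ h) * (2 * Num.sqrt (ln d^-1))); last by ring.
  rewrite ler_pM ?powR_ge0// ?powR_dyadic ?(ltW h0) ?(ltW h1)//.
  rewrite mulr2_sqrt ler_wsqrtr//.
  by have := ln_dyadic_ge d0 dn'; rewrite -natr1; nra.
rewrite gtr0_norm// powR_dyadicE invrK lnXn// mulrCA mulrC.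
have P0 := powR_ge0 2 (- (h * n%:R)).
rewrite (@le_trans _ _ (Num.sqrt n.+1%:R * 2 `^ (- (h * n%:R))))//.
  rewrite ler_wpM2r// ler_wsqrtr// -[leLHS]mulr_natl -natr1.
  by have := @ln2_le1 R; nra.
have : 0 <= Num.sqrt n.+1%:R * 2 `^ (- (h * n%:R)) by rewrite mulr_ge0.
lra.
Qed.

Lemma ordinary_gauge_compat h : 0 < h -> h < 1 ->
  gauge ordinary_gauge (omega_o h) h.
Proof.
(* 6 is the least [n] with [n + 2 <= (n / 2) ^+ 2], which bounds [ln n.+2%:R] by twice the iterated
   logarithm of [d^-1]. *)
move=> h0 h1; exists 4, 6%N; split => // n n6; rewrite /ordinary_gauge /omega_o.
have n6' : 6 <= n%:R :> R by rewrite ler_nat.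
have l2 := ln2_ge_half.
have p0 : 0 < 2 ^- n :> R by rewrite invr_gt0 exprn_gt0.
split.
  move=> d dn dn'; have d0 : 0 < d by apply: lt_trans dn; rewrite invr_gt0 exprn_gt0.
  rewrite gtr0_norm// mulrC [leRHS](_ : _ =
    (2 * d `^ h) * (2 * Num.sqrt (ln (ln d^-1)))); last by ring.
  rewrite ler_pM ?powR_ge0// ?powR_dyadic ?(ltW h0) ?(ltW h1)//.
  rewrite mulr2_sqrt ler_wsqrtr//.
  have e1 : n%:R / 2 <= ln d^-1 by have := ln_dyadic_ge d0 dn'; nra.
  have l0 : 0 < ln d^-1 by lra.
  have e2 : ln n.+2%:R <= ln ((ln d^-1) ^+ 2).
    rewrite ler_ln ?posrE ?exprn_gt0// -addn2 natrD.
    by rewrite (@le_trans _ _ ((n%:R / 2) ^+ 2))//; nra.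
  rewrite (le_trans e2)// lnXn// mulr2n.
  have : 0 <= ln (ln d^-1) by rewrite ln_ge0//; lra.
  lra.
rewrite gtr0_norm// powR_dyadicE invrK lnXn// mulrCA mulrC.
have P0 := powR_ge0 2 (- (h * n%:R)).
have nl : n%:R * ln 2 <= n.+2%:R :> R.
  by rewrite (@le_trans _ _ n%:R) ?ler_piMr ?ln2_le1// ler_nat ltnW.
rewrite (@le_trans _ _ (Num.sqrt (ln n.+2%:R) * 2 `^ (- (h * n%:R))))//.
  rewrite ler_wpM2r// ler_wsqrtr// -[ln 2 *+ n]mulr_natl ler_ln ?posrE//.
  by rewrite mulr_gt0//; lra.
have : 0 <= Num.sqrt (ln n.+2%:R) * 2 `^ (- (h * n%:R)) by rewrite mulr_ge0.
lra.
Qed.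

End Gauges.

(** * Gaussian tails and union bounds *)

Section GaussianTails.
Context {R : realType}.
Local Notation mu := (@lebesgue_measure R).
Implicit Types r : R.

Lemma normal_pdf1E (y : R) :
  normal_pdf 0 1 y = normal_peak 1 * expR (- (y ^+ 2 / 2)).
Proof.
rewrite normal_pdfE ?oner_neq0// /normal_fun; congr (_ * expR _).
by rewrite subr0 expr1n mulNr.
Qed.

Let sqrt2 : R := Num.sqrt 2.

Let sqrt2_neq0 : sqrt2 != 0. Proof. by rewrite gt_eqF// sqrtr_gt0. Qed.

Let normal_pdf2E (y : R) :
  normal_pdf 0 sqrt2 y = normal_peak sqrt2 * expR (- (y ^+ 2 / 4)).
Proof.
rewrite normal_pdfE// /normal_fun; congr (_ * expR _).
by rewrite subr0 sqr_sqrtr// mulNr -mulr_natr -natrM.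
Qed.

Let normal_peak_le : normal_peak 1 <= 2 * normal_peak sqrt2.
Proof.
rewrite /normal_peak expr1n sqr_sqrtr// mul1r.
have p0 : 0 < pi :> R by exact: pi_gt0.
have s0 : 0 < Num.sqrt (pi *+ 2) :> R by rewrite sqrtr_gt0 mulrn_wgt0.
have s2 : 0 < Num.sqrt (2 * pi *+ 2) :> R.
  by rewrite sqrtr_gt0 mulrn_wgt0// mulr_gt0.
rewrite -[leLHS]mul1r ler_pdivrMr// mulrAC ler_pdivlMr// mul1r.
by rewrite mulr2_sqrt ler_wsqrtr// !mulr2n; lra.
Qed.

(** Half of the Gaussian exponent gives the decay in [r]; the other half is a density of variance 2,
    with mass 1, up to the ratio of the peaks. *)
Lemma normal_tail_le r : 0 <= r ->
  (normal_prob 0 1 [set y : R | (r < `|y|)%R] <= (2 * expR (- (r ^+ 2 / 4)))%:E)%E.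
Proof.
move=> r0; have mA : measurable [set y : R | r < `|y|].
  apply: open_measurable.
  exact: (open_comp (fun x _ => @norm_continuous _ _ x) (@open_gt _ r)).
have mp s : measurable_fun setT (fun y : R => (normal_pdf 0 s y)%:E).
  by apply/measurable_EFinP; exact: measurable_normal_pdf.
have p0 s y : (0 <= (normal_pdf 0 s y)%:E)%E by rewrite lee_fin normal_pdf_ge0.
set c := 2 * expR _; have c0 : 0 <= c by rewrite mulr_ge0// expR_ge0.
apply: (@le_trans _ _
    (\int[mu]_(y in [set y | (r < `|y|)%R]) (c%:E * (normal_pdf 0 sqrt2 y)%:E))%E).
  apply: ge0_le_integral => //.
  - exact: measurable_funS (mp 1).
  - by apply: measurable_funeM; exact: measurable_funS (mp sqrt2).
  move=> y /= ry; rewrite -EFinM lee_fin normal_pdf1E normal_pdf2E.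
  rewrite [leRHS](_ : _ = (2 * normal_peak sqrt2) *
    (expR (- (r ^+ 2 / 4)) * expR (- (y ^+ 2 / 4)))); last by rewrite /c; ring.
  apply: ler_pM => //; rewrite ?normal_peak_ge0 ?expR_ge0//.
  rewrite -expRD ler_expR; have : r ^+ 2 <= y ^+ 2; last lra.
  by rewrite -[leRHS]real_normK ?num_real// lerXn2r ?nnegrE// ltW.
rewrite ge0_integralZl//; last exact: measurable_funS (mp sqrt2).
rewrite -[leRHS]mule1 lee_pmul2l//; last by rewrite lte_fin mulr_gt0// expR_gt0.
rewrite -(@integral_normal_pdf R 0 sqrt2).
by apply: ge0_subset_integral => //; exact: (mp sqrt2).
Qed.

(** The density is integrated over []r, r + 1]] only, where [y ^+ 2 / 2 <= r ^+ 2 + 1]. *)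
Lemma normal_tail_ge : exists c : R, 0 < c /\ forall r, 0 <= r ->
  ((c * expR (- r ^+ 2))%:E <= normal_prob 0 1 [set y : R | (r < `|y|)%R])%E.
Proof.
have k0 : 0 < normal_peak 1 :> R by exact: normal_peak_gt0 (oner_neq0 _).
exists (normal_peak 1 * expR (- 1)); split; first by rewrite mulr_gt0// expR_gt0.
move=> r r0; have mA : measurable [set y : R | r < `|y|].
  apply: open_measurable.
  exact: (open_comp (fun x _ => @norm_continuous _ _ x) (@open_gt _ r)).
have mp : measurable_fun setT (fun y : R => (normal_pdf 0 1 y)%:E).
  by apply/measurable_EFinP; exact: measurable_normal_pdf.
have p0 y : (0 <= (normal_pdf 0 1 y : R)%:E)%E by rewrite lee_fin normal_pdf_ge0.
set c := _ * expR (- r ^+ 2).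
apply: (@le_trans _ _ (\int[mu]_(y in `]r, (r + 1)%R]) (normal_pdf 0 1 y)%:E)%E).
  have -> : c%:E = (\int[mu]_(y in `]r, (r + 1)%R]) (cst c%:E y))%E.
    rewrite integral_cst//= lebesgue_measure_itv/= lte_fin ltrDl ltr01.
    by rewrite -EFinD [r + 1]addrC addrK mule1.
  have c0 : 0 <= c by rewrite !mulr_ge0 ?expR_ge0 ?(ltW k0).
  apply: ge0_le_integral => //.
  - exact: measurable_funS mp.
  move=> y; rewrite /= in_itv/= => /andP[ry yr].
  rewrite lee_fin normal_pdf1E /c -mulrA ler_wpM2l ?(ltW k0)//.
  rewrite -expRD ler_expR.
  have : 0 <= (r + 1 - y) * (r + 1 + y) by rewrite mulr_ge0//; lra.
  have := sqr_ge0 (r - 1); rewrite !expr2; lra.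
apply: ge0_subset_integral => //; first exact: measurable_funS mp.
move=> y; rewrite /= in_itv/= => /andP[ry _].
by rewrite (lt_le_trans ry)// ler_norm.
Qed.

(** A density of at most 1/2 on an interval of length 1/2. A value below 1/2 is what beats the
    doubling of the number of intervals in [slow_lower]. *)
Lemma normal_small_ball :
  (normal_prob 0 1 [set y : R | (`|y| < 4^-1)%R] <= (4^-1)%:E)%E.
Proof.
have -> : [set y : R | `|y| < 4^-1] = `]- 4^-1, 4^-1[%classic.
  by apply/seteqP; split => y /=; rewrite in_itv/= ltr_norml.
have mp : measurable_fun setT (fun y : R => (normal_pdf 0 1 y)%:E).
  by apply/measurable_EFinP; exact: measurable_normal_pdf.
have p0 y : (0 <= (normal_pdf 0 1 y : R)%:E)%E by rewrite lee_fin normal_pdf_ge0.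
apply: (@le_trans _ _ (\int[mu]_(y in `](- 4^-1)%R, (4^-1)%R[) (cst (2^-1)%:E y))%E).
  apply: ge0_le_integral => //.
  - exact: measurable_funS mp.
  move=> y _; rewrite lee_fin (le_trans (normal_pdf_ub _ _ (oner_neq0 _)))//.
  rewrite /normal_peak expr1n mul1r lef_pV2 ?posrE//.
    rewrite -[leLHS]mulr1 -[X in _ * X]sqrtr1 mulr2_sqrt ler_wsqrtr//.
    by rewrite mulr2n; have := @pi_ge2 R; lra.
  by rewrite sqrtr_gt0 mulrn_wgt0// pi_gt0.
rewrite integral_cst//= lebesgue_measure_itv/= lte_fin.
rewrite ifT; last by lra.
by rewrite -EFinD -EFinM lee_fin; lra.
Qed.

End GaussianTails.

Section UnionBounds.
Context d (T : measurableType d) (R : realType) (P : probability T R).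
Local Open Scope ereal_scope.

Lemma probability_bigcup_le (F : (set T)^nat) (u : R^nat) (B : R) :
  (forall n, measurable (F n)) -> (forall n, P (F n) <= (u n)%:E) ->
  (forall n, (\sum_(0 <= i < n) u i <= B)%R) -> P (\bigcup_n F n) <= B%:E.
Proof.
move=> mF Fu uB.
apply: (@le_trans _ _ (\sum_(0 <= i <oo) P (F i))).
  by apply: measure_sigma_subadditive => //; exact: bigcupT_measurable.
apply: lime_le; first exact: is_cvg_nneseries.
apply: nearW => n; apply: (@le_trans _ _ (\sum_(0 <= i < n) (u i)%:E)).
  by apply: lee_sum => i _; exact: Fu.
by rewrite sumEFin lee_fin.
Qed.

Definition exists_index (E : nat -> int -> set T) : set T :=
  [set w | exists j k, E j k w].

Lemma exists_indexE (E : nat -> int -> set T) : exists_index E =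
  \bigcup_j ((\bigcup_n E j n%:Z) `|` (\bigcup_n E j (- n.+1%:Z)%R)).
Proof.
apply/seteqP; split => [w [j [k Ew]]|w [j _ [[n _ Ew]|[n _ Ew]]]].
- exists j => //; case: k Ew => n Ew; first by left; exists n.
  by right; exists n => //; rewrite -NegzE.
- by exists j, n%:Z.
- by exists j, (- n.+1%:Z)%R.
Qed.

Lemma measurable_exists_index (E : nat -> int -> set T) :
  (forall j k, measurable (E j k)) -> measurable (exists_index E).
Proof.
move=> mE; rewrite exists_indexE; apply: bigcupT_measurable => j.
by apply: measurableU; exact: bigcupT_measurable.
Qed.

(** 32 is [(4 + 4) * 4]: the two halves of the integers for [k], then the sum over [j]. *)
Lemma probability_exists_index_le (E : nat -> int -> set T) (y : nat -> R) (alpha : R) :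
  (0 <= alpha)%R -> (forall j k, measurable (E j k)) ->
  (forall j k, P (E j k) <=
    (alpha * ((1 + j%:R) ^+ 2)^-1 * ((1 + `|y j - k%:~R|) ^+ 2)^-1)%:E) ->
  P (exists_index E) <= (32 * alpha)%:E.
Proof.
move=> a0 mE hE; rewrite exists_indexE.
pose c j : R := (alpha * ((1 + j%:R) ^+ 2)^-1)%R.
have c0 j : (0 <= c j)%R by rewrite mulr_ge0// invr_ge0 exprn_ge0// addr_ge0.
apply: (@probability_bigcup_le _ (fun j => 8 * c j)%R).
- by move=> j; apply: measurableU; exact: bigcupT_measurable.
- move=> j; apply: (le_trans (measureU2 _ _ _)) => //; try exact: bigcupT_measurable.
  rewrite (_ : (8 * c j)%:E = (4 * c j)%:E + (4 * c j)%:E); last first.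
    by rewrite -EFinD; congr EFin; ring.
  apply: leeD.
    apply: probability_bigcup_le (fun n => hE j n%:Z) _ => // n.
    rewrite -mulr_sumr [leLHS]mulrC ler_wpM2r//; first exact: c0.
    exact: (sum_inv_sqr_le (y j) n).
  apply: probability_bigcup_le (fun n => hE j (- n.+1%:Z)%R) _ => // n.
  rewrite -mulr_sumr [leLHS]mulrC ler_wpM2r//; first exact: c0.
  exact: (sum_inv_sqrN_le (y j) n).
move=> n; rewrite -mulr_sumr /c -mulr_sumr.
have h : (\sum_(0 <= i < n) ((1 + i%:R : R) ^+ 2)^-1 <= 4)%R.
  apply: le_trans (sum_inv_sqr_le 0 n); apply: ler_sum => i _.
  by rewrite sub0r normrN normr_nat.
rewrite (_ : 32 * alpha = 8 * (alpha * 4))%R; last by ring.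
by rewrite ler_wpM2l// ler_wpM2l.
Qed.

(* [negligible] events need not be measurable, which avoids measurability
   proofs for quantifications over points of the line. *)
Lemma negligible_bigcap_le (F : (set T)^nat) (u : R^nat) :
  (forall n, measurable (F n)) -> (forall n, P (F n) <= (u n)%:E) ->
  (forall eps : R, (0 < eps)%R -> exists n, (u n <= eps)%R) ->
  P.-negligible (\bigcap_n F n).
Proof.
move=> mF Fu u0; have mI : measurable (\bigcap_n F n) by exact: bigcapT_measurable.
apply/negligibleP => //; apply/eqP; rewrite eq_le measure_ge0 andbT.
apply/lee_addgt0Pr => eps eps0; rewrite add0e.
have [n un] := u0 eps eps0.
apply: (@le_trans _ _ (P (F n))); first by rewrite le_measure ?inE// => w; exact.
by rewrite (le_trans (Fu n))// lee_fin.
Qed.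

Lemma negligible_ae (A : set T) (Q : T -> Prop) : P.-negligible A ->
  (forall w, ~ A w -> Q w) -> {ae P, forall w, Q w}.
Proof. by move=> A0 h; apply: negligibleS A0 => w /= nQ; apply: contrapT => /h. Qed.

End UnionBounds.

Section GaussianFamily.
Context d (T : measurableType d) (R : realType) (P : probability T R).
Variable xi : nat -> int -> {RV P >-> R}.
Hypothesis xi_normal : forall (j : nat) (k : int) (A : set R), measurable A ->
  distribution P (xi j k) A = normal_prob 0 1 A.
Local Open Scope ereal_scope.

Lemma measurable_norm_gt (r : R) : measurable [set y : R | (r < `|y|)%R].
Proof.
apply: open_measurable.
exact: (open_comp (fun x _ => @norm_continuous _ _ x) (@open_gt _ r)).
Qed.

Lemma measurable_xi_preimage j k (A : set R) : measurable A ->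
  measurable (xi j k @^-1` A).
Proof. by move=> mA; rewrite -[_ @^-1` _]setTI; exact: measurable_funP. Qed.

Lemma prob_xi j k (A : set R) : measurable A ->
  P (xi j k @^-1` A) = normal_prob 0 1 A.
Proof. by move=> mA; rewrite -(xi_normal j k mA). Qed.

Definition excess (r : nat -> int -> R) (U : nat -> int -> Prop) : set T :=
  [set w | exists j k, U j k /\ (r j k < `|xi j k w|)%R].

Let E (r : nat -> int -> R) (U : nat -> int -> Prop) j k : set T :=
  [set w | U j k /\ (r j k < `|xi j k w|)%R].

Let mE r U j k : measurable (E r U j k).
Proof.
have [Ujk|nU] := pselect (U j k); last first.
  by rewrite (_ : E r U j k = set0)//; apply/seteqP; split => w // -[].
rewrite (_ : E r U j k = xi j k @^-1` [set y : R | (r j k < `|y|)%R]).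
  by apply: measurable_xi_preimage; exact: measurable_norm_gt.
by apply/seteqP; split => w //= -[].
Qed.

Lemma measurable_excess r U : measurable (excess r U).
Proof. exact: (measurable_exists_index (mE r U)). Qed.

(** Since [2 <= A] and [1 <= beta], one has [A ^+ 2 * beta ^+ 2 / 4 >= beta ^+ 2 + (A ^+ 2 / 4 -
    1)]: the first term makes the tails summable over all indices, the second makes the sum
    small. *)
Lemma probability_excess_le (beta : nat -> int -> R) (U : nat -> int -> Prop)
    (y : nat -> R) (i : nat) (A : R) :
  (2 <= A)%R -> (forall j k, U j k -> [/\ (i <= j)%N, (1 <= beta j k)%R &
    (2 * ln (1 + (j - i)%:R) + 2 * ln (1 + `|y j - k%:~R|)
         <= beta j k ^+ 2)%R]) ->
  P (excess (fun j k => A * beta j k)%R U) <= (64 * expR (1 - A ^+ 2 / 4))%:E.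
Proof.
move=> A2 hU; have A0 : (0 <= A)%R by lra.
rewrite (_ : 64 * _ = 32 * (2 * expR (1 - A ^+ 2 / 4)))%R; last by ring.
have -> : excess (fun j k => A * beta j k)%R U =
    exists_index (fun l k => E (fun j k => A * beta j k)%R U (i + l) k).
  apply/seteqP; split => w [j [k]]; last by exists (i + j)%N, k.
  move=> [Ujk h]; have [ij _ _] := hU j k Ujk.
  by exists (j - i)%N, k; rewrite /E/= subnKC.
apply: (@probability_exists_index_le _ _ _ _ _ (fun l => y (i + l)%N)).
- by rewrite mulr_ge0// expR_ge0.
- by move=> l k; exact: mE.
move=> l k; set j := (i + l)%N; have [Ujk|nU] := pselect (U j k); last first.
  rewrite (_ : E _ _ _ _ = set0); last by apply/seteqP; split => w // -[].
  by rewrite measure0 lee_fin !mulr_ge0 ?expR_ge0// invr_ge0 exprn_ge0// addr_ge0.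
have [ij b1] := hU j k Ujk; rewrite {1}/j addKn => b2.
rewrite (_ : E _ U j k = xi j k @^-1` [set z : R | (A * beta j k < `|z|)%R]); last first.
  by apply/seteqP; split => w //= -[].
rewrite prob_xi; last exact: measurable_norm_gt.
apply: (le_trans (normal_tail_le _)); first by rewrite mulr_ge0//; lra.
rewrite lee_fin -!mulrA ler_wpM2l//.
have j0 : (0 < 1 + l%:R :> R)%R by rewrite ltr_pwDl.
have k0 : (0 < 1 + `|y j - k%:~R|)%R by rewrite ltr_pwDl.
have X z : (0 < z)%R -> ((z ^+ 2)^-1 = expR (- (2 * ln z)))%R.
  move=> z0; rewrite expRN; congr (_^-1)%R.
  by rewrite [in RHS]mulrC expRM_natr lnK ?posrE.
rewrite !X// -!expRD ler_expR.
have : (0 <= (A ^+ 2 / 4 - 1) * (beta j k ^+ 2 - 1))%R.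
  by rewrite mulr_ge0//; nra.
nra.
Qed.

Lemma expR_sqr_small (C eps : R) : (0 < C)%R -> (0 < eps)%R ->
  exists n : nat, (C * expR (1 - (n.+2%:R) ^+ 2 / 4) <= eps)%R.
Proof.
move=> C0 e0; exists (Num.truncn (4 * (C / eps))).
set m := Num.truncn _.
have z0 : (0 <= 4 * (C / eps))%R by rewrite mulr_ge0// divr_ge0 ?ltW.
have /andP[_ hm] := truncn_itv z0; rewrite -/m in hm.
rewrite (_ : 1 - _ = - (m.+2%:R ^+ 2 / 4 - 1))%R; last by ring.
rewrite expRN ler_pdivrMr ?expR_gt0// mulrC -ler_pdivrMr//.
apply: le_trans (expR_ge1Dx _).
have : (m.+2%:R = m.+1%:R + 1 :> R)%R by rewrite -[m.+2%:R]natr1.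
move=> ->; set p := m.+1%:R in hm *.
have p1 : (1 <= p)%R by rewrite ler1n.
nra.
Qed.

Lemma ae_bounded_by (beta : nat -> int -> R) (y : nat -> R) :
  (forall j k, [/\ (1 <= beta j k)%R &
    (2 * ln (1 + j%:R) + 2 * ln (1 + `|y j - k%:~R|) <= beta j k ^+ 2)%R]) ->
  P.-negligible [set w | ~ exists A : R, (0 <= A)%R /\
    forall j k, (`|xi j k w| <= A * beta j k)%R].
Proof.
move=> hb.
have := @negligible_bigcap_le _ _ _ P
  (fun n => excess (fun j k => n.+2%:R * beta j k)%R (fun _ _ => True))
  (fun n => 64 * expR (1 - (n.+2%:R) ^+ 2 / 4))%R.
move=> /(_ (fun n => measurable_excess _ _)) h.
apply: negligibleS (h _ _).
- move=> w /= nA n _; apply: contrapT => nE; apply: nA.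
  exists n.+2%:R; split => // j k; rewrite leNgt; apply/negP => lt.
  by apply: nE; exists j, k.
- move=> n; apply: (@probability_excess_le _ _ y 0%N) => [|j k _].
    by rewrite ler_nat.
  by rewrite subn0; have [] := hb j k.
- by move=> eps eps0; exact: expR_sqr_small.
Qed.

End GaussianFamily.

(** * Independence and simultaneous small values *)

Section Independence.
Context d (T : measurableType d) (R : realType) (P : probability T R).
Variable xi : nat -> int -> {RV P >-> R}.
Hypothesis xi_indep : independent_family (fun p : nat * int => xi p.1 p.2).
Hypothesis xi_normal : forall (j : nat) (k : int) (A : set R), measurable A ->
  distribution P (xi j k) A = normal_prob 0 1 A.
Local Open Scope ereal_scope.

Lemma measurable_norm_le (r : R) : measurable [set y : R | (`|y| <= r)%R].
Proof.
rewrite (_ : [set y : R | _] = ~` [set y : R | (r < `|y|)%R]).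
  by apply: measurableC; exact: measurable_norm_gt.
by apply/seteqP; split => y /=; rewrite leNgt => /negP.
Qed.

Lemma measurable_finite_bigcap (s : seq (nat * int)) (B : nat * int -> set R) :
  (forall p, measurable (B p)) ->
  measurable (\bigcap_(p in [set` s]) (xi p.1 p.2 @^-1` B p)).
Proof.
move=> mB; apply: fin_bigcap_measurable; first exact: finite_seq.
by move=> p _; exact: measurable_xi_preimage.
Qed.

Lemma probability_all_le (s : seq (nat * int)) (B : nat * int -> set R)
    (u : nat * int -> R) : uniq s -> (forall p, measurable (B p)) ->
  (forall p, P (xi p.1 p.2 @^-1` B p) <= (u p)%:E) ->
  P (\bigcap_(p in [set` s]) (xi p.1 p.2 @^-1` B p)) <= (\prod_(p <- s) u p)%:E.
Proof.
move=> us mB hB; rewrite (xi_indep us mB).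
elim: s {us} => [|p s IH]; first by rewrite !big_nil.
by rewrite !big_cons EFinM lee_pmul// prode_ge0.
Qed.

(* [1 - x <= exp (- x)] turns the divergence of the sum of the tails into a
   vanishing probability. *)
Lemma probability_all_small : exists c : R, (0 < c)%R /\
  forall (s : seq (nat * int)) (r : nat * int -> R), uniq s ->
  (forall p, 0 <= r p)%R ->
  P (\bigcap_(p in [set` s]) (xi p.1 p.2 @^-1` [set y : R | (`|y| <= r p)%R])) <=
  (expR (- (c * \sum_(p <- s) expR (- r p ^+ 2))))%:E.
Proof.
have [c [c0 hc]] := @normal_tail_ge R.
exists c; split => // s r us r0.
rewrite mulr_sumr -sumrN expR_sum.
apply: probability_all_le => // p; first exact: measurable_norm_le.
rewrite prob_xi//; last exact: measurable_norm_le.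
(* The law is the same for all indices, so it is represented by [xi 0 0] in order to take a
   complement under [P]. *)
rewrite -(prob_xi xi_normal 0 0)//; last exact: measurable_norm_le.
rewrite (_ : _ @^-1` _ = ~` (xi 0 0 @^-1` [set y : R | (r p < `|y|)%R])); last first.
  by apply/seteqP; split => y /=; rewrite leNgt => /negP.
have mx := measurable_xi_preimage xi 0 0 (measurable_norm_gt (r p)).
rewrite probability_setC// prob_xi//; last exact: measurable_norm_gt.
apply: (@le_trans _ _ (1 - (c * expR (- r p ^+ 2))%:E)).
  by rewrite leeB// hc.
by rewrite -EFinB lee_fin (le_trans _ (expR_ge1Dx _)).
Qed.

End Independence.

(** * Dyadic lower bounds *)

Section DyadicFloor.
Context {R : realType}.
Implicit Types (t : R) (k : int).

Definition cell (j : nat) t : int := Num.floor (2 ^+ j * t).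

Lemma cell_itv (j : nat) t : (cell j t)%:~R <= 2 ^+ j * t < (cell j t)%:~R + 1.
Proof. by have := floor_itv (2 ^+ j * t); rewrite intrD. Qed.

Lemma cell_dist (j : nat) t : `|2 ^+ j * t - (cell j t)%:~R| <= 1.
Proof. by have /andP[h1 h2] := cell_itv j t; rewrite ger0_norm; lra. Qed.

Lemma cell_eq (j : nat) t k : k%:~R <= 2 ^+ j * t -> 2 ^+ j * t < k%:~R + 1 ->
  cell j t = k.
Proof. by move=> h1 h2; apply: floor_def; rewrite intrD h1. Qed.

(** The left end of a fine dyadic interval has the same ancestors as any point of the interval;
    unions over real [t] thus reduce to finite unions. *)
Lemma cell_coarse (i l : nat) t :
  cell i ((cell (i + l) t)%:~R * 2 ^- (i + l)) = cell i t.
Proof.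
have /andP[h1 h2] := cell_itv (i + l) t.
have /andP[g1 g2] := cell_itv i t.
have p m : 0 < 2 ^+ m :> R by rewrite exprn_gt0.
have e : 2 ^+ i * ((cell (i + l) t)%:~R * 2 ^- (i + l)) =
    (cell (i + l) t)%:~R * 2 ^- l :> R.
  by rewrite exprD; field; rewrite !gt_eqF.
have e2 : 2 ^+ (i + l) * t = 2 ^+ l * (2 ^+ i * t) by rewrite exprD; ring.
rewrite e2 in h1 h2.
have fine (n : int) : n%:~R <= 2 ^+ i * t ->
    n * 2 ^+ l <= cell (i + l) t.
  move=> h; rewrite /cell floor_ge_int e2 intrM rmorphXn/= mulrC.
  by rewrite ler_wpM2l ?(ltW (p l)).
apply: cell_eq; rewrite e.
  rewrite ler_pdivlMr//; have := fine _ g1; rewrite -(ler_int R).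
  by rewrite intrM rmorphXn.
by rewrite ltr_pdivrMr// (le_lt_trans h1)// mulrC ltr_pM2r.
Qed.

Lemma nested_intervals (l r : R^nat) : (forall n, l n <= l n.+1) ->
  (forall n, r n.+1 <= r n) -> (forall n, l n <= r n) ->
  exists t, forall n, l n <= t <= r n.
Proof.
move=> hl hr lr.
have ml : {homo l : m n / (m <= n)%N >-> m <= n} by exact/nondecreasing_seqP.
have mr m n : (m <= n)%N -> r n <= r m by move/nonincreasing_seqP: hr; exact.
have ub n : ubound (range l) (r n).
  move=> _ [m _ <-]; have [mn|nm] := leqP m n.
    exact: le_trans (ml _ _ mn) (lr n).
  exact: le_trans (lr m) (mr _ _ (ltnW nm)).
have hs : has_sup (range l) by split; [exists (l 0%N), 0%N|exists (r 0%N)].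
exists (sup (range l)) => n; apply/andP; split.
  by apply: sup_upper_bound => //; exists n.
by apply: sup_le_ub => //; exists (l 0%N), 0%N.
Qed.

End DyadicFloor.

Section LowerEvents.
Context d (T : measurableType d) (R : realType) (P : probability T R).
Variable xi : nat -> int -> {RV P >-> R}.
Hypothesis xi_indep : independent_family (fun p : nat * int => xi p.1 p.2).
Hypothesis xi_normal : forall (j : nat) (k : int) (A : set R), measurable A ->
  distribution P (xi j k) A = normal_prob 0 1 A.

Lemma expRN_nat_small (c eps : R) : 0 < c -> 0 < eps ->
  exists n : nat, expR (- (c * n%:R)) <= eps.
Proof.
move=> c0 e0; exists (Num.truncn (c^-1 * eps^-1)).+1.
have z0 : 0 <= c^-1 * eps^-1 by rewrite mulr_ge0// invr_ge0 ltW.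
have /andP[_ hm] := truncn_itv z0.
rewrite expRN -[leRHS]invrK lef_pV2 ?posrE ?expR_gt0 ?invr_gt0//.
apply: le_trans (expR_ge1Dx _).
rewrite (@le_trans _ _ (c * (c^-1 * eps^-1)))//.
  by rewrite mulrA mulfV ?mul1r// gt_eqF.
by rewrite (@le_trans _ _ (c * (Num.truncn (c^-1 * eps^-1)).+1%:R)) ?lerDr//
  ler_wpM2l// ltW.
Qed.

Lemma negligible_exists_index (E : nat -> int -> set T) :
  (forall j k, P.-negligible (E j k)) -> P.-negligible (exists_index E).
Proof.
move=> hE; rewrite exists_indexE; apply: negligible_bigcup => j.
by apply: negligibleU; exact: negligible_bigcup.
Qed.

(** Inclusion of dyadic intervals: the one of index [k] at level [j] lies in the one of index
    [kappa] at level [i]. *)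
Definition in_node (i : nat) (kappa : int) (j : nat) (k : int) :=
  (i <= j)%N /\ kappa * 2 ^+ (j - i) <= k < (kappa + 1) * 2 ^+ (j - i).

(** With threshold [2^-1 * rapid_gauge j], a tail costs about [expR (- 4^-1)] per level while the
    number of descendants doubles. As [2 * expR (- 4^-1)] is at least 3/2, the expected number of
    large coefficients tends to infinity. *)
Lemma rapid_lower : P.-negligible [set w | ~ forall (i : nat) (kappa : int),
  exists j k, in_node i kappa j k /\ 2^-1 * rapid_gauge j <= `|xi j k w|].
Proof.
have [c [c0 hc]] := probability_all_small xi_indep xi_normal.
pose F i kappa := [set w | ~ exists j k,
  in_node i kappa j k /\ 2^-1 * rapid_gauge j <= `|xi j k w|].
suff hF i kappa : P.-negligible (F i kappa).
  apply: negligibleS (negligible_exists_index hF) => w /= nw.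
  apply: contrapT => h; apply: nw => i kappa; apply: contrapT => h'.
  by apply: h; exists i, kappa.
pose s m : seq (nat * int) :=
  [seq ((i + m)%N, kappa * 2 ^+ m + n%:Z) | n <- iota 0 (2 ^ m)].
have us m : uniq (s m).
  rewrite map_inj_uniq; first exact: iota_uniq.
  by move=> x y [] /addrI => -[].
pose r (p : nat * int) : R := 2^-1 * rapid_gauge p.1.
have r0 p : 0 <= r p by apply: mulr_ge0 => //; exact: sqrtr_ge0.
pose e : R := expR (- (i.+1%:R / 4)).
have e0 : 0 < e by exact: expR_gt0.
have hs m : e * (m%:R / 2) <= \sum_(p <- s m) expR (- r p ^+ 2).
  rewrite big_map (eq_bigr (fun=> e * expR (- (m%:R / 4)))); last first.
    move=> n _; rewrite /r /e -expRD; congr expR.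
    by rewrite /rapid_gauge exprMn sqr_sqrtr// -addSn natrD /=; field.
  rewrite /= big_const_seq count_predT size_iota iter_addr_0 -mulrnAr ler_wpM2l ?(ltW e0)//.
  rewrite -[leRHS]mulr_natl natrX.
  have h : expR (- (m%:R / 4)) = expR (- 4^-1) ^+ m :> R.
    by rewrite -expRM_natl; congr expR; ring.
  rewrite h -exprMn.
  have q : 3 / 2 <= 2 * expR (- 4^-1) :> R.
    by have := @expR_ge1Dx R (- 4^-1); lra.
  apply: (@le_trans _ _ ((1 + 2^-1) ^+ m)).
    by apply: le_trans (bernoulli_ineq m _) => //; lra.
  by apply: lerXn2r; rewrite ?nnegrE ?mulr_ge0 ?expR_ge0//; lra.
have := @negligible_bigcap_le _ _ _ P
  (fun m => \bigcap_(p in [set` s m]) (xi p.1 p.2 @^-1` [set y : R | `|y| <= r p]))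
  (fun m => expR (- (c * (e / 2) * m%:R))).
move=> h; apply: negligibleS (h _ _ _).
- move=> w /= nw m _ p /= ps; rewrite leNgt; apply/negP => lt.
  apply: nw; case/mapP: ps => n; rewrite mem_iota/= add0n => nm pE.
  exists p.1, p.2; split; last exact: ltW.
  rewrite pE /in_node/= leq_addr addKn; split => //.
  rewrite lerDl mulrDl mul1r ltrD2l/=.
  by rewrite -[n%:Z]natz -natrX ltr_nat.
- by move=> m; apply: measurable_finite_bigcap => p; exact: measurable_norm_le.
- move=> m; apply: (le_trans (hc (s m) r (us m) r0)).
  rewrite lee_fin ler_expR lerN2 -!mulrA ler_wpM2l ?(ltW c0)//.
  by rewrite (le_trans _ (hs m))// mulrCA mulrC mulrA mulrAC.
- by move=> eps eps0; apply: expRN_nat_small => //; rewrite !mulr_gt0.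
Qed.

(** For a fixed interval of level [J], there are [2 ^ m] descendants at level [J + m], each with
    [m + 1] independent coefficients on its path; the union bound is 2^m 4^-(m+1). *)
Lemma slow_lower : P.-negligible [set w | exists (t : R) (J : nat),
  forall j, (J <= j)%N -> `|xi j (cell j t) w| < 4^-1].
Proof.
pose F J k0 := [set w | exists t : R, cell J t = k0 /\
  forall j, (J <= j)%N -> `|xi j (cell j t) w| < 4^-1].
suff hF J k0 : P.-negligible (F J k0).
  apply: negligibleS (negligible_exists_index hF) => w [t [J h]].
  by exists J, (cell J t), t.
pose B := [set y : R | `|y| < 4^-1].
have mB : measurable B.
  apply: open_measurable.
  exact: (open_comp (fun x _ => @norm_continuous _ _ x) (@open_lt _ 4^-1)).
pose s m n : seq (nat * int) :=
  [seq ((J + l)%N, cell (J + l) ((k0 * 2 ^+ m + n%:Z)%:~R * 2 ^- (J + m) : R))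
     | l <- iota 0 m.+1].
have us m n : uniq (s m n).
  rewrite map_inj_uniq; first exact: iota_uniq.
  by move=> x y [] /addnI.
pose E m n := \bigcap_(p in [set` s m n]) (xi p.1 p.2 @^-1` B).
have mE m n : measurable (E m n) by exact: measurable_finite_bigcap.
have PE m n : (P (E m n) <= ((4^-1) ^+ m.+1)%:E)%E.
  apply: (le_trans (probability_all_le xi_indep (u := fun=> 4^-1) (us m n) _ _)) => //.
    move=> p; rewrite prob_xi//; exact: normal_small_ball.
  by rewrite big_map big_const_seq count_predT size_iota iter_mulr_1.
have mU m : measurable (\big[setU/set0]_(n < 2 ^ m) E m n).
  exact: bigsetU_measurable.
have := @negligible_bigcap_le _ _ _ P
  (fun m => \big[setU/set0]_(n < 2 ^ m) E m n) (fun m => (2^-1) ^+ m).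
move=> h; apply: negligibleS (h mU _ _).
- move=> w [t [tk0 hw]] m _.
  have /andP[k1 k2] : k0 * 2 ^+ m <= cell (J + m) t < (k0 + 1) * 2 ^+ m.
    have /andP[g1 g2] := cell_itv J t; rewrite tk0 in g1 g2.
    have /andP[h1 h2] := cell_itv (J + m) t.
    have p2 : 0 < 2 ^+ m :> R by rewrite exprn_gt0.
    have e2 : 2 ^+ (J + m) * t = 2 ^+ m * (2 ^+ J * t) by rewrite exprD; ring.
    rewrite e2 in h1 h2; apply/andP; split.
      rewrite /cell floor_ge_int e2 intrM rmorphXn/= mulrC.
      by rewrite ler_wpM2l ?(ltW p2).
    rewrite -(ltr_int R) intrM rmorphXn/= intrD (le_lt_trans h1)//.
    by rewrite mulrC ltr_pM2r.
  have [n nE] : exists n : nat, cell (J + m) t = k0 * 2 ^+ m + n%:Z.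
    exists (absz (cell (J + m) t - k0 * 2 ^+ m)%R).
    by rewrite gez0_abs ?subr_ge0// addrC subrK.
  have nm : (n < 2 ^ m)%N.
    by move: k2; rewrite nE mulrDl mul1r ltrD2l -[n%:Z]natz -natrX ltr_nat.
  rewrite -bigcup_mkord; exists n => // p /= /mapP[l].
  rewrite mem_iota/= add0n ltnS => lm ->/=; rewrite -nE.
  have -> : cell (J + l) ((cell (J + m) t)%:~R * 2 ^- (J + m) : R) = cell (J + l) t.
    have e : (J + m = (J + l) + (m - l))%N by rewrite -addnA subnKC.
    by rewrite e cell_coarse.
  by apply: hw; exact: leq_addr.
- move=> m; apply: (@le_trans _ _ (\sum_(n < 2 ^ m) P (E m n))%E).
    by apply: content_subadditive => // n _; exact: mE.
  apply: (@le_trans _ _ (\sum_(n < 2 ^ m) ((4^-1) ^+ m.+1)%:E)%E).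
    by apply: lee_sum => n _.
  rewrite sumEFin lee_fin big_const cardT size_enum_ord iter_addr_0.
  rewrite -[leLHS]mulr_natl natrX exprS.
  rewrite (_ : 4^-1 ^+ m = 2^-1 ^+ m * 2^-1 ^+ m :> R); last first.
    by rewrite -exprMn; congr (_ ^+ _); field.
  have p2 : 0 < 2^-1 ^+ m :> R by rewrite exprn_gt0.
  have -> : 2 ^+ m * (4^-1 * (2^-1 ^+ m * 2^-1 ^+ m)) =
      (2 * 2^-1) ^+ m * 4^-1 * 2^-1 ^+ m :> R by rewrite exprMn; ring.
  by rewrite mulfV// expr1n; lra.
- move=> eps eps0; have [n hn] := expRN_nat_small (c := 2^-1) (eps := eps)
    ltac:(lra) eps0.
  exists n; apply: le_trans hn.
  rewrite -mulNr mulrC expRM_natl lerXn2r ?nnegrE ?expR_ge0//.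
  by have := @expR_ge1Dx R (- 2^-1); lra.
Qed.

End LowerEvents.

(** * Surviving branches *)

Section IndependentBlocks.
Context d (T : measurableType d) (R : realType) (P : probability T R).
Local Open Scope ereal_scope.

(* Dynkin's theorem: independence extends from a pi-system to the generated
   sigma-algebra. *)
Lemma independent_sigma (G : set (set T)) (B : set T) : measurable B ->
  setI_closed G -> G `<=` measurable ->
  (forall A, G A -> P (A `&` B) = P A * P B) ->
  forall A, <<s G >> A -> measurable A /\ P (A `&` B) = P A * P B.
Proof.
move=> mB GI Gm GB; rewrite -setI_closed_g_dynkin_g_sigma_algebra//.
pose H := [set A : set T | measurable A /\ P (A `&` B) = P A * P B].
suff : <<d G >> `<=` H by [].
have Pfin (A : set T) : measurable A -> P A \is a fin_num by exact: fin_num_measure.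
apply: smallest_sub; last by move=> A GA; split; [exact: Gm|exact: GB].
split.
- by split => //; rewrite setTI probability_setT mul1e.
- move=> A [mA AB]; split; first exact: measurableC.
  rewrite setIC -setDE measureD//; last by rewrite ltey_eq Pfin.
  transitivity (P B - P A * P B).
    by congr (_ - _); rewrite [B `&` A]setIC; exact: AB.
  rewrite probability_setC//.
  by rewrite muleBl ?mul1e// ?Pfin// fin_num_adde_defr// Pfin.
- move=> F tF HF; have mF n : measurable (F n) by have [] := HF n.
  split; first exact: bigcupT_measurable.
  rewrite setI_bigcupl measure_bigcup//; last 2 first.
  + by move=> n _; exact: measurableI.
  + by apply: trivIset_setIr.
  rewrite measure_bigcup// [RHS]muleC -(fineK (Pfin _ mB)) -nneseriesZl//.
  apply: eq_eseriesr => n _; rewrite fineK ?Pfin// muleC.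
  by have [] := HF n.
Qed.

Variable xi : nat -> int -> {RV P >-> R}.
Hypothesis xi_indep : independent_family (fun p : nat * int => xi p.1 p.2).
Hypothesis xi_normal : forall (j : nat) (k : int) (A : set R), measurable A ->
  distribution P (xi j k) A = normal_prob 0 1 A.

(** A pi-system generating the sigma-algebra of the variables with index in [U]. *)
Definition cylinders (U : nat * int -> Prop) : set (set T) :=
  [set A | exists (s : seq (nat * int)) (B : nat * int -> set R),
    [/\ uniq s, forall p, p \in s -> U p, forall p, measurable (B p) &
        A = \bigcap_(p in [set` s]) (xi p.1 p.2 @^-1` B p)]].

Definition block (U : nat * int -> Prop) : set (set T) := <<s cylinders U >>.

Lemma cylinders_measurable U : cylinders U `<=` measurable.
Proof. by move=> A [s [B [_ _ mB ->]]]; exact: measurable_finite_bigcap. Qed.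

Lemma cylindersI U : setI_closed (cylinders U).
Proof.
move=> _ _ [s [B [us sU mB ->]]] [s' [B' [us' sU' mB' ->]]].
pose C p := (if p \in s then B p else setT) `&` (if p \in s' then B' p else setT).
exists (undup (s ++ s')), C; split.
- exact: undup_uniq.
- by move=> p; rewrite mem_undup mem_cat => /orP[/sU|/sU'].
- by move=> p; apply: measurableI; case: ifP.
apply/seteqP; split => w /=.
  move=> [h h'] p /=; rewrite mem_undup mem_cat => ps; split.
    by case: ifPn => // /h.
  by case: ifPn => // /h'.
move=> h; split => p /= ps.
  by have := h p; rewrite /= mem_undup mem_cat ps /C/= ps => /(_ isT)[].
by have := h p; rewrite /= mem_undup mem_cat ps orbT /C/= ps => /(_ isT)[].
Qed.

Lemma block_measurable U A : block U A -> measurable A.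
Proof.
apply: smallest_sub; first exact: sigma_algebra_measurable.
exact: cylinders_measurable.
Qed.

(** Dynkin's theorem twice: first [A] ranges over its block against a fixed cylinder of [V], then
    [B] over its own against the fixed [A]. *)
Lemma blocks_independent U V A B : (forall p, U p -> ~ V p) ->
  block U A -> block V B -> P (A `&` B) = P A * P B.
Proof.
move=> UV UA VB.
suff h C : cylinders V C -> P (A `&` C) = P A * P C.
  have mA := block_measurable UA.
  have [|_] := @independent_sigma (cylinders V) A mA (@cylindersI V)
    (@cylinders_measurable V) _ B VB.
    by move=> C VC; rewrite setIC h// muleC.
  by rewrite setIC muleC.
move=> VC; have mC := cylinders_measurable VC.
have [|_ //] := @independent_sigma (cylinders U) C mC (@cylindersI U)
    (@cylinders_measurable U) _ A UA.
move=> _ [s [S [us sU mS ->]]]; case: VC => s' [S' [us' sV' mS' ->]].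
pose B0 p := if p \in s then S p else S' p.
have disj p : p \in s' -> p \notin s.
  by move=> ps'; apply/negP => /sU /UV; apply; exact: sV'.
have u2 : uniq (s ++ s').
  by rewrite cat_uniq us us' andbT/=; apply/hasPn => p; exact: disj.
have mB0 p : measurable (B0 p) by rewrite /B0; case: ifP.
have := xi_indep u2 mB0.
have e1 : \bigcap_(p in [set` s]) (xi p.1 p.2 @^-1` S p) =
    \bigcap_(p in [set` s]) (xi p.1 p.2 @^-1` B0 p).
  by apply: eq_bigcapr => p /= ps; rewrite /B0 ps.
have e2 : \bigcap_(p in [set` s']) (xi p.1 p.2 @^-1` S' p) =
    \bigcap_(p in [set` s']) (xi p.1 p.2 @^-1` B0 p).
  by apply: eq_bigcapr => p /= /disj ps; rewrite /B0 (negbTE ps).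
rewrite e1 e2 (xi_indep us mB0) (xi_indep us' mB0) big_cat/= => <-.
congr (P _); apply/seteqP; split => w /=.
  by move=> [h h'] p /=; rewrite mem_cat => /orP[/h|/h'].
by move=> h; split => p ps; apply: h; rewrite /= mem_cat ps ?orbT.
Qed.

Lemma block_sub U V A : (forall p, U p -> V p) -> block U A -> block V A.
Proof.
move=> UV; apply: smallest_sub; first exact: smallest_sigma_algebra.
move=> _ [s [B [us sU mB ->]]]; apply: sub_sigma_algebra.
by exists s, B; split => // p /sU /UV.
Qed.

Lemma blockC U A : block U A -> block U (~` A).
Proof. by move=> h; apply: (@measurableC _ (g_sigma_algebraType (cylinders U))). Qed.

Lemma blockU U A B : block U A -> block U B -> block U (A `|` B).
Proof. by move=> h h'; apply: (@measurableU _ (g_sigma_algebraType (cylinders U))). Qed.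

Lemma blockI U A B : block U A -> block U B -> block U (A `&` B).
Proof. by move=> h h'; apply: (@measurableI _ (g_sigma_algebraType (cylinders U))). Qed.

(** [measurable_exists_index] is applied to the sigma-algebra generated by the cylinders in place of
    that of [T]. *)
Lemma block_excess (r : nat -> int -> R) (U : nat -> int -> Prop) :
  block (fun p => U p.1 p.2) (excess xi r U).
Proof.
apply: (@measurable_exists_index _ (g_sigma_algebraType (cylinders _))
  (fun j k => [set w | U j k /\ (r j k < `|xi j k w|)%R])) => j k.
have [Ujk|nU] := pselect (U j k); last first.
  by rewrite (_ : [set w | _] = set0)//; apply/seteqP; split => w // -[].
apply: sub_sigma_algebra; exists [:: (j, k)], (fun=> [set y : R | (r j k < `|y|)%R]).
split => //.
- by move=> p; rewrite mem_seq1 => /eqP ->.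
- by move=> _; exact: measurable_norm_gt.
apply/seteqP; split => w /=.
  by move=> [_ h] p /=; rewrite mem_seq1 => /eqP ->.
by move=> h; split => //; apply: (h (j, k)); rewrite /= mem_seq1.
Qed.

End IndependentBlocks.

(** * The tree of surviving dyadic intervals *)

Section SurvivalTree.
Context d (T : measurableType d) (R : realType) (P : probability T R).
Variable xi : nat -> int -> {RV P >-> R}.
Hypothesis xi_indep : independent_family (fun p : nat * int => xi p.1 p.2).
Hypothesis xi_normal : forall (j : nat) (k : int) (A : set R), measurable A ->
  distribution P (xi j k) A = normal_prob 0 1 A.

(* The dyadic intervals inside the triple of the [kappa]-th one of level [i]. *)
Definition in_triple (i : nat) (kappa : int) (j : nat) (k : int) :=
  (i <= j)%N /\ (kappa - 1) * 2 ^+ (j - i) <= k < (kappa + 2) * 2 ^+ (j - i).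

(** The allowance depends on [j - i] and starts afresh at every node, so that the probability of
    being bad is bounded uniformly over nodes. *)
Definition bad (A : R) (i : nat) (kappa : int) : set T :=
  excess xi (fun j _ => A * (3 * (1 + (j - i)%:R))) (in_triple i kappa).

(* Each node keeps two of its descendants three levels below, whose triples are
   disjoint and contained in the node, so that their fates are independent. *)
Definition child (e : bool) (kappa : int) : int := kappa * 8 + (if e then 2 else 5).

(** Survival for [n] generations; survival for all [n] is turned into an infinite branch by
    [survival_branch]. *)
Fixpoint survive (A : R) (n i : nat) (kappa : int) : set T :=
  if n is m.+1 then ~` bad A i kappa `&`
    (survive A m (i + 3) (child true kappa) `|`
     survive A m (i + 3) (child false kappa))
  else ~` bad A i kappa.

Lemma in_triple_child e i kappa j k :
  in_triple (i + 3) (child e kappa) j k -> in_triple i kappa j k.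
Proof.
move=> [ij /andP[h1 h2]]; split; first exact: leq_trans (leq_addr _ _) ij.
have -> : (j - i = 3 + (j - (i + 3)))%N by lia.
rewrite exprD (_ : 2 ^+ 3 = 8 :> int)//.
have p0 : 0 < 2 ^+ (j - (i + 3)) :> int by rewrite exprn_gt0.
set p := 2 ^+ (j - (i + 3)) in h1 h2 p0 *; rewrite /child in h1 h2.
by case: e h1 h2 => h1 h2; apply/andP; split; nia.
Qed.

(** In units of level [i + 3] the two triples are [[8 kappa + 1, 8 kappa + 4[] and [[8 kappa + 4, 8
    kappa + 7[]. *)
Lemma in_triple_disjoint i kappa j k :
  in_triple (i + 3) (child true kappa) j k ->
  ~ in_triple (i + 3) (child false kappa) j k.
Proof.
move=> [ij /andP[h1 h2]] [_ /andP[h3 h4]].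
have p0 : 0 < 2 ^+ (j - (i + 3)) :> int by rewrite exprn_gt0.
set p := 2 ^+ (j - (i + 3)) in h1 h2 h3 h4 p0 *; rewrite /child in h1 h2 h3 h4.
nia.
Qed.

Lemma block_survive A n i kappa :
  block xi (fun p => in_triple i kappa p.1 p.2) (survive A n i kappa).
Proof.
elim: n i kappa => [|n IH] i kappa /=; first by apply: blockC; exact: block_excess.
apply: blockI; first by apply: blockC; exact: block_excess.
by apply: blockU; apply: block_sub (IH _ _) => p; exact: in_triple_child.
Qed.

Lemma measurable_bad A i kappa : measurable (bad A i kappa).
Proof. exact: measurable_excess. Qed.

Lemma measurable_survive A n i kappa : measurable (survive A n i kappa).
Proof. exact: block_measurable (@block_survive A n i kappa). Qed.

Lemma survive_antimono A n i kappa :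
  survive A n.+1 i kappa `<=` survive A n i kappa.
Proof.
elim: n i kappa => [|n IH] i kappa; first by move=> w [].
by move=> w [h1 [h2|h2]]; split => //; [left|right]; exact: IH.
Qed.

Lemma survive_le A n m i kappa : (n <= m)%N ->
  survive A m i kappa `<=` survive A n i kappa.
Proof.
move=> /subnK <-; elim: (m - n)%N => [//|q IH] w.
by rewrite addSn => /survive_antimono/IH.
Qed.

Lemma probability_bad_le (A : R) i kappa : 2 <= A ->
  (P (bad A i kappa) <= (64 * expR (1 - A ^+ 2 / 4))%:E)%E.
Proof.
move=> A2.
apply: (@probability_excess_le _ _ _ _ _ xi_normal
  (fun j _ => 3 * (1 + (j - i)%:R)) _ (fun j => kappa%:~R * 2 ^+ (j - i)) i) => //.
move=> j k [ij /andP[h1 h2]]; set l := (j - i)%N in h1 h2 *.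
have l0 := ler0n R l; split => //; first lra.
have p1 : 1 <= 2 ^+ l :> R by rewrite exprn_ege1// ler1n.
have kl : `|kappa%:~R * 2 ^+ l - k%:~R| <= 2 * 2 ^+ l :> R.
  move: h1 h2; rewrite -(ler_int R) -(ltr_int R) !intrM !rmorphXn/= !intrD.
  rewrite intrN mulrBl mulrDl mul1r => h1 h2.
  by rewrite ler_norml; apply/andP; split; lra.
have e1 : ln (1 + l%:R) <= l%:R :> R.
  by rewrite le_ln1Dx// (lt_le_trans _ l0)// ltrN10.
have e2 : ln (1 + `|kappa%:~R * 2 ^+ l - k%:~R|) <= l%:R + 2 :> R.
  apply: (@le_trans _ _ (ln (2 ^+ (l + 2)))).
    rewrite ler_ln ?posrE ?exprn_gt0 ?ltr_pwDl// exprD expr2; lra.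
  rewrite lnXn// -[leLHS]mulr_natl natrD.
  by have := @ln2_le1 R; have := @ln2_gt0 R; nra.
nra.
Qed.

(** A death probability [p] of both independent subtrees gives at most [delta + p ^+ 2] for the
    node, and [[0, 2 * delta]] is stable under this map when [delta <= 4^-1]. *)
Lemma probability_not_survive_le (A delta : R) : 0 <= delta -> delta <= 4^-1 ->
  (forall i kappa, (P (bad A i kappa) <= delta%:E)%E) ->
  forall n i kappa, (P (~` survive A n i kappa) <= (2 * delta)%:E)%E.
Proof.
move=> d0 d4 hbad; elim=> [|n IH] i kappa /=.
  by rewrite setCK (le_trans (hbad _ _))// lee_fin; lra.
set S1 := survive _ _ _ _; set S2 := survive _ _ _ _.
have mS1 : measurable S1 by exact: measurable_survive.
have mS2 : measurable S2 by exact: measurable_survive.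
rewrite setCI setCK setCU.
apply: (le_trans (measureU2 _ _ _)).
- exact: measurable_bad.
- by apply: measurableI; exact: measurableC.
have ind : P (~` S1 `&` ~` S2) = (P (~` S1) * P (~` S2))%E.
  apply: (blocks_independent xi_indep (U := fun p =>
      in_triple (i + 3) (child true kappa) p.1 p.2)
    (V := fun p => in_triple (i + 3) (child false kappa) p.1 p.2)).
  - by move=> p; exact: in_triple_disjoint.
  - by apply: blockC; exact: block_survive.
  - by apply: blockC; exact: block_survive.
apply: (@le_trans _ _ (delta%:E + (2 * delta)%:E * (2 * delta)%:E)%E).
  apply: leeD; first exact: hbad.
  apply: (@le_trans _ _ (P (~` S1) * P (~` S2))%E); last first.
    by apply: lee_pmul => //; exact: IH.
  by rewrite le_eqVlt; apply/orP; left; apply/eqP; exact: ind.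
by rewrite -EFinM -EFinD lee_fin; nra.
Qed.

(** For fixed [A] a given node may die. The constant depends on [w], and the death probability tends
    to 0 as [A] grows. *)
Lemma negligible_no_survival (i : nat) (kappa : int) : P.-negligible
  [set w | ~ exists A : R, 0 <= A /\ forall n, survive A n i kappa w].
Proof.
have [n0 hn0] := @expR_sqr_small R 64 4^-1 ltac:(lra) ltac:(lra).
pose A (n : nat) : R := (n0 + n).+2%:R.
pose delta n := 64 * expR (1 - A n ^+ 2 / 4).
pose F n := \bigcup_m ~` survive (A n) m i kappa.
have mF n : measurable (F n).
  by apply: bigcupT_measurable => m; apply: measurableC; exact: measurable_survive.
have A2 n : 2 <= A n by rewrite ler_nat.
have dmono n m : (n <= m)%N -> delta m <= delta n.
  move=> nm; rewrite /delta ler_wpM2l// ler_expR lerD2l lerN2.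
  rewrite ler_wpM2r// lerXn2r ?nnegrE ?ler0n//.
  by rewrite ler_nat !ltnS leq_add2l.
have d4 n : delta n <= 4^-1.
  apply: le_trans hn0; apply: le_trans (dmono 0%N n (leq0n _)) _.
  by rewrite /delta /A addn0.
have PF n : (P (F n) <= (2 * delta n)%:E)%E.
  have cvF : P \o (fun m => ~` survive (A n) m i kappa) @ \oo --> P (F n).
    apply: nondecreasing_cvg_mu => //.
    - by move=> m; apply: measurableC; exact: measurable_survive.
    - exact: mF.
    - move=> m m' mm'; apply/subsetPset/subsetC.
      exact: survive_le.
  apply: (cvge_to_le cvF); apply: nearW => m /=.
  apply: probability_not_survive_le => //; first by rewrite mulr_ge0// expR_ge0.
  by move=> i' kappa'; exact: probability_bad_le.
have := @negligible_bigcap_le _ _ _ P F (fun n => 2 * delta n) mF PF.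
move=> h; apply: negligibleS (h _).
- move=> w /= nw n _; apply: contrapT => nF; apply: nw.
  exists (A n); split => // m; apply: contrapT => ns; apply: nF.
  by exists m.
- move=> eps eps0; have e2 : 0 < eps / 2 by rewrite divr_gt0.
  have [n hn] := @expR_sqr_small R 64 (eps / 2) ltac:(lra) e2.
  exists n; suff : delta n <= eps / 2 by lra.
  apply: le_trans hn; rewrite /delta ler_wpM2l// ler_expR lerD2l lerN2.
  rewrite ler_wpM2r// lerXn2r ?nnegrE ?ler0n//.
  by rewrite ler_nat !ltnS leq_addl.
Qed.

Lemma survive_not_bad A n i kappa w : survive A n i kappa w -> ~ bad A i kappa w.
Proof. by case: n => [|n] //= []. Qed.

(* König's lemma on the binary tree of descendants. *)
Lemma survival_branch A i kappa w : (forall n, survive A n i kappa w) ->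
  exists K : nat -> int, [/\ K 0%N = kappa,
    forall m, exists e, K m.+1 = child e (K m) &
    forall m, ~ bad A (i + 3 * m) (K m) w].
Proof.
move=> h0.
pose alive (p : nat * int) := forall n, survive A n p.1 p.2 w.
have step (l : int) (m : nat) : exists e, alive ((i + 3 * m)%N, l) ->
    alive ((i + 3 * m.+1)%N, child e l).
  (* If the first child is dead after [n1] generations and the second after [n], then the parent is
     dead after [(maxn n1 n).+1]. *)
  have [[n1 h1]|h1] := pselect (exists n,
      ~ survive A n (i + 3 * m.+1) (child true l) w); last first.
    exists true => _ n; apply: contrapT => h; apply: h1; by exists n.
  exists false => hal n; apply: contrapT => h2.
  have [_ [h|h]] := hal (maxn n1 n).+1; rewrite -addnA -mulnSr in h.
    by apply: h1; apply: survive_le h; exact: leq_maxl.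
  by apply: h2; apply: survive_le h; exact: leq_maxr.
have [e he] : {e : nat -> int -> bool | forall m l, alive ((i + 3 * m)%N, l) ->
    alive ((i + 3 * m.+1)%N, child (e m l) l)}.
  exists (fun m l => sval (cid (step l m))) => m l.
  exact: (svalP (cid (step l m))).
pose K := fix K m := if m is m'.+1 then child (e m' (K m')) (K m') else kappa.
have aK m : alive ((i + 3 * m)%N, K m).
  elim: m => [|m IH]; first by rewrite /alive/= addn0.
  exact: he.
exists K; split => // m; first by exists (e m (K m)).
exact: survive_not_bad (aK m 0%N).
Qed.

End SurvivalTree.

(** * Growth of coefficients at special points *)

Section CoefficientGrowth.
Context {R : realType}.
Variable x : nat -> int -> R.

(** The almost sure growth of the whole Gaussian family, with no reference to a point [t]. *)
Definition global_weight (j : nat) (k : int) : R :=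
  2 * Num.sqrt (ln (2 + j%:R + `|k%:~R|)).

Lemma global_weight_ge (j : nat) (k : int) : 1 <= global_weight j k /\
  2 * ln (1 + j%:R) + 2 * ln (1 + `|0 - k%:~R|) <= global_weight j k ^+ 2.
Proof.
rewrite /global_weight; set y := 2 + _ + _.
have j0 := ler0n R j; have k0 := normr_ge0 (k%:~R : R).
have y2 : 2 <= y by rewrite /y; lra.
have y0 : 0 < y by lra.
have ly : 2^-1 <= ln y.
  by rewrite (le_trans ln2_ge_half)// ler_ln ?posrE.
have ly0 : 0 <= ln y by lra.
split.
  rewrite mulr2_sqrt -[leLHS]sqrtr1 ler_wsqrtr//; lra.
rewrite exprMn sqr_sqrtr// sub0r normrN.
have e1 : ln (1 + j%:R) <= ln y by rewrite ler_ln ?posrE ?ltr_pwDl// /y; lra.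
have e2 : ln (1 + `|k%:~R|) <= ln y by rewrite ler_ln ?posrE ?ltr_pwDl// /y; lra.
lra.
Qed.

(** [|k|] is at most [2 ^+ j * |t|] plus the distance of [k] to [2 ^+ j * t]; the logarithm
    separates the level from the distance. *)
Lemma ln_index_le (j : nat) (k : int) (t : R) :
  ln (2 + j%:R + `|k%:~R|) <=
    1 + j%:R + `|t| + ln (1 + `|2 ^+ j * t - k%:~R|).
Proof.
have j0 := ler0n R j; have t0 := normr_ge0 t.
set u := `|2 ^+ j * t - k%:~R|; have u0 : 0 <= u by exact: normr_ge0.
have p1 : 1 + j%:R <= 2 ^+ j :> R.
  have := @bernoulli_ineq R 1 j ler01; rewrite mulr1.
  by rewrite (_ : 1 + 1 = 2)//; ring.
have p0 : 0 < 2 ^+ j :> R by rewrite exprn_gt0.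
have k1 : `|k%:~R| <= 2 ^+ j * `|t| + u.
  have := ler_normB (2 ^+ j * t) (2 ^+ j * t - k%:~R).
  rewrite (_ : 2 ^+ j * t - (2 ^+ j * t - k%:~R) = k%:~R); last by ring.
  by rewrite normrM (gtr0_norm p0).
have k0 := normr_ge0 (k%:~R : R).
apply: (@le_trans _ _ (ln (2 * (2 ^+ j * ((1 + `|t|) * (1 + u)))))).
  rewrite ler_ln ?posrE.
  - have : 0 <= 2 ^+ j * `|t| by rewrite mulr_ge0// ltW.
    have : 0 <= 2 ^+ j * u by rewrite mulr_ge0// ltW.
    have : 0 <= 2 ^+ j * `|t| * u by rewrite !mulr_ge0// ltW.
    have : u <= 2 ^+ j * u by rewrite ler_peMl//; lra.
    lra.
  - by rewrite -addrA ltr_pwDl// addr_ge0.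
  - by rewrite !mulr_gt0// ltr_pwDl.
have a1 : 0 < 1 + `|t| by rewrite ltr_pwDl.
have a2 : 0 < 1 + u by rewrite ltr_pwDl.
rewrite !lnM ?posrE ?mulr_gt0// lnXn//.
have e1 : ln (1 + `|t|) <= `|t| by rewrite le_ln1Dx// (lt_le_trans _ t0)// ltrN10.
have e2 : ln 2 *+ j <= j%:R :> R.
  by rewrite -[leLHS]mulr_natl ler_piMr// ln2_le1.
have := @ln2_le1 R; lra.
Qed.

Lemma sqrt_le_self (z : R) : 1 <= z -> Num.sqrt z <= z.
Proof.
move=> z1; rewrite -[leRHS]ger0_norm; last by lra.
by rewrite -sqrtr_sqr ler_wsqrtr// expr2; nra.
Qed.

(** The upper bound holds at every [t]; for rapid points only the lower bound calls for a special
    [t]. *)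
Lemma rapid_growth (A : R) : 0 <= A ->
  (forall j k, `|x j k| <= A * global_weight j k) ->
  forall t, exists C : R, 0 <= C /\ coef_growth x rapid_gauge t C.
Proof.
move=> A0 hA t; exists (A * (2 * (1 + `|t|))).
split; first by rewrite !mulr_ge0// addr_ge0.
move=> j k; rewrite (le_trans (hA j k))// -!mulrA ler_wpM2l// ler_wpM2l//.
set l := ln (1 + _); have l0 : 0 <= l by rewrite ln_ge0// lerDl.
have t0 := normr_ge0 t; have j0 := ler0n R j.
rewrite mulrCA /rapid_gauge -[(1 + `|t|) * _]ger0_norm; last first.
  by rewrite mulr_ge0// addr_ge0.
rewrite (@le_trans _ _ (Num.sqrt (j.+1%:R * ((1 + `|t|) * (1 + l)))))//.
  rewrite ler_wsqrtr// (le_trans (ln_index_le _ _ t))// -/l -natr1.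
  have : 0 <= j%:R * `|t| by rewrite mulr_ge0.
  have : 0 <= j%:R * l by rewrite mulr_ge0.
  have : 0 <= `|t| * l by rewrite mulr_ge0.
  have : 0 <= j%:R * (`|t| * l) by rewrite !mulr_ge0.
  lra.
rewrite sqrtrM// ler_wpM2l// (le_trans (sqrt_le_self _)) ?ler_norm//.
have : 0 <= `|t| * l by rewrite mulr_ge0.
lra.
Qed.

(** The triple leaves a margin of one interval on each side of the node of [t], so an index outside
    it at a finer level is at a distance of at least [2 ^+ (j - i)] cells. The level is then bounded
    by the logarithm of the distance. *)
Lemma slow_growth_off_node (A : R) (i : nat) (kappa : int) (t : R) :
  0 <= A -> (forall j k, `|x j k| <= A * global_weight j k) ->
  kappa%:~R <= 2 ^+ i * t <= kappa%:~R + 1 ->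
  exists C : R, 0 <= C /\ forall j k, ~ in_triple i kappa j k ->
    `|x j k| <= C * (1 + ln (1 + `|2 ^+ j * t - k%:~R|)).
Proof.
move=> A0 hA ht; exists (A * (4 * (1 + i%:R + `|t| + 3))).
have t0 := normr_ge0 t; have i0 := ler0n R i.
split; first by rewrite !mulr_ge0// !addr_ge0.
move=> j k nT; rewrite (le_trans (hA j k))// -!mulrA ler_wpM2l//.
rewrite /global_weight; set u := `|2 ^+ j * t - k%:~R|.
have u0 : 0 <= u by exact: normr_ge0.
set l := ln (1 + u); have l0 : 0 <= l by rewrite ln_ge0// lerDl.
have jl : j%:R <= i%:R + 2 * l.
  have [ji|ij] := ltnP j i.
    have : j%:R <= i%:R :> R by rewrite ler_nat ltnW.
    lra.
  have p0 : 0 < 2 ^+ (j - i) :> R by rewrite exprn_gt0.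
  have uj : 2 ^+ (j - i) <= u.
    have e : 2 ^+ j * t = 2 ^+ (j - i) * (2 ^+ i * t).
      by rewrite mulrA -exprD subnK.
    have /andP[t1 t2] := ht.
    have f1 : 2 ^+ (j - i) * kappa%:~R <= 2 ^+ j * t by rewrite e ler_wpM2l// ltW.
    have f2 : 2 ^+ j * t <= 2 ^+ (j - i) * (kappa%:~R + 1).
      by rewrite e ler_wpM2l// ltW.
    have [kl|kl] := ltP k ((kappa - 1) * 2 ^+ (j - i)).
      move: kl; rewrite -(ltr_int R) intrM rmorphXn/= intrB => kl.
      by apply: le_trans (ler_norm _); lra.
    have kr : (kappa + 2) * 2 ^+ (j - i) <= k.
      by rewrite leNgt; apply/negP => kr; apply: nT; split => //; rewrite kl.
    move: kr; rewrite -(ler_int R) intrM rmorphXn/= intrD => kr.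
    by rewrite /u distrC; apply: le_trans (ler_norm _); lra.
  have : ln (2 ^+ (j - i)) <= l.
    by rewrite ler_ln ?posrE ?ltr_pwDl// (le_trans uj)// lerDr.
  rewrite lnXn// -[leLHS]mulr_natl natrB//.
  have := @ln2_ge_half R; have : i%:R <= j%:R :> R by rewrite ler_nat.
  nra.
have hl := ln_index_le j k t; rewrite -/u -/l in hl.
set y := ln _ in hl *.
have y0 : 0 <= y.
  rewrite ln_ge0//; have := normr_ge0 (k%:~R : R); have := ler0n R j; lra.
have hy : 2 * Num.sqrt y <= 4 * (1 + y).
  have : Num.sqrt y <= Num.sqrt (1 + y) by rewrite ler_wsqrtr// lerDr.
  have : Num.sqrt (1 + y) <= 1 + y by rewrite sqrt_le_self// lerDl.
  lra.
rewrite (le_trans hy)// ler_wpM2l//.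
have : 0 <= i%:R * l by rewrite mulr_ge0.
have : 0 <= `|t| * l by rewrite mulr_ge0.
lra.
Qed.

(** For each [k] the bound is taken at the last node of the branch whose triple contains it. Having
    left the next triple, [k] is far from [t], and the logarithmic weight covers the levels below
    that node. *)
Lemma slow_growth_branch (A A' : R) (i : nat) (kappa : int) (K : nat -> int) :
  0 <= A -> (forall j k, `|x j k| <= A * global_weight j k) -> 0 <= A' ->
  K 0%N = kappa -> (forall m, exists e, K m.+1 = child e (K m)) ->
  (forall m j k, in_triple (i + 3 * m) (K m) j k ->
     `|x j k| <= A' * (3 * (1 + (j - (i + 3 * m))%:R))) ->
  exists t : R, kappa%:~R <= 2 ^+ i * t <= kappa%:~R + 1 /\
    exists C : R, 0 <= C /\ coef_growth x slow_gauge t C.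
Proof.
move=> A0 hA A'0 K0 Kc hK.
pose l m : R := (K m)%:~R * 2 ^- (i + 3 * m).
pose r m : R := ((K m)%:~R + 1) * 2 ^- (i + 3 * m).
have p0 n : 0 < 2 ^+ n :> R by rewrite exprn_gt0.
have e8 m : 2 ^- (i + 3 * m) = 8 * 2 ^- (i + 3 * m.+1) :> R.
  have -> : (i + 3 * m.+1 = 3 + (i + 3 * m))%N by lia.
  rewrite (exprD _ 3) invfM mulrA (_ : 2 ^+ 3 = 8 :> R); last by ring.
  by rewrite mulfV// mul1r.
have cK m : (K m)%:~R * 8 + 1 <= (K m.+1)%:~R :> R /\
    (K m.+1)%:~R + 1 <= ((K m)%:~R + 1) * 8 :> R.
  by have [[] ->] := Kc m; rewrite /child intrD intrM; split; lra.
have q0 n : 0 < 2 ^- n :> R by rewrite invr_gt0.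
have [t ht] : exists t, forall m, l m <= t <= r m.
  apply: nested_intervals => m; rewrite /l /r.
  - rewrite (e8 m) mulrA ler_pM2r//; have [h _] := cK m; lra.
  - rewrite (e8 m) mulrA ler_pM2r//; have [_ h] := cK m; lra.
  - by rewrite ler_pM2r// lerDl.
have tK m : (K m)%:~R <= 2 ^+ (i + 3 * m) * t <= (K m)%:~R + 1.
  have /andP[h1 h2] := ht m; apply/andP; split.
    by rewrite mulrC -ler_pdivrMr.
  by rewrite mulrC -ler_pdivlMr.
have tk : kappa%:~R <= 2 ^+ i * t <= kappa%:~R + 1.
  by have := tK 0%N; rewrite K0 muln0 addn0.
exists t; split => //.
have [C [C0 hC]] := slow_growth_off_node A0 hA tk.
exists (C + 12 * A'); split; first by rewrite addr_ge0// mulr_ge0.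
move=> j k; rewrite /slow_gauge mulr1.
set u := `|2 ^+ j * t - k%:~R|; have u0 : 0 <= u by exact: normr_ge0.
set w := ln (1 + u); have w0 : 0 <= w by rewrite ln_ge0// lerDl.
have [inn|out] := pselect (in_triple i kappa j k); last first.
  rewrite (le_trans (hC j k out))// -/u -/w ler_wpM2r ?addr_ge0//.
  by rewrite lerDl mulr_ge0.
have [m [hm hm']] : exists m, in_triple (i + 3 * m) (K m) j k /\
    ~ in_triple (i + 3 * m.+1) (K m.+1) j k.
  apply: contrapT => h.
  have all m : in_triple (i + 3 * m) (K m) j k.
    elim: m => [|m IH]; first by rewrite K0 muln0 addn0.
    by apply: contrapT => h'; apply: h; exists m.
  (* [in_triple] includes [i + 3 * m <= j], which fails at [m = j.+1]. *)
  by have [+ _] := all j.+1; lia.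
have jm : (j - (i + 3 * m))%:R <= 3 + 2 * w.
  have [jlt|jge] := ltnP j (i + 3 * m.+1).
    have : (j - (i + 3 * m) <= 3)%N by lia.
    by rewrite -(ler_nat R); lra.
  have : (j - (i + 3 * m) = 3 + (j - (i + 3 * m.+1)))%N by lia.
  move=> ->; set n := (j - (i + 3 * m.+1))%N; rewrite natrD lerD2l.
  have un : 2 ^+ n <= u.
    have e : 2 ^+ j * t = 2 ^+ n * (2 ^+ (i + 3 * m.+1) * t).
      by rewrite mulrA -exprD subnK.
    have /andP[t1 t2] := tK m.+1.
    have f1 : 2 ^+ n * (K m.+1)%:~R <= 2 ^+ j * t by rewrite e ler_wpM2l// ltW.
    have f2 : 2 ^+ j * t <= 2 ^+ n * ((K m.+1)%:~R + 1).
      by rewrite e ler_wpM2l// ltW.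
    have [kl|kl] := ltP k ((K m.+1 - 1) * 2 ^+ n).
      move: kl; rewrite -(ltr_int R) intrM rmorphXn/= intrB => kl.
      by apply: le_trans (ler_norm _); lra.
    have kr : (K m.+1 + 2) * 2 ^+ n <= k.
      by rewrite leNgt; apply/negP => kr; apply: hm'; split => //; rewrite kl.
    move: kr; rewrite -(ler_int R) intrM rmorphXn/= intrD => kr.
    by rewrite /u distrC; apply: le_trans (ler_norm _); lra.
  have : ln (2 ^+ n) <= w.
    by rewrite ler_ln ?posrE ?ltr_pwDl// (le_trans un)// lerDr.
  rewrite lnXn// -[leLHS]mulr_natl.
  by have := @ln2_ge_half R; have := ler0n R n; nra.
rewrite (le_trans (hK _ _ _ hm))// [leRHS]mulrDl -[leLHS]add0r lerD//.
  by rewrite mulr_ge0// addr_ge0.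
rewrite [leRHS](_ : _ = A' * (12 * (1 + w))); last by ring.
by rewrite ler_wpM2l//; lra.
Qed.

Lemma rapid_point (i : nat) (kappa : int) :
  (forall (i : nat) (kappa : int), exists j k, in_node i kappa j k /\
    2^-1 * rapid_gauge j <= `|x j k|) ->
  exists t : R, kappa%:~R <= 2 ^+ i * t <= kappa%:~R + 1 /\
    exists c : R, 0 < c /\ forall J : nat, exists (j : nat) (k : int),
    [/\ (J <= j)%N, `|2 ^+ j * t - k%:~R| <= 1 & c * rapid_gauge j <= `|x j k|].
Proof.
move=> h.
have [nx hnx] : {nx : nat * int -> nat * int | forall p,
    in_node p.1 p.2 (nx p).1 (nx p).2 /\
    2^-1 * rapid_gauge (nx p).1 <= `|x (nx p).1 (nx p).2|}.
  have h' (p : nat * int) : exists q : nat * int, in_node p.1 p.2 q.1 q.2 /\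
      2^-1 * rapid_gauge q.1 <= `|x q.1 q.2|.
    by have [j [k hjk]] := h p.1 p.2; exists (j, k).
  exists (fun p => sval (cid (h' p))) => p; exact: (svalP (cid (h' p))).
(* The next node is the left half of the chosen interval: [in_node] allows [j = i], so without this
   descent the levels might not increase. *)
pose N := fix N m := if m is m'.+1 then
   (let q := nx (N m') in (q.1.+1, q.2 * 2)) else (i, kappa).
pose l m : R := (N m).2%:~R * 2 ^- (N m).1.
pose r m : R := ((N m).2%:~R + 1) * 2 ^- (N m).1.
have p0 n : 0 < 2 ^+ n :> R by rewrite exprn_gt0.
have q0 n : 0 < 2 ^- n :> R by rewrite invr_gt0.
have node (p q : nat * int) : in_node p.1 p.2 q.1 q.2 ->
    p.2%:~R * 2 ^- p.1 <= q.2%:~R * 2 ^- q.1 :> R /\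
    (q.2%:~R + 1) * 2 ^- q.1 <= (p.2%:~R + 1) * 2 ^- p.1 :> R.
  move=> [pq /andP[h1 h2]].
  have e : 2 ^- p.1 = 2 ^+ (q.1 - p.1) * 2 ^- q.1 :> R.
    by rewrite -{2}(subnK pq) exprD invfM mulrA mulfV ?mul1r// gt_eqF.
  rewrite e !mulrA !ler_pM2r//; split.
    by move: h1; rewrite -(ler_int R) intrM rmorphXn.
  by move: h2; rewrite -lezD1 -(ler_int R) intrM rmorphXn/= !intrD.
have half (q : nat * int) : (q.2 * 2)%:~R * 2 ^- q.1.+1 = q.2%:~R * 2 ^- q.1 :> R.
  by rewrite intrM exprS invfM mulrA mulfK.
have [t ht] : exists t, forall m, l m <= t <= r m.
  apply: nested_intervals => m; rewrite /l /r /=.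
  - by rewrite half; have [/node[]] := hnx (N m).
  - have [/node[_ h2] _] := hnx (N m); apply: le_trans h2.
    rewrite mulrDl half mulrDl lerD2l mul1r mul1r.
    by rewrite lef_pV2 ?posrE// exprS ler_peMl ?ler1n// ltW.
  - by rewrite ler_pM2r// lerDl.
exists t; split.
  have /andP[h1 h2] := ht 0%N; rewrite /l /r/= in h1 h2; apply/andP; split.
    by rewrite mulrC -ler_pdivrMr.
  by rewrite mulrC -ler_pdivlMr.
exists 2^-1; split; first by lra.
move=> J.
have big m : (m <= (N m).1)%N.
  elim: m => [//|m IH] /=; have [[ij _] _] := hnx (N m).
  by rewrite ltnS (leq_trans IH).
exists (nx (N J)).1, (nx (N J)).2; have [nd lb] := hnx (N J); split => //.
  by have [ij _] := nd; rewrite (leq_trans (big J)).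
have /andP[h1 h2] := ht J.+1; rewrite /l /r /= in h1 h2.
rewrite half in h1; rewrite mulrDl half in h2.
set q := nx (N J) in h1 h2 *.
have g1 : q.2%:~R <= 2 ^+ q.1 * t by rewrite mulrC -ler_pdivrMr.
have g2 : 2 ^+ q.1 * t <= q.2%:~R + 1.
  rewrite mulrC -ler_pdivlMr// mulrDl (le_trans h2)// lerD2l !mul1r.
  by rewrite lef_pV2 ?posrE// exprS ler_peMl ?ler1n// ltW.
by rewrite ger0_norm; lra.
Qed.

End CoefficientGrowth.

(** * Ordinary points *)

Section Fubini.
Context d (T : measurableType d) (R : realType) (P : probability T R).
Local Notation lambda := (@lebesgue_measure R).

Lemma fubini_null (N : set (T * measurableTypeR R)) : measurable N ->
  (forall t, P (ysection N t) = 0%E) ->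
  {ae P, forall w, lambda (xsection N w) = 0%E}.
Proof.
move=> mN N0.
have mF := indic_measurable_fun_fubini_tonelli_F lambda mN.
have F0 : (\int[P]_x (fubini_F lambda (EFin \o \1_N) x) = 0)%E.
  rewrite (indic_fubini_tonelli P lambda mN) indic_fubini_tonelli_GE//.
  by apply: integral0_eq => t _ /=; exact: N0.
have := (ae_eq_integral_abs P measurableT mF).1.
rewrite (eq_integral (fubini_F lambda (EFin \o \1_N))); last first.
  by move=> x _; rewrite gee0_abs// indic_fubini_tonelli_F_ge0.
move=> /(_ F0); apply: filterS => w /= /(_ Logic.I).
by rewrite indic_fubini_tonelli_FE.
Qed.

End Fubini.

Section OrdinaryPoints.
Context d (T : measurableType d) (R : realType) (P : probability T R).
Local Notation lambda := (@lebesgue_measure R).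
Variable xi : nat -> int -> {RV P >-> R}.
Hypothesis xi_indep : independent_family (fun p : nat * int => xi p.1 p.2).
Hypothesis xi_normal : forall (j : nat) (k : int) (A : set R), measurable A ->
  distribution P (xi j k) A = normal_prob 0 1 A.

(** Centered at an integer [n], later [cell j t], so that the dependence on [t] takes countably many
    values. *)
Definition ordinary_weight (n : int) (j : nat) (k : int) : R :=
  2 * ordinary_gauge j * (1 + ln (1 + `|n%:~R - k%:~R|)).

Lemma ordinary_weight_ge n j k : 1 <= ordinary_weight n j k /\
  2 * ln (1 + j%:R) + 2 * ln (1 + `|n%:~R - k%:~R|) <= ordinary_weight n j k ^+ 2.
Proof.
rewrite /ordinary_weight /ordinary_gauge.
have j0 := ler0n R j.
set l := ln (1 + `|_|); have l0 : 0 <= l by rewrite ln_ge0// lerDl.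
have L : 2^-1 <= ln j.+2%:R :> R.
  by rewrite (le_trans ln2_ge_half)// ler_ln ?posrE// ler_nat.
have L1 : ln (1 + j%:R) <= ln j.+2%:R :> R.
  have a1 : 0 < 1 + j%:R :> R by lra.
  have a2 : 1 + j%:R <= j.+2%:R :> R by rewrite -[j.+2]addn2 natrD; lra.
  by rewrite ler_ln ?posrE.
have s1 : 1 <= 2 * Num.sqrt (ln j.+2%:R) :> R.
  by rewrite mulr2_sqrt -[leLHS]sqrtr1 ler_wsqrtr//; lra.
split; first by rewrite -[leLHS]mulr1 ler_pM//; lra.
rewrite exprMn exprMn sqr_sqrtr; last by lra.
have : 0 <= (ln j.+2%:R - 2^-1) * l :> R by rewrite mulr_ge0//; lra.
have : 0 <= ln j.+2%:R * l ^+ 2 :> R by rewrite mulr_ge0 ?sqr_ge0//; lra.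
rewrite -/l !expr2; lra.
Qed.

Lemma ordinary_growth (x : nat -> int -> R) (A t : R) : 0 <= A ->
  (forall j k, `|x j k| <= A * ordinary_weight (cell j t) j k) ->
  coef_growth x ordinary_gauge t (A * 4).
Proof.
move=> A0 hA j k; rewrite (le_trans (hA j k))// /ordinary_weight -!mulrA ler_wpM2l//.
have og : 0 <= ordinary_gauge j :> R by exact: sqrtr_ge0.
rewrite [leRHS](_ : _ = 2 * (ordinary_gauge j *
  (2 * (1 + ln (1 + `|2 ^+ j * t - k%:~R|))))); last by ring.
rewrite ler_wpM2l// ler_wpM2l//.
set u := `|2 ^+ j * t - k%:~R|; have u0 : 0 <= u by exact: normr_ge0.
have l0 : 0 <= ln (1 + u) by rewrite ln_ge0// lerDl.
have : ln (1 + `|(cell j t)%:~R - k%:~R|) <= ln (2 * (1 + u)).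
  rewrite ler_ln ?posrE ?mulr_gt0 ?ltr_pwDl//.
  have := ler_normB (2 ^+ j * t - k%:~R) (2 ^+ j * t - (cell j t)%:~R).
  rewrite [X in `|X|](_ : _ = (cell j t)%:~R - k%:~R); last by ring.
  by have := cell_dist j t; rewrite -/u; lra.
rewrite lnM ?posrE ?ltr_pwDl//; have := @ln2_le1 R; lra.
Qed.

(** There is one coefficient per level, exceeding the threshold with probability at least of order
    [(j + 2)^(-1/4)], whose sum diverges. *)
Lemma ordinary_lower (t : R) : P.-negligible [set w | ~ forall J : nat,
  exists j, (J <= j)%N /\ 2^-1 * ordinary_gauge j < `|xi j (cell j t) w|].
Proof.
have [c [c0 hc]] := probability_all_small xi_indep xi_normal.
pose F J := [set w | ~ exists j, (J <= j)%N /\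
  2^-1 * ordinary_gauge j < `|xi j (cell j t) w|].
suff hF J : P.-negligible (F J).
  apply: negligibleS (negligible_bigcup hF) => w /= nw.
  apply: contrapT => h; apply: nw => J; apply: contrapT => h'.
  by apply: h; exists J.
pose s m : seq (nat * int) :=
  [seq ((J + l)%N, cell (J + l) t) | l <- iota 0 (m * m)].
have us m : uniq (s m).
  rewrite map_inj_uniq; first exact: iota_uniq.
  by move=> x y [] /addnI.
pose r (p : nat * int) : R := 2^-1 * ordinary_gauge p.1.
have r0 p : 0 <= r p by apply: mulr_ge0 => //; exact: sqrtr_ge0.
pose e : R := (2 * (J + 2)%:R)^-1.
have J0 : 0 < (J + 2)%:R :> R by rewrite ltr0n addn2.
have e0 : 0 < e by rewrite invr_gt0 mulr_gt0.
have hs m : e * m%:R <= \sum_(p <- s m) expR (- r p ^+ 2).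
  have m0 := ler0n R m.
  (* Each index satisfies [J + l + 2 <= y ^+ 2], so each of the [m * m] terms is at least [y^-1]; as
     [y] is linear in [m], the sum grows at least linearly. *)
  pose y : R := (J + 2)%:R * (1 + m%:R).
  have y0 : 0 < y by rewrite mulr_gt0// ltr_pwDl.
  apply: (@le_trans _ _ (\sum_(p <- s m) y^-1)).
    rewrite big_const_seq count_predT size_map size_iota iter_addr_0.
    rewrite -[leRHS]mulr_natl natrM ler_pdivlMr// /e /y.
    have [->|m1] := eqVneq m 0%N; first by rewrite !mulr0 mul0r.
    have m1' : 1 <= m%:R :> R by rewrite ler1n lt0n.
    rewrite (_ : (2 * (J + 2)%:R)^-1 * m%:R * ((J + 2)%:R * (1 + m%:R)) =
      m%:R * ((1 + m%:R) / 2)); last by field; rewrite gt_eqF.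
    by rewrite ler_wpM2l//; lra.
  rewrite !big_map big_seq [leRHS]big_seq; apply: ler_sum => l.
  rewrite mem_iota add0n/= => lm.
  rewrite -[y]lnK ?posrE// -expRN ler_expR lerN2 /r/= /ordinary_gauge exprMn.
  have ge1 : 0 <= ln (J + l).+2%:R :> R by rewrite ln_ge0// ler1n.
  rewrite sqr_sqrtr//.
  have : ln (J + l).+2%:R <= ln (y ^+ 2).
    rewrite ler_ln ?posrE ?exprn_gt0// /y exprMn.
    have lm' : l%:R <= m%:R * m%:R :> R by rewrite -natrM ler_nat ltnW.
    have -> : (J + l).+2%:R = (J + 2)%:R + l%:R :> R by rewrite -natrD; congr _%:R; lia.
    have J1 : 1 <= (J + 2)%:R :> R by rewrite ler1n addn2.
    rewrite (@le_trans _ _ ((J + 2)%:R * (1 + m%:R) ^+ 2))//.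
      by rewrite expr2; nra.
    by rewrite ler_wpM2r ?sqr_ge0// expr2 ler_peMr ?(ltW J0).
  by rewrite lnXn// mulr2n; lra.
have := @negligible_bigcap_le _ _ _ P
  (fun m => \bigcap_(p in [set` s m]) (xi p.1 p.2 @^-1` [set y : R | `|y| <= r p]))
  (fun m => expR (- (c * e * m%:R))).
move=> h; apply: negligibleS (h _ _ _).
- move=> w /= nw m _ p /= ps; rewrite leNgt; apply/negP => lt.
  apply: nw; case/mapP: ps => l _ pE; exists p.1.
  by rewrite pE/= leq_addr; split => //; rewrite pE in lt.
- by move=> m; apply: measurable_finite_bigcap => p; exact: measurable_norm_le.
- move=> m; apply: (le_trans (hc (s m) r (us m) r0)).
  by rewrite lee_fin ler_expR lerN2 -!mulrA ler_wpM2l ?(ltW c0).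
- by move=> eps eps0; apply: expRN_nat_small => //; rewrite mulr_gt0.
Qed.

(** The constant is a natural number so that its existence is a countable union of events. *)
Definition ordinary_at (w : T) (t : R) :=
  (exists A : nat, forall j k,
    `|xi j k w| <= A%:R * ordinary_weight (cell j t) j k) /\
  forall J : nat, exists j, (J <= j)%N /\
    2^-1 * ordinary_gauge j < `|xi j (cell j t) w|.

Lemma ordinary_at_ae (t : R) : P.-negligible [set w | ~ ordinary_at w t].
Proof.
have h1 := ae_bounded_by xi_normal (y := fun j => (cell j t)%:~R)
  (fun j k => ordinary_weight_ge (cell j t) j k).
apply: negligibleS (negligibleU h1 (ordinary_lower t)) => w /= nO.
apply: contrapT => /not_orP[/contrapT[A [A0 hA]] /contrapT hL].
apply: nO; split => //; exists (Num.truncn A).+1 => j k.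
rewrite (le_trans (hA j k))// ler_wpM2r//.
  by rewrite (le_trans ler01)//; have [] := ordinary_weight_ge (cell j t) j k.
by have /andP[_ /ltW] := truncn_itv A0.
Qed.

Lemma measurable_cell (j : nat) (n : int) :
  measurable ([set t | cell j t = n] : set (measurableTypeR R)).
Proof.
rewrite (_ : [set t | _] = `[n%:~R / 2 ^+ j, (n%:~R + 1) / 2 ^+ j[%classic); last first.
  have p0 : 0 < 2 ^+ j :> R by rewrite exprn_gt0.
  apply/seteqP; split => t /=; rewrite in_itv/= ler_pdivrMr// ltr_pdivlMr//.
    by move=> <-; rewrite [t * _]mulrC cell_itv.
  by rewrite [t * _]mulrC => /andP[]; exact: cell_eq.
exact: measurable_itv.
Qed.

(* A countable union of rectangles, as [cell j] takes countably many values. *)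
Lemma measurable_cell_event (j : nat) (B : int -> set T) :
  (forall n, measurable (B n)) ->
  measurable [set z : T * measurableTypeR R | B (cell j z.2) z.1].
Proof.
move=> mB.
rewrite (_ : [set z | _] =
    exists_index (fun _ n => B n `*` [set t | cell j t = n])).
  apply: measurable_exists_index => _ n; apply: measurableX => //.
  exact: measurable_cell.
apply/seteqP; split => [[w t] /= h|[w t] [_ [n [/= h e]]]]; last by rewrite e.
by exists 0%N, (cell j t).
Qed.

(** Tonelli's theorem needs joint measurability in [w] and [t], not only the negligibility of the
    event for each [t]. *)
Lemma measurable_ordinary :
  measurable [set z : T * measurableTypeR R | ~ ordinary_at z.1 z.2].
Proof.
rewrite (_ : [set z | _] = ~` (
  (\bigcup_(A in setT) ~` exists_index (fun j k => ~` [set z : T * measurableTypeR R |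
     (xi j k @^-1` [set y : R | `|y| <= (A : nat)%:R * ordinary_weight (cell j z.2) j k])
       z.1])) `&`
  (\bigcap_(J in setT) \bigcup_(j in [set j | (J <= j)%N])
     [set z : T * measurableTypeR R | (xi j (cell j z.2) @^-1`
       [set y : R | 2^-1 * ordinary_gauge j < `|y|]) z.1]))).
  apply: measurableC; apply: measurableI.
    apply: bigcupT_measurable => A; apply: measurableC.
    apply: measurable_exists_index => j k; apply: measurableC.
    apply: (@measurable_cell_event j (fun n => xi j k @^-1`
      [set y : R | `|y| <= A%:R * ordinary_weight n j k])) => n.
    by apply: measurable_xi_preimage; exact: measurable_norm_le.
  apply: bigcapT_measurable => J; apply: bigcup_measurable => j _.
  apply: (@measurable_cell_event j (fun n => xi j n @^-1`
      [set y : R | 2^-1 * ordinary_gauge j < `|y|])) => n.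
  by apply: measurable_xi_preimage; exact: measurable_norm_gt.
apply/seteqP; split => [[w t] /= nO [[A _ hA] hL]|[w t] /= nO [[A hA] hL]]; apply: nO.
  split; last by move=> J; have [j Jj h] := hL J Logic.I; exists j.
  by exists A => j k; apply: contrapT => h; apply: hA; exists j, k.
split; first by exists A => // -[j [k]]; apply; exact: hA.
by move=> J _; have [j [Jj h]] := hL J; exists j.
Qed.

Lemma ordinary_ae :
  {ae P, forall w, {ae lambda, forall t, ordinary_at w t}}.
Proof.
have mN := measurable_ordinary.
apply: filterS (fubini_null mN _).
  move=> w h; exists (xsection [set z | ~ ordinary_at z.1 z.2] w); split => //.
    exact: measurable_xsection.
  by move=> t /= nO; rewrite xsectionE.
move=> t; apply/negligibleP; first exact: measurable_ysection.
by apply: negligibleS (ordinary_at_ae t) => w; rewrite ysectionE.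
Qed.

End OrdinaryPoints.

(** * Localization in the interval and the three kinds of points *)

Lemma open_dyadic_node (R : realType) (I : set R) : open I -> I !=set0 ->
  exists (i : nat) (kappa : int), forall t : R,
    kappa%:~R <= 2 ^+ i * t <= kappa%:~R + 1 -> I t.
Proof.
move=> Iopen [p Ip]; have /nbhs_ballP[e /= e0 eI] := open_nbhs_nbhs (conj Iopen Ip).
have [n /andP[_ hn]] : exists n, 2 ^+ n <= 1 + e^-1 < 2 ^+ n.+1.
  by apply: dyadic_bracket; rewrite lerDl invr_ge0 ltW.
exists n.+1, (cell n.+1 p) => t /andP[t1 t2]; apply: eI.
have /andP[p1 p2] := cell_itv n.+1 p.
have P0 : 0 < 2 ^+ n.+1 :> R by rewrite exprn_gt0.
have h : 2 ^+ n.+1 * `|p - t| <= 1.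
  rewrite -(gtr0_norm P0) -normrM ler_norml mulrBr.
  by apply/andP; split; lra.
rewrite /ball/= -(ltr_pM2l P0) (le_lt_trans h)// -ltr_pdivrMr// mul1r.
by rewrite (lt_trans _ hn)// ltrDr.
Qed.

Lemma compact_unit_bounds (R : realType) (K : set R) :
  K `<=` `]0, 1[ -> compact K -> K !=set0 ->
  exists a b : R, [/\ 0 < a, b < 1 & forall z, K z -> a <= z <= b].
Proof.
move=> K01 Kc K0.
have cK : {within K, continuous (@id R)}.
  by apply: continuous_subspaceT => x; exact: cvg_id.
have [a aK ha] := compact_EVT_min K0 Kc cK.
have [b bK hb] := compact_EVT_max K0 Kc cK.
rewrite !inE in aK bK.
have /= := K01 _ aK; have /= := K01 _ bK; rewrite !in_itv/= => /andP[_ b1] /andP[a0 _].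
exists a, b; split => // z Kz.
by apply/andP; split; [apply: ha|apply: hb]; rewrite inE.
Qed.

Unset Implicit Arguments.

Theorem theorem5p1 (R : realType)
    (d : measure_display) (Omega : measurableType d) (P : probability Omega R)
    (psi psit : R -> R) (hpsi : wavelet_pair psi psit)
    (K : set R) (K01 : K `<=` `]0, 1[) (Kcompact : compact K)
    (H : R -> R) (HK : forall x, K (H x)) (Hlog : log_holder H)
    (xi : nat -> int -> {RV P >-> R})
    (xi_indep : independent_family (fun p : nat * int => xi p.1 p.2))
    (xi_normal : forall (j : nat) (k : int) (A : set R), measurable A ->
       distribution P (xi j k) A = normal_prob 0 1 A)
    (I : set R) (Iopen : open I) (Iitv : is_interval I) (I0 : I !=set0) :
  {ae P, forall w : Omega,
    let f := wavelet_series psi H (fun j k => xi j k w) in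
    [/\ {ae lebesgue_measure, forall t : R, I t ->
           exact_modulus_at f (omega_o (H t)) t},
        exists t : R, I t /\ exact_modulus_at f (omega_r (H t)) t &
        exists t : R, I t /\ exact_modulus_at f (omega_s (H t)) t]}.
Proof.
have K0 : K !=set0 by exists (H 0).
have [a [b [a0 b1 Kab]]] := compact_unit_bounds K01 Kcompact K0.
have Hab z : a <= H z <= b by exact: Kab.
have H0 z : 0 < H z by have /andP[h _] := Hab z; exact: lt_le_trans h.
have H1 z : H z < 1 by have /andP[_ h] := Hab z; exact: le_lt_trans b1.
have [i [kappa hI]] := open_dyadic_node Iopen I0.
have ae1 := negligible_ae (ae_bounded_by xi_normal (y := fun=> 0)
  (@global_weight_ge R)) (fun w => @contrapT _).
have ae2 := negligible_ae (rapid_lower xi_indep xi_normal) (fun w => @contrapT _).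
have ae3 := negligible_ae (slow_lower xi_indep xi_normal) (fun w h => h).
have ae4 := negligible_ae (negligible_no_survival xi_indep xi_normal i kappa)
  (fun w => @contrapT _).
have ae5 := ordinary_ae xi_indep xi_normal.
apply: filterS (filterI ae1 (filterI ae2 (filterI ae3 (filterI ae4 ae5)))).
move=> w [[A [A0 hA]] [hrapid [hslow [[A' [A'0 hA']] hord]]]].
split.
- apply: (negligibleS _ hord) => t /= nE hO; apply: nE => It.
  have [[B hB] hL] := hO.
  have hC := ordinary_growth (ler0n R B) hB.
  apply: (exact_modulus_of_coef hpsi ordinary_gauge_growth a0 b1 Hab Hlog _ hC).
  + by rewrite mulr_ge0.
  + exact: ordinary_gauge_compat.
  exists 2^-1; split; first by lra.
  move=> J; have [j [Jj h]] := hL J; exists j, (cell j t).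
  by split => //; [exact: cell_dist|exact: ltW].
- have [t [/hI It [c [c0 hc]]]] := rapid_point i kappa hrapid.
  have [C [C0 hC]] := rapid_growth A0 hA t.
  exists t; split => //.
  apply: (exact_modulus_of_coef hpsi rapid_gauge_growth a0 b1 Hab Hlog C0 hC).
    exact: rapid_gauge_compat.
  by exists c.
have [N [N0 Nc hN]] := survival_branch hA'.
have [t [/hI It [C [C0 hC]]]] :
    exists t : R, kappa%:~R <= 2 ^+ i * t <= kappa%:~R + 1 /\
    exists C : R, 0 <= C /\ coef_growth (fun j k => xi j k w) slow_gauge t C.
  apply: (slow_growth_branch A0 hA A'0 N0 Nc) => m j k mjk.
  rewrite leNgt; apply/negP => lt; apply: (hN m).
  by exists j, k.
exists t; split => //.
apply: (exact_modulus_of_coef hpsi slow_gauge_growth a0 b1 Hab Hlog C0 hC).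
  exact: slow_gauge_compat.
exists 4^-1; split; first by lra.
(* Otherwise the coefficients on the dyadic branch of [t] would all be small from level [J] on,
   which [hslow] excludes for every [t] at once. *)
move=> J; apply: contrapT => h; apply: hslow; exists t, J => j Jj.
rewrite ltNge; apply/negP => lt; apply: h; exists j, (cell j t).
by split => //; [exact: cell_dist|rewrite /slow_gauge mulr1].
Qed.
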